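(* The system $\mathsf{RCA}_0^\omega$ proves $\mathsf{WHBU}\to\mathsf{NIN}$ and also proves $\mathsf{BCT}\to\mathsf{NIN}$.
   Context: Finite types: $0$ is a type (natural numbers), and if $\sigma,\tau$ are types then so is $\sigma\to\tau$; $1:=0\to 0$ and $n+1:=n\to 0$; superscripts indicate types. $\mathsf{L}_\omega$ is the many-sorted language with variables of every finite type, constants $0,1,<_0,+_0,\times_0,=_0$ (with usual meaning), typed combinators $\Pi,\Sigma$, and recursor constants $\mathbf{R}_\sigma$. For $\tau=(\tau_1\to\dots\to\tau_k\to 0)$, $x=_\tau y$ abbreviates $\forall z_1^{\tau_1}\dots z_k^{\tau_k}(xz_1\dots z_k=_0 yz_1\dots z_k)$. $\mathsf{QF\text{-}AC}^{\sigma,\tau}$ is the schema $(\forall x^\sigma)(\exists y^\tau)A(x,y)\to(\exists Y^{\sigma\to\tau})(\forall x^\sigma)A(x,Y(x))$ for quantifier-free $A$ of $\mathsf{L}_\omega$. $\mathsf{RCA}_0^\omega$ (Kohlenbach's base theory, classical logic) has the following axioms: ordered semi-ring axioms for $0,1,<_0,+_0,\times_0$; defining axioms of $\Pi,\Sigma$ (giving $\lambda$-abstraction); $\mathbf{R}_0(f,m,0)=m$ and $\mathbf{R}_0(f,m,n+1)=f(n,\mathbf{R}_0(f,m,n))$; extensionality $x=_\rho y\to\varphi(x)=_\tau\varphi(y)$ for all types $\rho,\tau$; induction for quantifier-free formulas of $\mathsf{L}_\omega$; and $\mathsf{QF\text{-}AC}^{1,0}$. Finite sequences are coded as usual. Inside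 this theory a real is a sequence of rationals $(q_n)$ with $|q_n-q_{n+i}|<2^{-n}$ for all $n,i$; reals $x,y$ represented by $(q_n),(r_n)$ satisfy $x=_{\mathbb{R}}y$ iff $|q_n-r_n|\le 2^{-n+1}$ for all $n$; $<_{\mathbb{R}}$ is defined similarly. Functions on $[0,1]$ or $\mathbb{R}$ with values in $\mathbb{N}$ or $\mathbb{R}$ are objects of the corresponding finite type that map $=_{\mathbb{R}}$-equal reals to equal values. $\mathsf{NIN}$: for any $Y:[0,1]\to\mathbb{N}$ there are $x,y\in[0,1]$ with $x\neq_{\mathbb{R}}y$ and $Y(x)=Y(y)$. $\mathsf{WHBU}$: for any $\Psi:\mathbb{R}\to\mathbb{R}^+$ and $\varepsilon>_{\mathbb{R}}0$ there are pairwise distinct $y_0,\dots,y_k\in[0,1]$ with $1-\varepsilon<_{\mathbb{R}}\sum_{i\le k}|J^\Psi_{y_i}|$, where $I^\Psi_x:=(x-\Psi(x),x+\Psi(x))$, $J^\Psi_{y_0}:=I^\Psi_{y_0}$, $J^\Psi_{y_{i+1}}:=I^\Psi_{y_{i+1}}\setminus\bigcup_{j\le i}I^\Psi_{y_j}$, and $|J|$ is the total length of the finite union of intervals $J$. $\mathsf{BCT}$ (Baire category theorem for open sets given by characteristic functions): for any sequence $(O_n)_{n\in\mathbb{N}}$ of open and dense sets in $[0,1]$ there is $x\in[0,1]$ with $x\in O_n$ for all $n$. Here an open set $O$ is represented by a function $Y$ to $\mathbb{R}$, where ''$x\in O$'' means $Y(x)>_{\mathbb{R}}0$, and where $x\in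 O$ implies that there is $n\in\mathbb{N}$ such that $y\in O$ for all $y$ (in the space) with $|x-y|<2^{-n}$; a sequence of open sets is given by a sequence of such functions. *)

(* Defs.v *)
From Stdlib Require Import List.
Import ListNotations.
Set Implicit Arguments.
Unset Strict Implicit.
Unset Printing Implicit Defensive.

(** * The language L_omega

    Terms and formulas are intrinsically typed; variables are de Bruijn indices
    into a context, the list of the types of the free variables.  Terms contain
    no binder: lambda-abstraction is defined from [Pi] and [Sigma] below. *)

Inductive fty : Type :=
| tN : fty
| tArr : fty -> fty -> fty.

Declare Scope fty_scope.
Delimit Scope fty_scope with fty.
Bind Scope fty_scope with fty.
Notation "s ⇒ t" := (tArr s t) (at level 55, right associativity) : fty_scope.

Notation T1 := (tArr tN tN).

Definition ctx : Type := list fty.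

Inductive var : ctx -> fty -> Type :=
| V0 : forall (G : ctx) (t : fty), var (t :: G) t
| VS : forall (G : ctx) (s t : fty), var G t -> var (s :: G) t.
Arguments V0 {G t}.
Arguments VS {G s t} v.

Inductive const : fty -> Type :=
| Zero : const tN
| One : const tN
| Plus : const (tN ⇒ tN ⇒ tN)
| Times : const (tN ⇒ tN ⇒ tN)
| Pi : forall r s : fty, const (r ⇒ s ⇒ r)
| Sigma : forall r s t : fty, const ((r ⇒ s ⇒ t) ⇒ (r ⇒ s) ⇒ r ⇒ t)
| Rec : forall s : fty, const ((tN ⇒ s ⇒ s) ⇒ s ⇒ tN ⇒ s).

Inductive term (G : ctx) : fty -> Type :=
| Var : forall t : fty, var G t -> term G t
| Cst : forall t : fty, const t -> term G t
| App : forall s t : fty, term G (s ⇒ t) -> term G s -> term G t.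
Arguments Var {G t} v.
Arguments Cst {G t} c.
Arguments App {G s t} f a.

Inductive form (G : ctx) : Type :=
| Bot : form G
| Eq0 : term G tN -> term G tN -> form G
| Lt0 : term G tN -> term G tN -> form G
| And : form G -> form G -> form G
| Or : form G -> form G -> form G
| Imp : form G -> form G -> form G
| All : forall t : fty, form (t :: G) -> form G
| Ex : forall t : fty, form (t :: G) -> form G.
Arguments Bot {G}.
Arguments All {G} t A.
Arguments Ex {G} t A.

Fixpoint qf (G : ctx) (A : form G) : Prop :=
  match A with
  | Bot | Eq0 _ _ | Lt0 _ _ => True
  | And A B | Or A B | Imp A B => qf A /\ qf B
  | All _ _ | Ex _ _ => False
  end.

Definition sub (G D : ctx) : Type := forall t : fty, var G t -> term D t.

Definition scons (G D : ctx) (u : fty) (a : term D u) (s : sub G D) :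
    sub (u :: G) D :=
  fun t v =>
    match v in var E t'
      return match E with
             | [] => unit
             | u' :: G' => term D u' -> sub G' D -> term D t'
             end
    with
    | V0 => fun a _ => a
    | VS w => fun _ s => s _ w
    end a s.

Fixpoint tsub (G D : ctx) (s : sub G D) (t : fty) (a : term G t) : term D t :=
  match a with
  | Var v => s _ v
  | Cst c => Cst c
  | App f b => App (tsub s f) (tsub s b)
  end.

Definition shift (G : ctx) (u : fty) : sub G (u :: G) := fun t v => Var (VS v).

Definition up (G D : ctx) (u : fty) (s : sub G D) : sub (u :: G) (u :: D) :=
  scons (Var V0) (fun t v => tsub (@shift D u) (s t v)).

Fixpoint fsub (G D : ctx) (s : sub G D) (A : form G) : form D :=
  match A with
  | Bot => Bot
  | Eq0 a b => Eq0 (tsub s a) (tsub s b)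
  | Lt0 a b => Lt0 (tsub s a) (tsub s b)
  | And A B => And (fsub s A) (fsub s B)
  | Or A B => Or (fsub s A) (fsub s B)
  | Imp A B => Imp (fsub s A) (fsub s B)
  | All t A => All t (fsub (up s) A)
  | Ex t A => Ex t (fsub (up s) A)
  end.

Definition fwk (G : ctx) (u : fty) (A : form G) : form (u :: G) :=
  fsub (@shift G u) A.

(** ** Named notation for binders

    [ext G D] says that [D] extends [G] by further variables.  In [∀ x : t, A]
    the name [x] stands for the newest variable, a term over [t :: G]; every
    later use is written [$x], which weakens [x] to the context at hand. *)

Class ext (G D : ctx) : Type := ext_var : forall t : fty, var G t -> var D t.
#[global] Hint Mode ext + + : typeclass_instances.
#[global] Instance ext_refl (G : ctx) : ext G G | 0 := fun t v => v.
#[global] Instance ext_cons (G D : ctx) (s : fty) (e : ext G D) :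
  ext G (s :: D) | 1 := fun t v => VS (e t v).

Definition ext_sub (G D : ctx) (e : ext G D) : sub G D :=
  fun t v => Var (ext_var v).

Definition wk (G D : ctx) {e : ext G D} (t : fty) (a : term G t) : term D t :=
  tsub (ext_sub e) a.

(** [inst A a] is A(a), and [inst2 A a b] is A(a, b); the newest variable of a
    formula comes last, so [b] replaces [V0] in the latter. *)

Definition inst (G D : ctx) {e : ext G D} (u : fty) (A : form (u :: G))
    (a : term D u) : form D :=
  fsub (scons a (ext_sub e)) A.

Definition inst2 (G D : ctx) {e : ext G D} (u w : fty)
    (A : form (w :: u :: G)) (a : term D u) (b : term D w) : form D :=
  fsub (scons b (scons a (ext_sub e))) A.

Definition bind_all (G : ctx) (t : fty)
    (A : term (t :: G) t -> form (t :: G)) : form G := All t (A (Var V0)).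

Definition bind_ex (G : ctx) (t : fty)
    (A : term (t :: G) t -> form (t :: G)) : form G := Ex t (A (Var V0)).

(** Bracket abstraction.  A subterm without the abstracted variable is put
    under a single [Pi], which keeps nested abstractions small. *)

Definition unshift_var (G : ctx) (s t : fty) (v : var (s :: G) t) :
    option (term G t) :=
  match v in var E t'
    return match E with [] => unit | _ :: G' => option (term G' t') end
  with
  | V0 => None
  | VS w => Some (Var w)
  end.

(** [unshift a = Some b] iff [a] is the weakening of [b]. *)
Fixpoint unshift (G : ctx) (s t : fty) (a : term (s :: G) t) :
    option (term G t) :=
  match a with
  | Var v => unshift_var v
  | Cst c => Some (Cst c)
  | App f b =>
      match unshift f, unshift b with
      | Some f', Some b' => Some (App f' b')
      | _, _ => None
      end
  end.

Definition lam_var (G : ctx) (s t : fty) (v : var (s :: G) t) :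
    term G (s ⇒ t) :=
  match v in var E t'
    return match E with [] => unit | s' :: G' => term G' (s' ⇒ t') end
  with
  | @V0 _ u => App (App (Cst (Sigma u (u ⇒ u) u)) (Cst (Pi u (u ⇒ u))))
                   (Cst (Pi u u))
  | VS w => App (Cst (Pi _ _)) (Var w)
  end.

Fixpoint lam (G : ctx) (s t : fty) (a : term (s :: G) t) : term G (s ⇒ t) :=
  match unshift a with
  | Some b => App (Cst (Pi _ _)) b
  | None =>
      match a with
      | Var v => lam_var v
      | Cst c => App (Cst (Pi _ _)) (Cst c)
      | App f b => App (App (Cst (Sigma _ _ _)) (lam f)) (lam b)
      end
  end.

Definition bind_lam (G : ctx) (s t : fty)
    (a : term (s :: G) s -> term (s :: G) t) : term G (s ⇒ t) :=
  lam (a (Var V0)).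

Declare Scope L_scope.
Delimit Scope L_scope with L.
Bind Scope L_scope with term.
Bind Scope L_scope with form.

Notation "$ x" := (wk x) (at level 5, x at level 4, format "$ x") : L_scope.
Notation "f · a" := (App f a) (at level 20, left associativity) : L_scope.
Notation "0" := (Cst Zero) : L_scope.
Notation "1" := (Cst One) : L_scope.
Notation "a + b" := (App (App (Cst Plus) a) b) : L_scope.
Notation "a * b" := (App (App (Cst Times) a) b) : L_scope.
Notation "a == b" := (Eq0 a b) (at level 70, no associativity) : L_scope.
Notation "a < b" := (Lt0 a b) : L_scope.
Notation "A /\ B" := (And A B) : L_scope.
Notation "A \/ B" := (Or A B) : L_scope.
Notation "A --> B" := (Imp A B) (at level 90, right associativity) : L_scope.
Notation "~ A" := (Imp A Bot) : L_scope.
Notation "A <--> B" := (And (Imp A B) (Imp B A))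
  (at level 95, no associativity) : L_scope.
Notation "'∀' x : t , A" := (bind_all (t := t%fty) (fun x => A%L))
  (at level 200, x name, t at level 99, A at level 200) : L_scope.
Notation "'∃' x : t , A" := (bind_ex (t := t%fty) (fun x => A%L))
  (at level 200, x name, t at level 99, A at level 200) : L_scope.
Notation "'λ' x : t , a" := (bind_lam (s := t%fty) (fun x => a%L))
  (at level 200, x name, t at level 99, a at level 200) : L_scope.

Open Scope L_scope.

Fixpoint eqt (t : fty) : forall G : ctx, term G t -> term G t -> form G :=
  match t with
  | tN => fun G x y => x == y
  | (s ⇒ t')%fty => fun G x y => ∀ z : s, eqt ($x · $z) ($y · $z)
  end.

(** * Derivability: classical many-sorted natural deduction with equality on
    type [tN].  A theory is a set of possibly open formulas, whose free
    variables are read universally. *)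

Definition theory : Type := forall G : ctx, form G -> Prop.

Inductive nd (T : theory) : forall G : ctx, list (form G) -> form G -> Prop :=
| nd_hyp : forall G H (A : form G), In A H -> nd T H A
| nd_ax : forall G H (A : form G), T G A -> nd T H A
| nd_raa : forall G H (A : form G), nd T ((~ A) :: H) Bot -> nd T H A
| nd_andI : forall G H (A B : form G), nd T H A -> nd T H B -> nd T H (A /\ B)
| nd_andE1 : forall G H (A B : form G), nd T H (A /\ B) -> nd T H A
| nd_andE2 : forall G H (A B : form G), nd T H (A /\ B) -> nd T H B
| nd_orI1 : forall G H (A B : form G), nd T H A -> nd T H (A \/ B)
| nd_orI2 : forall G H (A B : form G), nd T H B -> nd T H (A \/ B)
| nd_orE : forall G H (A B C : form G),
    nd T H (A \/ B) -> nd T (A :: H) C -> nd T (B :: H) C -> nd T H C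
| nd_impI : forall G H (A B : form G), nd T (A :: H) B -> nd T H (A --> B)
| nd_impE : forall G H (A B : form G),
    nd T H (A --> B) -> nd T H A -> nd T H B
| nd_allI : forall G H t (A : form (t :: G)),
    nd T (map (@fwk G t) H) A -> nd T H (All t A)
| nd_allE : forall G H t (A : form (t :: G)) (a : term G t),
    nd T H (All t A) -> nd T H (inst A a)
| nd_exI : forall G H t (A : form (t :: G)) (a : term G t),
    nd T H (inst A a) -> nd T H (Ex t A)
| nd_exE : forall G H t (A : form (t :: G)) (C : form G),
    nd T H (Ex t A) -> nd T (A :: map (@fwk G t) H) (fwk t C) -> nd T H C
| nd_eq_refl : forall G H (a : term G tN), nd T H (a == a)
| nd_eq_subst : forall G H (A : form (tN :: G)) (a b : term G tN),
    nd T H (a == b) -> nd T H (inst A a) -> nd T H (inst A b).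

Definition proves (T : theory) (A : form []) : Prop := nd T [] A.
Notation "T ⊢ A" := (proves T A%L) (at level 99, no associativity) : type_scope.

Definition QF_IND (G : ctx) (A : form (tN :: G)) : form G :=
  inst A 0 /\ (∀ n : tN, inst A $n --> inst A ($n + 1)) -->
  ∀ n : tN, inst A $n.

Definition AC (s t : fty) (G : ctx) (A : form (t :: s :: G)) : form G :=
  (∀ x : s, ∃ y : t, inst2 A $x $y) -->
  ∃ Y : s ⇒ t, ∀ x : s, inst2 A $x ($Y · $x).

Definition rec (G : ctx) (f : term G (tN ⇒ tN ⇒ tN)) (m n : term G tN) :
    term G tN := Cst (Rec tN) · f · m · n.

(** The language has recursors of all types; only the one of type [tN] has
    axioms. *)
Inductive RCA0w : theory :=
| ax_addA : forall G, RCA0w (G := G)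
    (∀ x : tN, ∀ y : tN, ∀ z : tN, $x + ($y + $z) == ($x + $y) + $z)
| ax_addC : forall G, RCA0w (G := G) (∀ x : tN, ∀ y : tN, $x + $y == $y + $x)
| ax_add0 : forall G, RCA0w (G := G) (∀ x : tN, $x + 0 == $x)
| ax_mulA : forall G, RCA0w (G := G)
    (∀ x : tN, ∀ y : tN, ∀ z : tN, $x * ($y * $z) == ($x * $y) * $z)
| ax_mulC : forall G, RCA0w (G := G) (∀ x : tN, ∀ y : tN, $x * $y == $y * $x)
| ax_mul1 : forall G, RCA0w (G := G) (∀ x : tN, $x * 1 == $x)
| ax_mul0 : forall G, RCA0w (G := G) (∀ x : tN, $x * 0 == 0)
| ax_mulD : forall G, RCA0w (G := G)
    (∀ x : tN, ∀ y : tN, ∀ z : tN, $x * ($y + $z) == $x * $y + $x * $z)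
| ax_ltI : forall G, RCA0w (G := G) (∀ x : tN, ~ $x < $x)
| ax_ltT : forall G, RCA0w (G := G)
    (∀ x : tN, ∀ y : tN, ∀ z : tN, $x < $y --> $y < $z --> $x < $z)
| ax_lt_total : forall G, RCA0w (G := G)
    (∀ x : tN, ∀ y : tN, $x < $y \/ $x == $y \/ $y < $x)
| ax_lt_add : forall G, RCA0w (G := G)
    (∀ x : tN, ∀ y : tN, ∀ z : tN, $x < $y --> $x + $z < $y + $z)
| ax_lt_mul : forall G, RCA0w (G := G)
    (∀ x : tN, ∀ y : tN, ∀ z : tN, $x < $y --> 0 < $z --> $x * $z < $y * $z)
| ax_lt01 : forall G, RCA0w (G := G) (0 < 1)
(* nonnegativity and discreteness, redundant given induction *)
| ax_ge0 : forall G, RCA0w (G := G) (∀ x : tN, ~ $x < 0)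
| ax_ltS : forall G, RCA0w (G := G)
    (∀ x : tN, ∀ y : tN, $x < $y + 1 <--> $x < $y \/ $x == $y)
| ax_Pi : forall G r s, RCA0w (G := G)
    (∀ x : r, ∀ y : s, eqt (Cst (Pi r s) · $x · $y) $x)
| ax_Sigma : forall G r s t, RCA0w (G := G)
    (∀ x : r ⇒ s ⇒ t, ∀ y : r ⇒ s, ∀ z : r,
      eqt (Cst (Sigma r s t) · $x · $y · $z) ($x · $z · ($y · $z)))
| ax_R0_0 : forall G, RCA0w (G := G)
    (∀ f : tN ⇒ tN ⇒ tN, ∀ m : tN, rec $f $m 0 == $m)
| ax_R0_S : forall G, RCA0w (G := G)
    (∀ f : tN ⇒ tN ⇒ tN, ∀ m : tN, ∀ n : tN,
      rec $f $m ($n + 1) == $f · $n · rec $f $m $n)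
| ax_ext : forall G r t, RCA0w (G := G)
    (∀ f : r ⇒ t, ∀ x : r, ∀ y : r, eqt $x $y --> eqt ($f · $x) ($f · $y))
(* in the schemas, [A] may contain parameters of any type from [G] *)
| ax_ind : forall G (A : form (tN :: G)), qf A -> RCA0w (QF_IND A)
| ax_QF_AC10 : forall G (A : form (tN :: T1 :: G)), qf A -> RCA0w (AC A).

Definition Pred {G : ctx} : term G (tN ⇒ tN) :=
  λ n : tN, rec (λ k : tN, λ m : tN, $k) 0 $n.

Definition Monus {G : ctx} : term G (tN ⇒ tN ⇒ tN) :=
  λ a : tN, λ b : tN, rec (λ k : tN, λ m : tN, Pred · $m) $a $b.
Notation "a ∸ b" := (App (App Monus a) b)
  (at level 50, left associativity) : L_scope.

Definition Pow2 {G : ctx} : term G (tN ⇒ tN) :=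
  λ n : tN, rec (λ k : tN, λ m : tN, $m + $m) 1 $n.

(** Integer square root: the step from k to k+1 adds 1 to the root r exactly
    when (r+1)^2 <= k+1. *)
Definition Sqrt {G : ctx} : term G (tN ⇒ tN) :=
  λ n : tN,
    rec (λ k : tN, λ r : tN, $r + (1 ∸ (($r + 1) * ($r + 1) ∸ ($k + 1)))) 0 $n.

(** The pairing (a+b)^2 + a.  Since a + b is the integer square root of the
    code, the projections below invert it; they are total functions. *)
Definition Pair {G : ctx} : term G (tN ⇒ tN ⇒ tN) :=
  λ a : tN, λ b : tN, ($a + $b) * ($a + $b) + $a.
Definition Fst {G : ctx} : term G (tN ⇒ tN) :=
  λ c : tN, $c ∸ (Sqrt · $c) * (Sqrt · $c).
Definition Snd {G : ctx} : term G (tN ⇒ tN) :=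
  λ c : tN, Sqrt · $c ∸ Fst · $c.

(** Every number q codes a rational, namely (a - b)/(c + 1) for
    a = Fst (Fst q), b = Snd (Fst q), c = Snd q.  Codes are not unique. *)
Definition Qpos {G : ctx} : term G (tN ⇒ tN) := λ q : tN, Fst · (Fst · $q).
Definition Qneg {G : ctx} : term G (tN ⇒ tN) := λ q : tN, Snd · (Fst · $q).
Definition Qden {G : ctx} : term G (tN ⇒ tN) := λ q : tN, Snd · $q + 1.

(** A code of (a - b)/d, for d > 0. *)
Definition Qmk {G : ctx} : term G (tN ⇒ tN ⇒ tN ⇒ tN) :=
  λ a : tN, λ b : tN, λ d : tN, Pair · (Pair · $a · $b) · ($d ∸ 1).

Definition Qlt {G : ctx} (p q : term G tN) : form G :=
  (Qpos · p) * (Qden · q) + (Qneg · q) * (Qden · p)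
  < (Qpos · q) * (Qden · p) + (Qneg · p) * (Qden · q).
Definition Qle {G : ctx} (p q : term G tN) : form G := ~ Qlt q p.

Definition Q0 {G : ctx} : term G tN := Qmk · 0 · 0 · 1.
Definition Q1 {G : ctx} : term G tN := Qmk · 1 · 0 · 1.

Definition Qadd {G : ctx} : term G (tN ⇒ tN ⇒ tN) :=
  λ p : tN, λ q : tN,
    Qmk · ((Qpos · $p) * (Qden · $q) + (Qpos · $q) * (Qden · $p))
        · ((Qneg · $p) * (Qden · $q) + (Qneg · $q) * (Qden · $p))
        · ((Qden · $p) * (Qden · $q)).
Definition Qopp {G : ctx} : term G (tN ⇒ tN) :=
  λ q : tN, Qmk · (Qneg · $q) · (Qpos · $q) · (Qden · $q).
Definition Qsub {G : ctx} : term G (tN ⇒ tN ⇒ tN) :=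
  λ p : tN, λ q : tN, Qadd · $p · (Qopp · $q).
Definition Qabs {G : ctx} : term G (tN ⇒ tN) :=
  λ q : tN,
    Qmk · ((Qpos · $q ∸ Qneg · $q) + (Qneg · $q ∸ Qpos · $q)) · 0 · (Qden · $q).

(** 2^-n and 2^(-n+1). *)
Definition Qexp {G : ctx} : term G (tN ⇒ tN) :=
  λ n : tN, Qmk · 1 · 0 · (Pow2 · $n).
Definition Qexp1 {G : ctx} : term G (tN ⇒ tN) :=
  λ n : tN, Qmk · (1 + 1) · 0 · (Pow2 · $n).

Definition isR {G : ctx} (x : term G T1) : form G :=
  ∀ n : tN, ∀ i : tN,
    Qlt (Qabs · (Qsub · ($x · $n) · ($x · ($n + $i)))) (Qexp · $n).

Definition Req {G : ctx} (x y : term G T1) : form G :=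
  ∀ n : tN, Qle (Qabs · (Qsub · ($x · $n) · ($y · $n))) (Qexp1 · $n).
Definition Rlt {G : ctx} (x y : term G T1) : form G :=
  ∃ n : tN, Qlt (Qadd · ($x · $n) · (Qexp1 · $n)) ($y · $n).
Definition Rle {G : ctx} (x y : term G T1) : form G := ~ Rlt y x.

Definition RofQ {G : ctx} : term G (tN ⇒ T1) := λ q : tN, λ n : tN, $q.
Definition R0 {G : ctx} : term G T1 := RofQ · Q0.
Definition R1 {G : ctx} : term G T1 := RofQ · Q1.

(** The index shifts restore the modulus of convergence. *)
Definition Radd {G : ctx} : term G (T1 ⇒ T1 ⇒ T1) :=
  λ x : T1, λ y : T1, λ n : tN, Qadd · ($x · ($n + 1)) · ($y · ($n + 1)).
Definition Ropp {G : ctx} : term G (T1 ⇒ T1) :=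
  λ x : T1, λ n : tN, Qopp · ($x · $n).
Definition Rsub {G : ctx} : term G (T1 ⇒ T1 ⇒ T1) :=
  λ x : T1, λ y : T1, Radd · $x · (Ropp · $y).
Definition Rabs {G : ctx} : term G (T1 ⇒ T1) :=
  λ x : T1, λ n : tN, Qabs · ($x · $n).
(** [Rsum · s · m] is the sum of the reals s(i) for i < m. *)
Definition Rsum {G : ctx} : term G ((tN ⇒ T1) ⇒ tN ⇒ T1) :=
  λ s : tN ⇒ T1, λ m : tN, λ n : tN,
    rec (λ i : tN, λ q : tN, Qadd · $q · ($s · $i · ($n + $m))) Q0 $m.

Definition in01 {G : ctx} (x : term G T1) : form G :=
  isR x /\ Rle R0 x /\ Rle x R1.

(** |x - y| < 2^-n *)
Definition Rnear {G : ctx} (x y : term G T1) (n : term G tN) : form G :=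
  Rlt (Rabs · (Rsub · x · y)) (RofQ · (Qexp · n)).

Definition NIN : form [] :=
  ∀ Y : T1 ⇒ tN,
    (∀ x : T1, ∀ y : T1,
      in01 $x --> in01 $y --> Req $x $y --> $Y · $x == $Y · $y) -->
    ∃ x : T1, ∃ y : T1,
      in01 $x /\ in01 $y /\ ~ Req $x $y /\ $Y · $x == $Y · $y.

Definition fun_R_Rpos {G : ctx} (F : term G (T1 ⇒ T1)) : form G :=
  (∀ x : T1, isR $x --> isR ($F · $x) /\ Rlt R0 ($F · $x)) /\
  (∀ x : T1, ∀ y : T1,
    isR $x --> isR $y --> Req $x $y --> Req ($F · $x) ($F · $y)).

(** The real x belongs to the interval from a to b, whose left (right) endpoint
    is included iff the flag u (v) is 0. *)
Definition in_itv {G : ctx} (a b : term G T1) (u v : term G tN)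
    (x : term G T1) : form G :=
  (Rlt a x \/ u == 0 /\ Req a x) /\ (Rlt x b \/ v == 0 /\ Req x b).

(** The set [P] of reals is the union of finitely many intervals, listed from
    left to right without overlap, and [l] is the sum of their lengths. *)
Definition total_length {G : ctx} (P : form (T1 :: G)) (l : term G T1) :
    form G :=
  ∃ m : tN, ∃ a : tN ⇒ T1, ∃ b : tN ⇒ T1, ∃ u : T1, ∃ v : T1,
    (∀ i : tN, $i < $m -->
      isR ($a · $i) /\ isR ($b · $i) /\ Rle ($a · $i) ($b · $i)) /\
    (∀ i : tN, $i + 1 < $m --> Rle ($b · $i) ($a · ($i + 1))) /\
    (∀ x : T1, isR $x -->
      (inst P $x <-->
       ∃ i : tN, $i < $m /\
         in_itv ($a · $i) ($b · $i) ($u · $i) ($v · $i) $x)) /\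
    Req $l (Rsum · (λ i : tN, Rsub · ($b · $i) · ($a · $i)) · $m).

(** x is in I_y = (y - F(y), y + F(y)). *)
Definition in_I {G : ctx} (F : term G (T1 ⇒ T1)) (y x : term G T1) : form G :=
  Rlt (Rsub · y · (F · y)) x /\ Rlt x (Radd · y · (F · y)).

(** J_{y_i}, as a formula in the newest variable. *)
Definition J_set {G : ctx} (F : term G (T1 ⇒ T1)) (y : term G (tN ⇒ T1))
    (i : term G tN) : form (T1 :: G) :=
  let x : term (T1 :: G) T1 := Var V0 in
  in_I $F ($y · $i) $x /\
  ∀ j : tN, $j < $i --> ~ in_I $F ($y · $j) $x.

(** [F] and [e] are Psi and epsilon; the finite sequence y_0, ..., y_k is [y]
    restricted to indices below k + 1, and [l] lists the lengths of the J_{y_i}. *)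
Definition WHBU : form [] :=
  ∀ F : T1 ⇒ T1, ∀ e : T1,
    fun_R_Rpos $F --> isR $e --> Rlt R0 $e -->
    ∃ k : tN, ∃ y : tN ⇒ T1, ∃ l : tN ⇒ T1,
      (∀ i : tN, $i < $k + 1 --> in01 ($y · $i)) /\
      (∀ i : tN, ∀ j : tN, $i < $k + 1 --> $j < $k + 1 --> ~ $i == $j -->
        ~ Req ($y · $i) ($y · $j)) /\
      (∀ i : tN, $i < $k + 1 -->
        isR ($l · $i) /\ total_length (J_set $F $y $i) ($l · $i)) /\
      Rlt (Rsub · R1 · $e) (Rsum · $l · ($k + 1)).

Definition fun_01_R {G : ctx} (F : term G (T1 ⇒ T1)) : form G :=
  (∀ x : T1, in01 $x --> isR ($F · $x)) /\
  (∀ x : T1, ∀ y : T1,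
    in01 $x --> in01 $y --> Req $x $y --> Req ($F · $x) ($F · $y)).

Definition in_open {G : ctx} (O : term G (T1 ⇒ T1)) (x : term G T1) : form G :=
  Rlt R0 (O · x).

Definition is_open {G : ctx} (O : term G (T1 ⇒ T1)) : form G :=
  fun_01_R O /\
  ∀ x : T1, in01 $x --> in_open $O $x -->
    ∃ n : tN, ∀ y : T1, in01 $y --> Rnear $x $y $n --> in_open $O $y.

Definition is_dense {G : ctx} (O : term G (T1 ⇒ T1)) : form G :=
  ∀ x : T1, ∀ n : tN, in01 $x -->
    ∃ y : T1, in01 $y /\ Rnear $x $y $n /\ in_open $O $y.

Definition BCT : form [] :=
  ∀ O : tN ⇒ T1 ⇒ T1,
    (∀ n : tN, is_open ($O · $n) /\ is_dense ($O · $n)) -->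
    ∃ x : T1, in01 $x /\ ∀ n : tN, in_open ($O · $n) $x.

(* Main.v *)
(** By a Henkin construction the deduction system is complete, so it suffices
    to derive NIN in every extensional model M of the axioms in which WHBU, or
    BCT, holds.  The numbers of M form an ordered semiring with quantifier-free
    induction; codes of rationals take their values in its field of fractions,
    an ordered field.

    Let Y : [0,1] -> N be injective in M.  Each set {x | Y x <> n} omits at most
    one point, hence is open and dense, but no x belongs to all of them; this
    contradicts BCT.  For WHBU take Psi x = 2^-(Y x + 3) and epsilon = 1/2: the
    length of J_(y_i) is at most that of I_(y_i), which is 2^-(Y(y_i) + 2), and
    the numbers Y(y_i) are distinct, so that the lengths add up to at most 1/2. *)

From HB Require Import structures.
From mathcomp Require Import all_boot all_order all_algebra.
From mathcomp Require Import boolp.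
From Stdlib Require Cantor.
From Stdlib Require Import Ring.
(* Stdlib's [ring], which mathcomp's [ring] shadows below, handles semirings. *)
Ltac semiring := ring.
From mathcomp Require Import ring lra.
Require Import Defs.
Set Implicit Arguments.
Unset Strict Implicit.
Unset Printing Implicit Defensive.
Unset Asymmetric Patterns.
Close Scope L_scope.

(* The kernel should not unfold combinator terms before it has to. *)
Strategy 1000 [Pred Monus Pow2 Sqrt Pair Fst Snd Qpos Qneg Qden Qmk Qadd Qopp Qsub
  Qabs Qexp Qexp1 Q0 Q1 RofQ Radd Ropp Rsub Rabs Rsum R0 R1].

(** The models may be nonstandard. The number of centres in WHBU and the number of intervals that
    make up a set J are then numbers of M, possibly infinite from outside, so arguments about finite
    sums are available only as quantifier-free induction in M. Hence a function that enters an
    induction must be represented in M, a property proved by induction must have a represented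
    characteristic function, and steps such as taking a maximum or sorting the terms of a sum by
    size are replaced by recursively computed sums and truncations. The order of reals is not
    quantifier-free either. Each estimate on reals is therefore made on rational approximations at a
    fixed index, chosen so large that the error remains small after multiplication by the number of
    terms. On the syntactic side contexts are finite lists, so no context contains all Henkin
    constants. The constants are fresh variables, and the elements of the model come from sequences
    of terms over growing contexts. *)

Lemma var_case (G : ctx) (u : fty) (P : forall t, var (u :: G) t -> Prop) :
  P u V0 -> (forall t v, P t (VS v)) -> forall t v, P t v.
Proof.
move=> h0 hS t v.
refine (match v as v' in var E t' return
  match E as E0 return var E0 t' -> Prop with
  | nil => fun _ => True
  | u' :: G' => fun w => forall Q : (forall t, var (u' :: G') t -> Prop),
      Q u' V0 -> (forall t w, Q t (VS w)) -> Q t' w end v' with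
  | V0 => fun Q q0 qS => q0 | VS w => fun Q q0 qS => qS _ w end P h0 hS).
Qed.

Lemma var_nil t (v : var nil t) : False.
Proof.
exact: (match v in var E _ return match E with nil => False | _ => True end with
  V0 => I | VS _ => I end).
Qed.

Lemma famE (I : fty -> Type) (X : forall t, I t -> Type)
  (f g : forall t (i : I t), X t i) :
  (forall t i, f t i = g t i) -> f = g.
Proof. by move=> h; apply: functional_extensionality_dep => t; apply: functional_extensionality_dep => i. Qed.

(** * Substitution calculus *)

Definition ids (G : ctx) : sub G G := fun t v => Var v.

Lemma tsub_tsub (G D E : ctx) (s : sub G D) (r : sub D E) t (a : term G t) :
  tsub r (tsub s a) = tsub (fun t v => tsub r (s t v)) a.
Proof. by elim: a => //= ? ? f -> b ->. Qed.

Lemma tsub_ids (G : ctx) t (a : term G t) : tsub (@ids G) a = a.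
Proof. by elim: a => //= ? ? f -> b ->. Qed.

Lemma up_comp (G D E : ctx) (u : fty) (s : sub G D) (r : sub D E) :
  (fun t v => tsub (up r) (up (u := u) s v)) = up (fun t v => tsub r (s t v)).
Proof.
apply: famE; apply: var_case => //= t v.
by rewrite /up /= !tsub_tsub.
Qed.

Lemma up_ids (G : ctx) (u : fty) : up (u := u) (@ids G) = @ids (u :: G).
Proof. by apply: famE; apply: var_case. Qed.

Lemma fsub_fsub (G D E : ctx) (s : sub G D) (r : sub D E) (A : form G) :
  fsub r (fsub s A) = fsub (fun t v => tsub r (s t v)) A.
Proof.
elim: A D E s r => //=.
- by move=> G' a b D E s r; rewrite !tsub_tsub.
- by move=> G' a b D E s r; rewrite !tsub_tsub.
- by move=> G' A hA B hB D E s r; rewrite hA hB.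
- by move=> G' A hA B hB D E s r; rewrite hA hB.
- by move=> G' A hA B hB D E s r; rewrite hA hB.
- by move=> G' t A hA D E s r; rewrite hA up_comp.
- by move=> G' t A hA D E s r; rewrite hA up_comp.
Qed.

Lemma fsub_ids (G : ctx) (A : form G) : fsub (@ids G) A = A.
Proof.
elim: A => //=.
- by move=> G' a b; rewrite !tsub_ids.
- by move=> G' a b; rewrite !tsub_ids.
- by move=> G' A -> B ->.
- by move=> G' A -> B ->.
- by move=> G' A -> B ->.
- by move=> G' t A hA; rewrite up_ids hA.
- by move=> G' t A hA; rewrite up_ids hA.
Qed.

Lemma inst_up (G D : ctx) (u : fty) (s : sub G D) (A : form (u :: G))
    (a : term D u) : inst (fsub (up s) A) a = fsub (scons a s) A.
Proof.
rewrite /inst fsub_fsub; congr (fsub _ A); apply: famE; apply: var_case => //= t v.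
by rewrite /up /= tsub_tsub -[RHS]tsub_ids.
Qed.

Lemma inst_shift (G : ctx) (u : fty) (A : form (u :: G)) :
  inst (fsub (up (@shift G u)) A) (Var V0) = A.
Proof.
rewrite inst_up -[RHS]fsub_ids; congr (fsub _ A).
by apply: famE; apply: var_case.
Qed.

Lemma fsub_inst (G D : ctx) (u : fty) (s : sub G D) (A : form (u :: G))
    (a : term G u) : fsub s (inst A a) = inst (fsub (up s) A) (tsub s a).
Proof.
rewrite inst_up /inst fsub_fsub; congr (fsub _ A).
by apply: famE; apply: var_case.
Qed.

Lemma wkE (G D : ctx) (e : ext G D) t (a : term G t) :
  wk (e := e) a = tsub (fun t v => Var (e t v)) a.
Proof. by []. Qed.

Lemma fsub_eqt t (G D : ctx) (s : sub G D) (a b : term G t) :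
  fsub s (eqt a b) = eqt (tsub s a) (tsub s b).
Proof.
elim: t G D s a b => //= r _ t IH G D s a b.
by rewrite /bind_all /= IH /= !wkE !tsub_tsub.
Qed.

Lemma inst_eqt s t (G : ctx) (x y : term G (tArr s t)) (c : term G s) :
  inst (D := G) (eqt (App (wk x) (Var V0 : term (s :: G) s)) (App (wk y) (Var V0))) c
  = eqt (App x c) (App y c).
Proof.
by rewrite /inst fsub_eqt /= !wkE !tsub_tsub /= !tsub_ids.
Qed.

(** * Semantics *)

(** Equality of numbers is interpreted as identity and so has no field of its own. *)
Record structure := Structure {
  dom : fty -> Type;
  app : forall s t, dom (tArr s t) -> dom s -> dom t;
  cst : forall t, const t -> dom t;
  ltD : dom tN -> dom tN -> Prop }.
Arguments app {s0 s t} : rename.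

Definition env (M : structure) (G : ctx) := forall t, var G t -> dom M t.

Definition enil (M : structure) : env M nil :=
  fun t v => False_rect _ (var_nil v).
Arguments enil M : clear implicits.

Definition econs (M : structure) (G : ctx) (u : fty) (x : dom M u) (r : env M G) :
    env M (u :: G) :=
  fun t v =>
    match v in var E t'
      return match E with
             | nil => unit
             | u' :: G' => dom M u' -> env M G' -> dom M t'
             end
    with
    | V0 => fun a _ => a
    | VS w => fun _ r => r _ w
    end x r.

Fixpoint eval (M : structure) (G : ctx) (r : env M G) t (a : term G t) : dom M t :=
  match a with
  | Var v => r _ v
  | Cst c => cst M c
  | App f b => app (eval r f) (eval r b)
  end.

Fixpoint sem (M : structure) (G : ctx) (A : form G) : env M G -> Prop :=
  match A with
  | Bot => fun _ => False
  | Eq0 a b => fun r => eval r a = eval r b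
  | Lt0 a b => fun r => ltD (eval r a) (eval r b)
  | And A B => fun r => sem A r /\ sem B r
  | Or A B => fun r => sem A r \/ sem B r
  | Imp A B => fun r => sem A r -> sem B r
  | All t A => fun r => forall x : dom M t, sem A (econs x r)
  | Ex t A => fun r => exists x : dom M t, sem A (econs x r)
  end.

Lemma eval_tsub (M : structure) (G D : ctx) (s : sub G D) (r : env M D) t
    (a : term G t) : eval r (tsub s a) = eval (fun t v => eval r (s t v)) a.
Proof. by elim: a => //= ? ? f -> b ->. Qed.

Lemma econs_up (M : structure) (G D : ctx) u (s : sub G D) (r : env M D) (x : dom M u) :
  (fun t v => eval (econs x r) (up s v)) = econs x (fun t v => eval r (s t v)).
Proof.
by apply: famE; apply: var_case => //= t v; rewrite /up /= eval_tsub.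
Qed.

Lemma sem_fsub (M : structure) (G D : ctx) (s : sub G D) (r : env M D) (A : form G) :
  sem (fsub s A) r = sem A (fun t v => eval r (s t v)).
Proof.
elim: A D s r => //=.
- by move=> G' a b D s r; rewrite !eval_tsub.
- by move=> G' a b D s r; rewrite !eval_tsub.
- by move=> G' A hA B hB D s r; rewrite hA hB.
- by move=> G' A hA B hB D s r; rewrite hA hB.
- by move=> G' A hA B hB D s r; rewrite hA hB.
- move=> G' t A hA D s r; apply: eq_forall => x; by rewrite hA econs_up.
- move=> G' t A hA D s r; apply: eq_exists => x; by rewrite hA econs_up.
Qed.

Lemma sem_inst (M : structure) (G D : ctx) (e : ext G D) u (A : form (u :: G))
    (a : term D u) (r : env M D) :
  sem (inst A a) r = sem A (econs (eval r a) (fun t v => r t (e t v))).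
Proof.
rewrite /inst sem_fsub; congr (sem A _).
by apply: famE; apply: var_case.
Qed.

Lemma eval_wk (M : structure) (G D : ctx) (e : ext G D) (r : env M D) t (a : term G t) :
  eval r (wk (e := e) a) = eval (fun t v => r t (e t v)) a.
Proof. by rewrite wkE eval_tsub. Qed.

Definition extensional (M : structure) :=
  forall s t (f g : dom M (tArr s t)), (forall x, app f x = app g x) -> f = g.

(** Extensionality turns the defined equality of higher types into identity, so that in a model the
    combinator axioms become rewrite rules. *)
Lemma sem_eqt (M : structure) (hM : extensional M) t (G : ctx) (r : env M G) (a b : term G t) :
  sem (eqt a b) r <-> eval r a = eval r b.
Proof.
elim: t G r a b => //= s _ t IH G r a b; split.
- move=> h; apply: hM => x; move: (h x); rewrite IH /=.
  by rewrite !eval_wk.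
- by move=> h x; rewrite IH /= !eval_wk /= /ext_var /= h.
Qed.

(** * Countability of the language *)

Import GenTree.

Fixpoint code_fty (t : fty) : tree nat :=
  match t with tN => Leaf 0 | tArr s t => Node 0 [:: code_fty s; code_fty t] end.

Lemma code_fty_inj : injective code_fty.
Proof. by elim=> [|s hs t ht] [|s' t'] //= [/hs -> /ht ->]. Qed.

Fixpoint code_var (G : ctx) t (v : var G t) : nat :=
  match v with V0 => 0 | VS w => (code_var w).+1 end.

Definition pack (X : fty -> Type) t (x : X t) : {t : fty & X t} := existT X t x.

(** Proof irrelevance makes the equality between the two type indices trivial. *)
Lemma pack_inj (X : fty -> Type) t (x y : X t) : pack x = pack y -> x = y.
Proof.
move=> h; have e := projT2_eq h; rewrite -[y]e /=.
by rewrite (Prop_irrelevance (projT1_eq h) erefl).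
Qed.

(** In a fixed context the index of a variable determines its type too, so codes need not record
    types. *)
Lemma code_var_inj (G : ctx) t (v : var G t) t' (v' : var G t') :
  code_var v = code_var v' -> pack v = pack v'.
Proof.
elim: v t' v' => [{}G {}t|{}G s {}t w IH] t' v'; move: t' v'; apply: var_case => //=.
by move=> t' w' [/IH h]; have := congr1 (fun p => pack (VS (s := s) (projT2 p))) h.
Qed.

Definition code_const t (c : const t) : tree nat :=
  match c with
  | Zero => Leaf 0 | One => Leaf 1 | Plus => Leaf 2 | Times => Leaf 3
  | Pi r s => Node 0 [:: code_fty r; code_fty s]
  | Sigma r s t => Node 1 [:: code_fty r; code_fty s; code_fty t]
  | Rec s => Node 2 [:: code_fty s]
  end.

Lemma code_const_inj t (c : const t) t' (c' : const t') :
  code_const c = code_const c' -> pack c = pack c'.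
Proof.
case: c => [||||r s|r s u|s]; case: c' => [||||r' s'|r' s' u'|s'] //= [];
by do ?move/code_fty_inj ->.
Qed.

Fixpoint code_term (G : ctx) t (a : term G t) : tree nat :=
  match a with
  | Var v => Leaf (code_var v)
  | Cst c => Node 0 [:: code_const c]
  | App f b => Node 1 [:: code_term f; code_term b]
  end.

Lemma code_term_inj (G : ctx) t (a : term G t) t' (a' : term G t') :
  code_term a = code_term a' -> pack a = pack a'.
Proof.
elim: a t' a' => [{}t v|{}t c|s {}t f IHf b IHb] t' [u v'|u c'|s' u f' b'] //= [].
- by move=> /code_var_inj h; have := congr1 (fun p => pack (Var (projT2 p))) h.
- by move=> /code_const_inj h; have := congr1 (fun p => pack (Cst (G := G) (projT2 p))) h.
- move=> /IHf h /IHb h'.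
  (* The type of the function part determines both the argument type and the result type, which the
     code of an application omits. *)
  have [e1 e2] := projT1_eq h; subst.
  by rewrite (pack_inj h) (pack_inj h').
Qed.

Lemma code_term_inj_at (G : ctx) t : injective (@code_term G t).
Proof. by move=> a b /code_term_inj h; apply: (pack_inj (X := term G)). Qed.

Fixpoint code_form (G : ctx) (A : form G) : tree nat :=
  match A with
  | Bot => Leaf 0
  | Eq0 a b => Node 0 [:: code_term a; code_term b]
  | Lt0 a b => Node 1 [:: code_term a; code_term b]
  | And A B => Node 2 [:: code_form A; code_form B]
  | Or A B => Node 3 [:: code_form A; code_form B]
  | Imp A B => Node 4 [:: code_form A; code_form B]
  | All t A => Node 5 [:: code_fty t; code_form A]
  | Ex t A => Node 6 [:: code_fty t; code_form A]
  end.

Lemma code_form_inj (G : ctx) : injective (@code_form G).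
Proof.
move=> A; elim: A => {G} G.
- by case.
- by move=> a b [] //= a' b' [] /code_term_inj_at -> /code_term_inj_at ->.
- by move=> a b [] //= a' b' [] /code_term_inj_at -> /code_term_inj_at ->.
- by move=> A hA B hB [] //= A' B' [] /hA -> /hB ->.
- by move=> A hA B hB [] //= A' B' [] /hA -> /hB ->.
- by move=> A hA B hB [] //= A' B' [] /hA -> /hB ->.
- by move=> t A hA [] //= t' A' [] /code_fty_inj e; subst => /hA ->.
- by move=> t A hA [] //= t' A' [] /code_fty_inj e; subst => /hA ->.
Qed.

(** [Bot] fills the numbers that code no formula. *)
Definition enum_form (G : ctx) (n : nat) : form G :=
  match pselect (exists A : form G, pickle (code_form A) = n) with
  | left h => projT1 (cid h)
  | right _ => Bot
  end.

Lemma enum_form_surj (G : ctx) (A : form G) : exists n, enum_form G n = A.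
Proof.
exists (pickle (code_form A)); rewrite /enum_form.
case: pselect => [h|[]]; last by exists A.
by case: (cid h) => B /= /(pcan_inj (@pickleK _))/code_form_inj.
Qed.

(** * Completeness *)

Section Deductions.
Variable T : theory.

Lemma nd_hyp0 (G : ctx) (H : list (form G)) A : nd T (A :: H) A.
Proof. by apply: nd_hyp; left. Qed.
Lemma nd_hyp1 (G : ctx) (H : list (form G)) A B : nd T (B :: A :: H) A.
Proof. by apply: nd_hyp; right; left. Qed.
Lemma nd_hyp2 (G : ctx) (H : list (form G)) A B C : nd T (C :: B :: A :: H) A.
Proof. by apply: nd_hyp; right; right; left. Qed.

Lemma nd_absurd (G : ctx) (H : list (form G)) A B :
  nd T H (Imp (Imp A Bot) (Imp A B)).
Proof.
apply: nd_impI; apply: nd_impI; apply: nd_raa.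
by apply: (nd_impE (A := A)); [apply: nd_hyp2|apply: nd_hyp1].
Qed.

Lemma nd_const (G : ctx) (H : list (form G)) A B : nd T H (Imp B (Imp A B)).
Proof. by apply: nd_impI; apply: nd_impI; apply: nd_hyp1. Qed.

(** Through this classical law, witnesses for existential formulas settle universal formulas as
    well. *)
Lemma nd_not_all (G : ctx) (H : list (form G)) t (B : form (t :: G)) :
  nd T H (Imp (Imp (All t B) Bot) (Ex t (Imp B Bot))).
Proof.
apply: nd_impI; apply: nd_raa.
apply: (nd_impE (A := All t B)); first exact: nd_hyp1.
apply: nd_allI; apply: nd_raa.
apply: (nd_impE (A := fwk t (Ex t (Imp B Bot)))); first exact: nd_hyp1.
apply: (nd_exI (a := Var V0)).
have -> : inst (D := t :: G) (fsub (up (@shift G t)) (Imp B Bot)) (Var V0) = Imp B Bot.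
  exact: inst_shift.
exact: nd_hyp0.
Qed.

Lemma nd_eq_sym (G : ctx) (H : list (form G)) (a b : term G tN) :
  nd T H (Eq0 a b) -> nd T H (Eq0 b a).
Proof.
move=> h.
have := nd_eq_subst (A := Eq0 (Var V0) (tsub (@shift G tN) a)) h.
rewrite /inst /= !tsub_tsub /= !tsub_ids; apply; exact: nd_eq_refl.
Qed.

Lemma nd_eq_trans (G : ctx) (H : list (form G)) (a b c : term G tN) :
  nd T H (Eq0 a b) -> nd T H (Eq0 b c) -> nd T H (Eq0 a c).
Proof.
move=> h h'.
have := nd_eq_subst (A := Eq0 (tsub (@shift G tN) a) (Var V0)) h'.
by rewrite /inst /= !tsub_tsub /= !tsub_ids; apply.
Qed.

Lemma nd_lt_subst (G : ctx) (H : list (form G)) (a b a' b' : term G tN) :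
  nd T H (Eq0 a a') -> nd T H (Eq0 b b') -> nd T H (Lt0 a b) -> nd T H (Lt0 a' b').
Proof.
move=> h h' h0.
have := nd_eq_subst (A := Lt0 (tsub (@shift G tN) a') (Var V0)) h'.
rewrite /inst /= !tsub_tsub /= !tsub_ids; apply.
have := nd_eq_subst (A := Lt0 (Var V0) (tsub (@shift G tN) b)) h.
by rewrite /inst /= !tsub_tsub /= !tsub_ids; apply.
Qed.

End Deductions.

(** The induction on [n] shifts the family [X], so that no cast along an equation of indices arises;
    [d] fills the places before [n]. *)
Lemma nat_extend (X : nat -> Type) (d : forall n, X n) (f : forall n, X n -> X n.+1)
    n (a : X n) :
  exists s : forall m, X m, s n = a /\ forall m, n <= m -> s m.+1 = f m (s m).
Proof.
elim: n X d f a => [|n IH] X d f a.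
  exists (fix s m := match m with 0 => a | m'.+1 => f m' (s m') end).
  by split.
have [s [hs hS]] := IH (fun m => X m.+1) (fun m => d m.+1) (fun m => f m.+1) a.
exists (fun m => match m with 0 => d 0 | m'.+1 => s m' end); split => //.
by case=> // m /hS.
Qed.

(** * The Henkin extension *)

Section Henkin.
Variable T : theory.
Hypothesis T_ext : forall G r t (H : list (form G)) (f : term G (tArr r t)) x y,
  nd T H (eqt x y) -> nd T H (eqt (App f x) (App f y)).
Variable A0 : form nil.
Hypothesis A0_cons : ~ nd T [:: A0] Bot.

(* [s_enum S k j] is the [j]-th formula of the [k]-th context, weakened to the
   context of [S]. *)
Record stage := Stage { s_ctx : ctx; s_hyp : list (form s_ctx);
  s_enum : nat -> nat -> form s_ctx }.

(** The fresh variable is itself the witness of an existential formula, so the body joins the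
    hypotheses verbatim. In the other cases a dummy variable of type [tN] keeps every step to
    exactly one new variable. *)
Definition add_witness (G : ctx) (A : form G) (H : list (form G)) :
    {u : fty & list (form (u :: G))} :=
  match A with
  | Ex t B => fun H => existT _ t (B :: List.map (@fwk G t) H)
  | _ => fun H => existT _ tN (List.map (@fwk G tN) H)
  end H.

Definition extend_hyp (G : ctx) (A : form G) (H : list (form G)) :
    {u : fty & list (form (u :: G))} :=
  if pselect (nd T (A :: H) Bot) then
    existT _ tN (List.map (@fwk G tN) (Imp A Bot :: H))
  else add_witness A (A :: H).

(* Only the first component of the decoding of [n] is used, so that every pair
   recurs infinitely often. *)
Definition sched (n : nat) : nat * nat := Cantor.of_nat (Cantor.of_nat n).1.

Lemma sched_surj N k j : exists n, N <= n /\ sched n = (k, j).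
Proof.
exists (Cantor.to_nat (Cantor.to_nat (k, j), N)); split.
  apply/leP; have := Cantor.to_nat_non_decreasing (Cantor.to_nat (k, j)) N.
  by move=> h; apply: PeanoNat.Nat.le_trans h; apply: PeanoNat.Nat.le_add_r.
by rewrite /sched Cantor.cancel_of_to; apply: Cantor.cancel_of_to.
Qed.

(** Rows up to [n] are already fixed and get weakened. The later rows are placeholders, enumerated
    anew at each stage until the stage whose number is that of the row. *)
Definition next_stage (n : nat) (S : stage) : stage :=
  let p := extend_hyp (s_enum S (sched n).1 (sched n).2) (s_hyp S) in
  Stage (projT2 p)
    (fun k j => if k <= n then fwk (projT1 p) (s_enum S k j) else enum_form _ j).

Fixpoint stage_at (n : nat) : stage :=
  match n with
  | 0 => Stage [:: A0] (fun _ j => enum_form nil j)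
  | m.+1 => next_stage m (stage_at m)
  end.

Definition ctx_at n : ctx := s_ctx (stage_at n).
Definition hyps_at n : list (form (ctx_at n)) := s_hyp (stage_at n).
Definition requested n : form (ctx_at n) := s_enum (stage_at n) (sched n).1 (sched n).2.
Definition new_type n : fty := projT1 (extend_hyp (requested n) (hyps_at n)).
Definition shift_at n : sub (ctx_at n) (ctx_at n.+1) := @shift (ctx_at n) (new_type n).
Arguments shift_at : clear implicits.

(** A fresh variable is harmless because every type has a closed term to put in its place; a fresh
    witness is harmless by [nd_exE]. *)
Lemma extend_hyp_cons G (A : form G) (H : list (form G)) :
  ~ nd T H Bot -> ~ nd T (projT2 (extend_hyp A H)) Bot.
Proof.
have nd_low u (H' : list (form G)) : nd T (List.map (@fwk G u) H') Bot -> nd T H' Bot.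
  move=> h; have inh : term G u.
    by elim: (u) => [|s _ t a]; [exact: (Cst Zero)|exact: (App (Cst (Pi t s)) a)].
  have /nd_allE : nd T H' (All u Bot) by exact: nd_allI.
  by move/(_ inh).
rewrite /extend_hyp; case: pselect => /= [h|nh] hH.
  move=> /(nd_low tN (Imp A Bot :: H)) h'; apply: hH; apply: (nd_impE (A := A)); first exact: nd_impI.
  exact: nd_raa.
suff : ~ nd T (projT2 (add_witness A (A :: H))) Bot by [].
case: A nh => //= [|a b|a b|B C|B C|B C|t B|t B] nh; try by move/(nd_low tN (_ :: H)).
by move=> h; apply: nh; apply: (nd_exE (A := B)); [exact: nd_hyp0|exact: h].
Qed.

Lemma hy_cons n : ~ nd T (hyps_at n) Bot.
Proof. by elim: n => //= n; apply: extend_hyp_cons. Qed.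

Lemma extend_hyp_keep G (A B : form G) (H : list (form G)) :
  List.In B H -> List.In (fwk _ B) (projT2 (extend_hyp A H)).
Proof.
rewrite /extend_hyp; case: pselect => /= [h|nh] hB.
  by right; apply: List.in_map.
suff : List.In (fwk _ B) (projT2 (add_witness A (A :: H))) by [].
case: A {nh} => //= *; by do ?right; apply: List.in_map.
Qed.

Lemma hy_keep n (A : form (ctx_at n)) : List.In A (hyps_at n) -> List.In (fsub (shift_at n) A) (hyps_at n.+1).
Proof. exact: extend_hyp_keep. Qed.

Lemma extend_hyp_decide G (A : form G) (H : list (form G)) :
  let p := extend_hyp A H in
  List.In (fwk (projT1 p) A) (projT2 p) \/ List.In (fwk (projT1 p) (Imp A Bot)) (projT2 p).
Proof.
rewrite /= /extend_hyp; case: pselect => /= [h|nh]; first by right; left.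
left; suff : List.In (fwk (projT1 (add_witness A (A :: H))) A) (projT2 (add_witness A (A :: H))) by [].
by case: A {nh} => //= *; do ?[by left|right].
Qed.

Lemma extend_hyp_bad G (A : form G) (H : list (form G)) : nd T (A :: H) Bot ->
  let p := extend_hyp A H in List.In (fwk (projT1 p) (Imp A Bot)) (projT2 p).
Proof. by move=> h; rewrite /= /extend_hyp; case: pselect => // ?; left. Qed.

Lemma extend_hyp_wit G (A : form G) (H : list (form G)) t (B : form (t :: G)) :
  A = Ex t B -> ~ nd T (A :: H) Bot ->
  exists a : term (projT1 (extend_hyp A H) :: G) t,
    List.In (fsub (scons a (@shift G _)) B) (projT2 (extend_hyp A H)).
Proof.
move=> -> nh; rewrite /extend_hyp; case: pselect => //= _.
exists (Var V0); left; rewrite -[LHS]fsub_ids; congr (fsub _ B).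
by apply: famE; apply: var_case.
Qed.

(* The union of the increasing contexts is represented by sequences whose
   terms are eventually the weakenings of each other. *)
Definition eventually (P : nat -> Prop) := exists N, forall n, N <= n -> P n.

Lemma ev_and P Q : eventually P -> eventually Q -> eventually (fun n => P n /\ Q n).
Proof.
move=> [N hN] [N' hN']; exists (maxn N N') => n; rewrite geq_max => /andP [h h'].
by split; [apply: hN|apply: hN'].
Qed.

Lemma ev_mono P Q : (forall n, P n -> Q n) -> eventually P -> eventually Q.
Proof. by move=> h [N hN]; exists N => n /hN/h. Qed.

Lemma ev_all (P : nat -> Prop) : (forall n, P n) -> eventually P.
Proof. by move=> h; exists 0. Qed.

Lemma ev_ex P : eventually P -> exists n, P n.
Proof. by move=> [N hN]; exists N; apply: hN. Qed.

(** * Truth in the union of the stages *)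

Definition tm t := forall n, term (ctx_at n) t.
Definition fm := forall n, form (ctx_at n).

Definition tcoh t (a : tm t) := eventually (fun n => a n.+1 = tsub (shift_at n) (a n)).
Definition fcoh (A : fm) := eventually (fun n => A n.+1 = fsub (shift_at n) (A n)).
Definition scoh G (s : forall n, sub G (ctx_at n)) :=
  eventually (fun n => s n.+1 = (fun t v => tsub (shift_at n) (s n t v))).

Definition Tr (A : fm) := eventually (fun n => nd T (hyps_at n) (A n)).

Lemma Tr_In (A : fm) N : (forall n, N <= n -> A n.+1 = fsub (shift_at n) (A n)) ->
  List.In (A N) (hyps_at N) -> Tr A.
Proof.
move=> hA hin; exists N => n /subnK <-.
apply: nd_hyp; elim: (n - N) => //= k IH.
by rewrite addSn hA ?leq_addl //; apply: hy_keep.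
Qed.

Lemma s_enum_ge n k j : n <= k -> s_enum (stage_at n) k j = enum_form (ctx_at n) j.
Proof. by case: n => // n; rewrite ltnNge /= /next_stage /=; case: (k <= n). Qed.

(** From [N] on the sequence is determined by its entry at [N], which has a place in row [N]; the
    schedule comes back to that place after stage [N]. *)
Lemma fm_requested (A : fm) N : (forall n, N <= n -> A n.+1 = fsub (shift_at n) (A n)) ->
  exists n, N <= n /\ requested n = A n.
Proof.
move=> hA; have [j hj] := enum_form_surj (A N).
have [n [hn hs]] := sched_surj N N j.
exists n; split => //; rewrite /requested hs /= -(subnK hn).
elim: (n - N) => [|k IH]; first by rewrite s_enum_ge.
by rewrite addSn hA ?leq_addl //= /next_stage /= leq_addl IH.
Qed.

(** At the stage that requests the sequence, its entry or the negation becomes a hypothesis, and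
    hypotheses persist. *)
Lemma Tr_decide (A : fm) : fcoh A -> Tr A \/ Tr (fun n => Imp (A n) Bot).
Proof.
move=> [N hA]; have [n [hn hr]] := fm_requested hA.
have hA' m : n.+1 <= m -> A m.+1 = fsub (shift_at m) (A m) by move=> /ltnW/(leq_trans hn)/hA.
have := extend_hyp_decide (requested n) (hyps_at n) => -[] h; [left|right].
  by apply: (Tr_In hA'); rewrite hA // -hr.
apply: (@Tr_In (fun n => Imp (A n) Bot) n.+1) => [m /hA' -> //|].
by rewrite hA // -hr.
Qed.

Lemma Tr_mp (A B : fm) : Tr (fun n => Imp (A n) (B n)) -> Tr A -> Tr B.
Proof.
by move=> h h'; apply: ev_mono (ev_and h h') => n [a b]; apply: nd_impE a b.
Qed.

Lemma Tr_bot : ~ Tr (fun n => Bot).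
Proof. by case/ev_ex=> n /hy_cons. Qed.

Lemma Tr_imp (A B : fm) : fcoh A -> fcoh B ->
  Tr (fun n => Imp (A n) (B n)) <-> (Tr A -> Tr B).
Proof.
move=> hA hB; split; first exact: Tr_mp.
move=> h; case: (Tr_decide hA) => [/h|] h'.
  by apply: Tr_mp h'; apply: ev_all => n; apply: nd_const.
by apply: Tr_mp h'; apply: ev_all => n; apply: nd_absurd.
Qed.

Lemma Tr_and (A B : fm) : Tr (fun n => And (A n) (B n)) <-> (Tr A /\ Tr B).
Proof.
split=> [h|[h h']].
  by split; apply: ev_mono h => n h; [apply: nd_andE1 h|apply: nd_andE2 h].
by apply: ev_mono (ev_and h h') => n [a b]; apply: nd_andI.
Qed.

Lemma Tr_or (A B : fm) : fcoh A -> fcoh B ->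
  Tr (fun n => Or (A n) (B n)) <-> (Tr A \/ Tr B).
Proof.
move=> hA hB; split=> [h|[h|h]].
- case: (Tr_decide hA) => [|h1]; first by left.
  case: (Tr_decide hB) => [|h2]; first by right.
  case: Tr_bot; apply: ev_mono (ev_and h (ev_and h1 h2)) => n [a [b c]].
  apply: (nd_impE _ c); apply: (nd_impE _ b).
  apply: (nd_impE _ a); apply: nd_impI.
  apply: (nd_orE (A := A n) (B := B n)); first exact: nd_hyp0.
    do 2 apply: nd_impI; apply: (nd_impE (A := A n)); first exact: nd_hyp1.
    exact: nd_hyp2.
  do 2 apply: nd_impI; apply: (nd_impE (A := B n)); first exact: nd_hyp0.
  exact: nd_hyp2.
- by apply: ev_mono h => n; apply: nd_orI1.
- by apply: ev_mono h => n; apply: nd_orI2.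
Qed.

Definition inh t (G : ctx) : term G t :=
  (fix inh t : term G t := match t with
   | tN => Cst Zero | tArr s t => App (Cst (Pi t s)) (inh t) end) t.

Lemma tsub_inh t G D (s : sub G D) : tsub s (inh t G) = inh t D.
Proof. by elim: t => //= s1 _ t ->. Qed.

Lemma tcoh_extend t n (a : term (ctx_at n) t) :
  exists b : tm t, b n = a /\ forall m, n <= m -> b m.+1 = tsub (shift_at m) (b m).
Proof. exact: (@nat_extend (fun m => term (ctx_at m) t) (fun m => inh t (ctx_at m))
  (fun m => @tsub _ _ (shift_at m) t)). Qed.

Definition bcoh t (B : forall n, form (t :: ctx_at n)) :=
  eventually (fun n => B n.+1 = fsub (up (shift_at n)) (B n)).

Lemma Tr_ex t (B : forall n, form (t :: ctx_at n)) : bcoh B ->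
  Tr (fun n => Ex t (B n)) <-> exists a : tm t, tcoh a /\ Tr (fun n => inst (B n) (a n)).
Proof.
move=> [N hB]; split; last first.
  by move=> [a [ha h]]; apply: ev_mono h => n; apply: nd_exI.
move=> h.
have hA n : N <= n -> Ex t (B n.+1) = fsub (shift_at n) (Ex t (B n)) by move=> /hB ->.
have [n [hn hr]] := @fm_requested (fun n => Ex t (B n)) N hA.
(* A true existential formula cannot have been rejected, so the stage that treats it supplies a
   witness. *)
case: (pselect (nd T (requested n :: hyps_at n) Bot)) => [hbad|hgood].
  exfalso; apply: Tr_bot; apply: Tr_mp h.
  apply: (@Tr_In (fun n => Imp (Ex t (B n)) Bot) n.+1) => [m /ltnW/(leq_trans hn)/hA -> //|].
  by rewrite hA // -hr; apply: extend_hyp_bad.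
have [a0 h0] := extend_hyp_wit hr hgood.
(* The witness lives in the context of stage [n.+1]; earlier entries of the sequence are fillers. *)
have [a [ha hcoh]] := @tcoh_extend t n.+1 a0.
exists a; split; first by exists n.+1.
apply: (@Tr_In (fun n => inst (B n) (a n)) n.+1) => [m hm|].
  by rewrite hcoh // hB ?fsub_inst // (leq_trans hn) // ltnW.
by rewrite hB // inst_up ha.
Qed.

(** If the universal formula is not true, its negation is, and a Henkin witness for the negated body
    refutes one of the instances. *)
Lemma Tr_all t (B : forall n, form (t :: ctx_at n)) : bcoh B ->
  Tr (fun n => All t (B n)) <-> forall a : tm t, tcoh a -> Tr (fun n => inst (B n) (a n)).
Proof.
move=> hB; split.
  by move=> h a ha; apply: ev_mono h => n /nd_allE.
move=> h.
have hA : fcoh (fun n => All t (B n)) by apply: ev_mono hB => n ->.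
case: (Tr_decide hA) => // hn.
have hB' : bcoh (fun n => Imp (B n) Bot) by apply: ev_mono hB => n ->.
have /(Tr_ex hB') [a [ha ha']] : Tr (fun n => Ex t (Imp (B n) Bot)).
  by apply: Tr_mp hn; apply: ev_all => n; apply: nd_not_all.
by case: Tr_bot; apply: Tr_mp (h a ha).
Qed.

(** * The quotient term model *)

Fixpoint eqS t : tm t -> tm t -> Prop :=
  match t with
  | tN => fun a b => Tr (fun n => Eq0 (a n) (b n))
  | tArr s t => fun a b => forall z : tm s, tcoh z ->
      eqS (fun n => App (a n) (z n)) (fun n => App (b n) (z n))
  end.

Lemma tcoh_app s t (f : tm (tArr s t)) (a : tm s) :
  tcoh f -> tcoh a -> tcoh (fun n => App (f n) (a n)).
Proof. by move=> h h'; apply: ev_mono (ev_and h h') => n [-> ->]. Qed.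

Lemma eqS_refl t (a : tm t) : eqS a a.
Proof.
elim: t a => [|s _ t IH] a /=; first by apply: ev_all => n; apply: nd_eq_refl.
by move=> z _; apply: IH.
Qed.

Lemma eqS_sym t (a b : tm t) : eqS a b -> eqS b a.
Proof.
elim: t a b => //= [a b|s _ t IH a b h z hz]; last by apply/IH/h.
by apply: ev_mono => n; apply: nd_eq_sym.
Qed.

Lemma eqS_trans t (a b c : tm t) : eqS a b -> eqS b c -> eqS a c.
Proof.
elim: t a b c => //= [a b c|s _ t IH a b c h h' z hz]; last first.
  by apply: IH (h z hz) (h' z hz).
by move=> h h'; apply: ev_mono (ev_and h h') => n []; apply: nd_eq_trans.
Qed.

(** This identifies [eqS], whose quantifiers range over coherent sequences, with the truth of the
    defined equality of L_omega. *)
Lemma Tr_eqt t (a b : tm t) : tcoh a -> tcoh b ->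
  Tr (fun n => eqt (a n) (b n)) <-> eqS a b.
Proof.
elim: t a b => //= s _ t IH a b ha hb.
have hB : bcoh (fun n => eqt (App (wk (a n)) (Var V0 : term (s :: ctx_at n) s)) (App (wk (b n)) (Var V0))).
  apply: ev_mono (ev_and ha hb) => n [-> ->].
  by rewrite fsub_eqt /= !wkE !tsub_tsub.
rewrite (Tr_all hB); split=> h z hz.
  apply/(IH _ _ (tcoh_app ha hz) (tcoh_app hb hz)).
  by apply: ev_mono (h z hz) => n; rewrite inst_eqt.
have := proj2 (IH _ _ (tcoh_app ha hz) (tcoh_app hb hz)) (h z hz).
by apply: ev_mono => n; rewrite inst_eqt.
Qed.

(** In the function place this is the definition of [eqS]; in the argument place it is the
    extensionality axiom, which enters through [T_ext]. *)
Lemma eqS_app s t (f g : tm (tArr s t)) (a b : tm s) : tcoh f -> tcoh g ->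
  tcoh a -> tcoh b -> eqS f g -> eqS a b ->
  eqS (fun n => App (f n) (a n)) (fun n => App (g n) (b n)).
Proof.
move=> hf hg ha hb h h'; apply: eqS_trans (h a ha) _.
rewrite -Tr_eqt; try exact: tcoh_app.
have /ev_mono : Tr (fun n => eqt (a n) (b n)) by rewrite Tr_eqt.
by apply=> n; apply: T_ext.
Qed.

Definition cl_dom t := {P : tm t -> Prop | exists a, tcoh a /\ P = eqS a}.

Lemma tcoh_inh t : tcoh (fun n => inh t (ctx_at n)).
Proof. by apply: ev_all => n; rewrite tsub_inh. Qed.

(** Incoherent sequences go to the class of a default term, which makes [cls] total. *)
Definition cls t (a : tm t) : cl_dom t :=
  match pselect (tcoh a) with
  | left h => exist _ (eqS a) (ex_intro _ a (conj h erefl))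
  | right _ => exist _ (eqS _) (ex_intro _ _ (conj (tcoh_inh t) erefl))
  end.

Definition repr t (x : cl_dom t) : tm t := projT1 (cid (proj2_sig x)).

Lemma repr_coh t (x : cl_dom t) : tcoh (repr x).
Proof. by rewrite /repr; case: cid => a []. Qed.

Lemma cls_eq t (a b : tm t) : tcoh a -> tcoh b -> cls a = cls b <-> eqS a b.
Proof.
rewrite /cls => ha hb; do 2 case: pselect => // ?; split.
  by case=> /(congr1 (fun P => P b)) => ->; apply: eqS_refl.
move=> h; apply: eq_exist; apply: funext => c; apply: propext; split.
  exact/eqS_trans/eqS_sym.
exact: eqS_trans.
Qed.

Lemma reprK t (x : cl_dom t) : cls (repr x) = x.
Proof.
rewrite /cls; case: pselect (repr_coh x) => // h _; case: x h => P hP h.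
by apply: eq_exist; rewrite /repr /=; case: cid => a /= [].
Qed.

Lemma repr_cls t (a : tm t) : tcoh a -> eqS (repr (cls a)) a.
Proof. by move=> ha; rewrite -cls_eq ?reprK //; apply: repr_coh. Qed.

Definition term_structure : structure :=
  @Structure cl_dom
    (fun s t f x => cls (fun n => App (repr f n) (repr x n)))
    (fun t c => cls (fun n => Cst c))
    (fun x y => Tr (fun n => Lt0 (repr x n) (repr y n))).

Lemma term_structure_ext : extensional term_structure.
Proof.
move=> s t f g h; rewrite -[f]reprK -[g]reprK cls_eq; try exact: repr_coh.
move=> z hz; apply: eqS_trans.
  apply: (@eqS_app _ _ _ (repr f) _ (repr (cls z))); try exact: repr_coh; try exact: hz.
    exact: eqS_refl.
  exact/eqS_sym/repr_cls.
apply: eqS_sym; apply: eqS_trans.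
  apply: (@eqS_app _ _ _ (repr g) _ (repr (cls z))); try exact: repr_coh; try exact: hz.
    exact: eqS_refl.
  exact/eqS_sym/repr_cls.
apply: eqS_sym; move: (h (cls z)) => /=; rewrite cls_eq //; apply: tcoh_app; exact: repr_coh.
Qed.

Local Notation M := term_structure.

Definition senv G (s : forall n, sub G (ctx_at n)) : env M G :=
  fun t v => cls (fun n => s n t v).

Lemma tcoh_tsub G (s : forall n, sub G (ctx_at n)) t (a : term G t) :
  scoh s -> tcoh (fun n => tsub (s n) a).
Proof. by apply: ev_mono => n ->; rewrite tsub_tsub. Qed.

Lemma fcoh_fsub G (s : forall n, sub G (ctx_at n)) (A : form G) :
  scoh s -> fcoh (fun n => fsub (s n) A).
Proof. by apply: ev_mono => n ->; rewrite fsub_fsub. Qed.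

Lemma bcoh_fsub G (s : forall n, sub G (ctx_at n)) u (A : form (u :: G)) :
  scoh s -> bcoh (fun n => fsub (up (s n)) A).
Proof. by apply: ev_mono => n ->; rewrite fsub_fsub up_comp. Qed.

Lemma eval_senv G (s : forall n, sub G (ctx_at n)) t (a : term G t) : scoh s ->
  eval (senv s) a = cls (fun n => tsub (s n) a).
Proof.
move=> hs; elim: a => //= {}s' {}t f -> a ->.
have hf := tcoh_tsub f hs; have ha := tcoh_tsub a hs.
rewrite cls_eq; try by apply: tcoh_app => //; exact: repr_coh.
apply: eqS_app => //; try exact: repr_coh; exact: repr_cls.
Qed.

Lemma senv_cons G (s : forall n, sub G (ctx_at n)) u (a : tm u) :
  econs (cls a : dom M u) (senv s) = senv (fun n => scons (a n) (s n)).
Proof. by apply: famE; apply: var_case. Qed.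

Lemma scoh_cons G (s : forall n, sub G (ctx_at n)) u (a : tm u) :
  scoh s -> tcoh a -> scoh (fun n => scons (a n) (s n)).
Proof.
move=> hs ha; apply: ev_mono (ev_and hs ha) => n [-> ->].
by apply: famE; apply: var_case.
Qed.

Lemma cls_sur t (x : cl_dom t) : exists a, tcoh a /\ x = cls a.
Proof. by exists (repr x); rewrite reprK; split => //; apply: repr_coh. Qed.

Lemma Tr_iff (A B : fm) : (forall n, A n = B n) -> Tr A <-> Tr B.
Proof. by move=> h; split; apply: ev_mono => n; rewrite h. Qed.

(** Induction on the formula, with one [Tr] lemma per connective. Open formulas under coherent
    sequences of substitutions are needed because the quantifier cases extend the substitution by a
    sequence of terms. *)
Lemma truth G (A : form G) (s : forall n, sub G (ctx_at n)) : scoh s ->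
  sem A (senv s : env M G) <-> Tr (fun n => fsub (s n) A).
Proof.
elim: A s => {G} G /=.
- by move=> s _; split => // /Tr_bot.
- move=> a b s hs; rewrite !eval_senv // cls_eq //; exact: tcoh_tsub.
- move=> a b s hs; rewrite !eval_senv //.
  have ha := repr_cls (tcoh_tsub a hs); have hb := repr_cls (tcoh_tsub b hs).
  split=> h; apply: ev_mono (ev_and (ev_and ha hb) h) => n [[h1 h2]].
    exact: nd_lt_subst.
  by apply: nd_lt_subst; apply: nd_eq_sym.
- by move=> A hA B hB s hs; rewrite hA // hB // Tr_and.
- by move=> A hA B hB s hs; rewrite hA // hB // Tr_or //; apply: fcoh_fsub.
- by move=> A hA B hB s hs; rewrite hA // hB // Tr_imp //; apply: fcoh_fsub.
- move=> t A hA s hs; rewrite Tr_all; last exact: bcoh_fsub.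
  split=> [h a ha|h x].
    by rewrite (Tr_iff (fun n => inst_up (s n) A (a n))) -(hA _ (scoh_cons hs ha)) -senv_cons.
  have [a [ha ->]] := cls_sur x.
  rewrite senv_cons hA; last exact: scoh_cons.
  by rewrite -(Tr_iff (fun n => inst_up (s n) A (a n))); apply: h.
- move=> t A hA s hs; rewrite Tr_ex; last exact: bcoh_fsub.
  split=> [[x]|[a [ha h]]].
    have [a [ha ->]] := cls_sur x.
    rewrite senv_cons hA; last exact: scoh_cons.
    by rewrite -(Tr_iff (fun n => inst_up (s n) A (a n))) => h; exists a.
  exists (cls a); rewrite senv_cons hA; last exact: scoh_cons.
  by rewrite -(Tr_iff (fun n => inst_up (s n) A (a n))).
Qed.

End Henkin.

(** The assumption on [B] ranges over all contexts and hypothesis lists because [B] is used at every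
    Henkin stage; an axiom present in every context satisfies it at once. *)
Lemma completeness (T : theory) (A : form nil) :
  (forall G r t (H : list (form G)) (f : term G (tArr r t)) x y,
    nd T H (eqt x y) -> nd T H (eqt (App f x) (App f y))) ->
  (forall M : structure, extensional M ->
    (forall B : form nil,
      (forall G (s : sub nil G) (H : list (form G)), nd T H (fsub s B)) ->
      sem B (enil M)) ->
    sem A (enil M)) ->
  nd T nil A.
Proof.
move=> T_ext hA; apply: contrapT => nA.
have hc : ~ nd T [:: Imp A Bot] Bot by move=> /nd_raa.
pose s0 n : sub nil (ctx_at T (Imp A Bot) n) := fun t v => False_rect _ (var_nil v).
have hs0 : scoh s0 by apply: ev_all => n; apply: famE => t v; case: (var_nil v).
have henv : enil (term_structure T (Imp A Bot)) = senv s0.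
  by apply: famE => t v; case: (var_nil v).
suff : Tr (fun n => fsub (s0 n) (Imp A Bot)).
  move=> h; apply: (Tr_bot hc); apply: Tr_mp h _.
  apply/(truth T_ext hc A hs0); rewrite -henv; apply: hA; first exact: term_structure_ext.
  by move=> B hB; rewrite henv truth //; apply: ev_all => n; apply: hB.
apply: (@Tr_In _ _ (fun n => fsub (s0 n) (Imp A Bot)) 0).
  move=> n _; rewrite fsub_fsub; congr (fsub _ _).
  by apply: famE => t v; case: (var_nil v).
rewrite -[X in List.In _ X]/[:: Imp A Bot].
left; rewrite -[LHS]fsub_ids; congr (fsub _ _).
by apply: famE => t v; case: (var_nil v).
Qed.

Import Order.TTheory GRing.Theory Num.Theory.

(** * Field of fractions *)

Section Quotient.
Variables (X : Type) (R : X -> X -> Prop).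
Hypothesis R_refl : forall a, R a a.
Hypothesis R_sym : forall a b, R a b -> R b a.
Hypothesis R_trans : forall a b c, R a b -> R b c -> R a c.

Definition quot := {P : X -> Prop | exists a, P = R a}.
Definition qcl (a : X) : quot := exist _ (R a) (ex_intro _ a erefl).
Definition qrep (x : quot) : X := projT1 (cid (proj2_sig x)).

Lemma qcl_eq a b : qcl a = qcl b <-> R a b.
Proof.
split=> [[/(congr1 (fun P => P b)) ->]//|h].
apply: eq_exist; apply: funext => c; apply: propext; split; apply: R_trans => //.
exact: R_sym.
Qed.

Lemma qrepK x : qcl (qrep x) = x.
Proof. by case: x => P h; apply: eq_exist; rewrite /qrep /=; case: cid. Qed.

Lemma qrep_cl a : R (qrep (qcl a)) a.
Proof. by apply/qcl_eq; rewrite qrepK. Qed.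
End Quotient.

(** The properties of the numbers of a model that make the fractions (a - b)/d an ordered field. The
    difference property [sd_sub] yields inverses and a total order, [sd_zerosum] its
    antisymmetry. *)
Record semidomain := Semidomain {
  sd_car :> Type;
  sd0 : sd_car; sd1 : sd_car;
  sdadd : sd_car -> sd_car -> sd_car; sdmul : sd_car -> sd_car -> sd_car;
  sd_ring : semi_ring_theory sd0 sd1 sdadd sdmul eq;
  sd_cancel : forall x y z, sdadd x z = sdadd y z -> x = y;
  sd_sub : forall x y, exists z, x = sdadd y z \/ y = sdadd x z;
  sd_zerosum : forall x y, sdadd x y = sd0 -> x = sd0;
  sd_integral : forall x y, sdmul x y = sd0 -> x = sd0 \/ y = sd0;
  sd_nontrivial : sd1 <> sd0 }.

Section Fractions.
Variable S : semidomain.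
Add Ring S_ring : (sd_ring S).
Local Notation "0" := (sd0 S).
Local Notation "1" := (sd1 S).
Local Infix "+" := (@sdadd S).
Local Infix "*" := (@sdmul S).

Lemma sd_mulI (x y z : S) : z <> 0 -> x * z = y * z -> x = y.
Proof.
move=> hz; have [c [] -> e] := sd_sub x y.
  have : c * z + y * z = 0 + y * z by rewrite -[0 + _]/(_ + _); transitivity ((y + c) * z); [semiring|rewrite e; semiring].
  by move=> /sd_cancel /sd_integral [-> //|//]; semiring.
have : c * z + x * z = 0 + x * z by transitivity ((x + c) * z); [semiring|rewrite -e; semiring].
by move=> /sd_cancel /sd_integral [-> //|//]; semiring.
Qed.

(* [Frac a b d] stands for the fraction (a - b)/d. *)
Record frac := Frac { fpos : S; fneg : S; fden : S; fden_neq0 : fden <> 0 }.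

Lemma mul_neq0 (x y : S) : x <> 0 -> y <> 0 -> x * y <> 0.
Proof. by move=> hx hy /sd_integral []. Qed.

(** Cross-multiplication, with the negative parts moved across since the semiring has no
    subtraction. *)
Definition frel (p q : frac) :=
  fpos p * fden q + fneg q * fden p = fpos q * fden p + fneg p * fden q.

Lemma frel_refl p : frel p p. Proof. by []. Qed.
Lemma frel_sym p q : frel p q -> frel q p. Proof. by rewrite /frel => ->. Qed.
Lemma frel_trans p q r : frel p q -> frel q r -> frel p r.
Proof.
case: p => a b d hd; case: q => a' b' d' hd'; case: r => a2 b2 d2 hd2.
(* The middle fraction is eliminated by cancelling first its denominator and then the common summand
   (a' + b') d d2. *)
rewrite /frel /= => h h'; apply: (sd_mulI hd').
apply: (@sd_cancel _ _ _ (a' * d * d2 + b' * d * d2)).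
transitivity ((a * d' + b' * d) * d2 + (a' * d2 + b2 * d') * d); first by semiring.
by rewrite h h'; semiring.
Qed.

Definition ffield := quot frel.
Definition fcl (p : frac) : ffield := qcl frel p.
Lemma fcl_eq p q : fcl p = fcl q <-> frel p q.
Proof. by apply: qcl_eq; [exact: frel_refl|exact: frel_sym|exact: frel_trans]. Qed.
Lemma fcl_sur x : exists p, x = fcl p.
Proof. by exists (qrep x); rewrite /fcl qrepK. Qed.
Lemma frep_cl p : frel (qrep (fcl p)) p.
Proof. by apply: qrep_cl; [exact: frel_refl|exact: frel_sym|exact: frel_trans]. Qed.

Definition padd (p q : frac) := @Frac (fpos p * fden q + fpos q * fden p)
  (fneg p * fden q + fneg q * fden p) _ (mul_neq0 (@fden_neq0 p) (@fden_neq0 q)).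
Definition pmul (p q : frac) := @Frac (fpos p * fpos q + fneg p * fneg q)
  (fpos p * fneg q + fneg p * fpos q) _ (mul_neq0 (@fden_neq0 p) (@fden_neq0 q)).
Definition popp (p : frac) := Frac (fneg p) (fpos p) (@fden_neq0 p).
Definition pnat (a : S) := Frac a 0 (@sd_nontrivial S).

Definition fadd (x y : ffield) := fcl (padd (qrep x) (qrep y)).
Definition fmul (x y : ffield) := fcl (pmul (qrep x) (qrep y)).
Definition fopp (x : ffield) := fcl (popp (qrep x)).
Definition fnat (a : S) := fcl (pnat a).

Lemma paddC p q : frel (padd p q) (padd q p).
Proof. by rewrite /frel /=; semiring. Qed.
Lemma pmulC p q : frel (pmul p q) (pmul q p).
Proof. by rewrite /frel /=; semiring. Qed.

Lemma padd_l p p' q : frel p p' -> frel (padd p q) (padd p' q).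
Proof.
case: p => a b d hd; case: p' => a' b' d' hd'; case: q => e f g hg.
rewrite /frel /= => h.
transitivity (g * g * (a * d' + b' * d) + (e + f) * d * d' * g); first by semiring.
by rewrite h; semiring.
Qed.

Lemma pmul_l p p' q : frel p p' -> frel (pmul p q) (pmul p' q).
Proof.
case: p => a b d hd; case: p' => a' b' d' hd'; case: q => e f g hg.
rewrite /frel /= => h.
transitivity (g * e * (a * d' + b' * d) + g * f * (a' * d + b * d')); first by semiring.
by rewrite h -{2}h; semiring.
Qed.

Lemma faddE p q : fadd (fcl p) (fcl q) = fcl (padd p q).
Proof.
apply/fcl_eq; apply: frel_trans (padd_l _ (frep_cl p)) _.
apply: frel_trans (paddC _ _) _; apply: frel_trans (paddC _ _).
exact: padd_l (frep_cl q).
Qed.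

Lemma fmulE p q : fmul (fcl p) (fcl q) = fcl (pmul p q).
Proof.
apply/fcl_eq; apply: frel_trans (pmul_l _ (frep_cl p)) _.
apply: frel_trans (pmulC _ _) _; apply: frel_trans (pmulC _ _).
exact: pmul_l (frep_cl q).
Qed.

Lemma foppE p : fopp (fcl p) = fcl (popp p).
Proof.
apply/fcl_eq; have := frep_cl p; rewrite /frel /=; move: (qrep _) => r h.
transitivity (fpos p * fden r + fneg r * fden p); first by semiring.
by rewrite -h; semiring.
Qed.

Ltac fe := rewrite /fnat ?foppE ?faddE ?fmulE ?faddE; apply/fcl_eq; rewrite /frel /=; semiring.

Lemma faddA : associative fadd.
Proof.
by move=> x y z; case: (fcl_sur x) (fcl_sur y) (fcl_sur z) => p -> [q ->] [r ->]; rewrite !faddE; fe.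
Qed.
Lemma faddC : commutative fadd.
Proof. by move=> x y; case: (fcl_sur x) (fcl_sur y) => p -> [q ->]; fe. Qed.
Lemma fadd0 : left_id (fnat 0) fadd.
Proof. by move=> x; case: (fcl_sur x) => p ->; fe. Qed.
Lemma faddN : left_inverse (fnat 0) fopp fadd.
Proof. by move=> x; case: (fcl_sur x) => p ->; fe. Qed.
Lemma fmulA : associative fmul.
Proof.
by move=> x y z; case: (fcl_sur x) (fcl_sur y) (fcl_sur z) => p -> [q ->] [r ->]; rewrite !fmulE; fe.
Qed.
Lemma fmulC : commutative fmul.
Proof. by move=> x y; case: (fcl_sur x) (fcl_sur y) => p -> [q ->]; fe. Qed.
Lemma fmul1 : left_id (fnat 1) fmul.
Proof. by move=> x; case: (fcl_sur x) => p ->; fe. Qed.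
Lemma fmulDl : left_distributive fmul fadd.
Proof.
by move=> x y z; case: (fcl_sur x) (fcl_sur y) (fcl_sur z) => p -> [q ->] [r ->]; rewrite faddE !fmulE; fe.
Qed.
Lemma fnat_inj a b : fnat a = fnat b -> a = b.
Proof. by move/fcl_eq; rewrite /frel /= => h; transitivity (a * 1 + 0 * 1); [|rewrite h]; semiring. Qed.

HB.instance Definition _ := gen_eqMixin ffield.
HB.instance Definition _ := gen_choiceMixin ffield.
HB.instance Definition _ := GRing.isZmodule.Build ffield faddA faddC fadd0 faddN.
Lemma fone_neq0 : fnat 1 != fnat 0.
Proof. by apply/eqP => /fnat_inj /sd_nontrivial. Qed.
HB.instance Definition _ := GRing.Zmodule_isComNzRing.Build ffield fmulA fmulC fmul1 fmulDl fone_neq0.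

Lemma fnatD a b : fnat (a + b) = (fnat a + fnat b)%R :> ffield.
Proof. by rewrite [RHS]faddE; apply/fcl_eq; rewrite /frel /=; semiring. Qed.
Lemma fnatM a b : fnat (a * b) = (fnat a * fnat b)%R :> ffield.
Proof. by rewrite [RHS]fmulE; apply/fcl_eq; rewrite /frel /=; semiring. Qed.

Definition fge0 (x : ffield) := exists a d, d <> 0 /\ (x * fnat d)%R = fnat a.

Lemma fge0_total x : fge0 x \/ fge0 (- x)%R.
Proof.
case: (fcl_sur x) => -[a b d hd] ->; have [c [] e] := sd_sub a b; [left|right].
  exists c, d; split=> //; rewrite [LHS]fmulE; apply/fcl_eq; rewrite /frel /= e; semiring.
exists c, d; split=> //; rewrite [X in (X * _)%R]foppE [LHS]fmulE; apply/fcl_eq; rewrite /frel /= e; semiring.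
Qed.

(** Comparing numerator parts by [sd_sub] turns the fraction into c/d or -c/d, inverted by d/c or
    -d/c. *)
Lemma finv_ex (x : ffield) : exists y, x != 0%R -> (y * x)%R = 1%R.
Proof.
case: (fcl_sur x) => -[a b d hd] ->; have [c [] e] := sd_sub a b;
  (case: (pselect (c = 0)) => hc;
   [by exists 0%R => /eqP []; apply/fcl_eq; rewrite /frel /= e hc; semiring|]).
  exists (fcl (Frac d 0 hc)) => _.
  by rewrite [LHS]fmulE; apply/fcl_eq; rewrite /frel /= e; semiring.
exists (fcl (Frac 0 d hc)) => _.
by rewrite [LHS]fmulE; apply/fcl_eq; rewrite /frel /= e; semiring.
Qed.

Definition finv (x : ffield) : ffield :=
  if x == 0%R then 0%R else projT1 (cid (finv_ex x)).
Lemma fmulV x : x != 0%R -> (finv x * x)%R = 1%R.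
Proof. by move=> hx; rewrite /finv; case: cid => y hy /=; rewrite (negbTE hx) hy. Qed.
Lemma finv0 : finv 0%R = 0%R.
Proof. by rewrite /finv; case: cid => y _ /=; rewrite eqxx. Qed.
HB.instance Definition _ := GRing.ComNzRing_isField.Build ffield fmulV finv0.

Lemma fnat_eq0 a : (fnat a == 0%R) = `[<a = 0>].
Proof. by apply/eqP/asboolP => [/fnat_inj|->]. Qed.

Lemma fnat_neq0 a : a <> 0 -> fnat a != 0%R.
Proof. by move=> h; rewrite fnat_eq0; apply/asboolP. Qed.

Definition fle (x y : ffield) : bool := `[< fge0 (y - x)%R >].
Definition flt (x y : ffield) : bool := (y != x) && fle x y.
Definition fnorm (x : ffield) : ffield := if fle 0%R x then x else (- x)%R.

Lemma fge0D x y : fge0 x -> fge0 y -> fge0 (x + y)%R.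
Proof.
move=> [a [d [hd e]]] [a' [d' [hd' e']]]; exists (a * d' + a' * d), (d * d').
split; first exact: mul_neq0.
by rewrite fnatD !fnatM -e -e'; ring.
Qed.

Lemma fge0M x y : fge0 x -> fge0 y -> fge0 (x * y)%R.
Proof.
move=> [a [d [hd e]]] [a' [d' [hd' e']]]; exists (a * a'), (d * d').
split; first exact: mul_neq0.
by rewrite !fnatM -e -e'; ring.
Qed.

Lemma fge0_anti x : fge0 x -> fge0 (- x)%R -> x = 0%R.
Proof.
move=> [a [d [hd e]]] [a' [d' [hd' e']]].
have : fnat (a * d' + a' * d) = fnat 0.
  transitivity (0%R : ffield) => //; rewrite fnatD !fnatM -e -e'. ring.
move=> /fnat_inj /sd_zerosum /sd_integral [] // ha.
move/eqP: e; rewrite ha [fnat 0]/(0%R : ffield) mulf_eq0 (negbTE (fnat_neq0 hd)) orbF.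
by move/eqP.
Qed.

Lemma fle0E x : fle 0%R x = `[<fge0 x>]. Proof. by rewrite /fle subr0. Qed.

Lemma fle_add x y : fle 0%R x -> fle 0%R y -> fle 0%R (x + y)%R.
Proof. by rewrite !fle0E => /asboolP h /asboolP h'; apply/asboolP/fge0D. Qed.
Lemma fle_mul x y : fle 0%R x -> fle 0%R y -> fle 0%R (x * y)%R.
Proof. by rewrite !fle0E => /asboolP h /asboolP h'; apply/asboolP/fge0M. Qed.
Lemma fle_anti x : fle 0%R x -> fle x 0%R -> x = 0%R.
Proof. by rewrite fle0E /fle sub0r => /asboolP h /asboolP; apply: fge0_anti. Qed.
Lemma fle_sub x y : fle 0%R (y - x)%R = fle x y.
Proof. by rewrite fle0E. Qed.
Lemma fle_total x : fle 0%R x || fle x 0%R.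
Proof. by rewrite fle0E /fle sub0r; apply/orP; case: (fge0_total x) => h; [left|right]; apply/asboolP. Qed.
Lemma fnormN x : fnorm (- x)%R = fnorm x.
Proof.
rewrite /fnorm; have [] := (fle_total x, fle_total (- x)%R).
have e : fle (- x)%R 0%R = fle 0%R x by rewrite -fle_sub sub0r opprK.
have e' : fle x 0%R = fle 0%R (- x)%R by rewrite -fle_sub sub0r.
rewrite e e' opprK; case h1: (fle 0%R x); case h2: (fle 0%R (- x)%R) => // _ _.
by rewrite (@fle_anti x h1) ?oppr0 // e'.
Qed.
Lemma fge0_norm x : fle 0%R x -> fnorm x = x.
Proof. by rewrite /fnorm => ->. Qed.
Lemma flt_def x y : flt x y = (y != x) && fle x y. Proof. by []. Qed.

HB.instance Definition _ := Num.IntegralDomain_isLeReal.Build ffield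
  fle_add fle_mul fle_anti fle_sub fle_total fnormN fge0_norm flt_def.

Lemma fnat_ge0 a : (0 <= fnat a)%R.
Proof.
rewrite [(_ <= _)%R]fle0E; apply/asboolP; exists a, 1; split; first exact: sd_nontrivial.
by rewrite -fnatM; congr fnat; semiring.
Qed.

Lemma ffieldE (x : ffield) : exists a b d, d <> 0 /\ x = ((fnat a - fnat b) / fnat d)%R.
Proof.
case: (fcl_sur x) => -[a b d hd] ->; exists a, b, d; split=> //.
apply: (canRL (mulfK (fnat_neq0 hd))).
rewrite [X in (_ + X)%R]foppE [RHS]faddE [LHS]fmulE.
by apply/fcl_eq; rewrite /frel /=; semiring.
Qed.

End Fractions.

Record fraction_field (S : semidomain) := FractionField {
  ff_field :> realFieldType;
  ff_nat : S -> ff_field;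
  ff_nat0 : ff_nat (sd0 S) = 0%R;
  ff_nat1 : ff_nat (sd1 S) = 1%R;
  ff_natD : forall a b, ff_nat (sdadd a b) = (ff_nat a + ff_nat b)%R;
  ff_natM : forall a b, ff_nat (sdmul a b) = (ff_nat a * ff_nat b)%R;
  ff_nat_inj : injective ff_nat;
  ff_nat_ge0 : forall a, (0 <= ff_nat a)%R;
  ff_surj : forall x, exists a b d, d <> sd0 S /\ x = ((ff_nat a - ff_nat b) / ff_nat d)%R }.

(* Opaque, so that [ring] and [lra] do not unfold the construction. *)
Lemma fraction_field_of (S : semidomain) : fraction_field S.
Proof.
exact: (@FractionField S (ffield S) (@fnat S) erefl erefl (@fnatD S) (@fnatM S)
  (@fnat_inj S) (@fnat_ge0 S) (@ffieldE S)).
Qed.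

(** * Arithmetic in a model *)

(** [m_valid] asks for derivability in all contexts, the form in which [completeness] supplies
    it. *)
Record model := Model {
  mstr :> structure;
  m_ext : extensional mstr;
  m_valid : forall B : form nil,
    (forall G (s : sub nil G) (H : list (form G)), nd RCA0w H (fsub s B)) ->
    sem B (enil mstr) }.
Arguments m_valid : clear implicits.

(** * Combinators and the values of closed terms *)

Section Combinators.
Variable M : model.

Lemma m_Pi r s (x : dom M r) (y : dom M s) : app (app (cst M (Pi r s)) x) y = x.
Proof.
have h : sem (∀ x : r, ∀ y : s, eqt (Cst (Pi r s) · $x · $y) $x)%L (enil M).
  apply: (m_valid M) => G t H; apply: nd_ax; have := @ax_Pi G r s.
  by rewrite /bind_all /= fsub_eqt.
by move: (h x y) => /sem_eqt; apply; apply: m_ext.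
Qed.

Lemma m_Sigma r s t (x : dom M (r ⇒ s ⇒ t)) (y : dom M (r ⇒ s)) (z : dom M r) :
  app (app (app (cst M (Sigma r s t)) x) y) z = app (app x z) (app y z).
Proof.
have h : sem (∀ x : r ⇒ s ⇒ t, ∀ y : r ⇒ s, ∀ z : r,
      eqt (Cst (Sigma r s t) · $x · $y · $z) ($x · $z · ($y · $z)))%L (enil M).
  apply: (m_valid M) => G u H; apply: nd_ax; have := @ax_Sigma G r s t.
  by rewrite /bind_all /= fsub_eqt.
by move: (h x y z) => /sem_eqt; apply; apply: m_ext.
Qed.

Lemma unshift_spec G s t (a : term (s :: G) t) (b : term G t) :
  unshift a = Some b -> a = tsub (@shift G s) b.
Proof.
elim: a b => {t} /= [t v|t c|u t f IHf a IHa] b.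
- move: t v b; apply: var_case => //= t v b.
  by case=> <-.
- by case=> <-.
- case: (unshift f) IHf => // f' /(_ _ erefl) ->.
  by case: (unshift a) IHa => // a' /(_ _ erefl) -> [<-].
Qed.

(** The axioms of [Pi] and [Sigma] justify each clause of [lam]; [hu] covers the shortcut for
    subterms without the abstracted variable. *)
Lemma eval_lam G (r : env M G) s t (a : term (s :: G) t) (x : dom M s) :
  app (eval r (lam a)) x = eval (econs x r) a.
Proof.
have hu (u : fty) (c : term (s :: G) u) d : unshift c = Some d ->
    app (eval r (App (Cst (Pi u s)) d)) x = eval (econs x r) c.
  by move/unshift_spec => ->; rewrite eval_tsub /= m_Pi.
elim: a => {t} [t v|t c|u t f IHf a IHa] /=.
- case e: (unshift_var v) => [d|]; first by rewrite (hu _ (Var v)).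
  move: t v e; apply: var_case => //= _.
  by rewrite m_Sigma !m_Pi.
- by rewrite m_Pi.
- have e0 : app (eval r (App (App (Cst (Sigma s u t)) (lam f)) (lam a))) x =
      app (eval (econs x r) f) (eval (econs x r) a).
    by rewrite /= m_Sigma IHf IHa.
  case ef: (unshift f) => [f'|]; last exact: e0.
  case ea: (unshift a) => [a'|]; last exact: e0.
  by rewrite (hu _ (App f a)) //= ef ea.
Qed.

Lemma eval_bind_lam G (r : env M G) s t (f : term (s :: G) s -> term (s :: G) t) (x : dom M s) :
  app (eval r (bind_lam f)) x = eval (econs x r) (f (Var V0)).
Proof. exact: eval_lam. Qed.

Lemma eval_closed G (r : env M G) t (c : term nil t) (c' : term G t) :
  c' = tsub (fun u v => False_rect _ (var_nil v)) c -> eval r c' = eval (enil M) c.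
Proof.
move=> ->; rewrite eval_tsub; congr (eval _ c).
by apply: famE => u v; case: (var_nil v).
Qed.
End Combinators.

(* The values of the closed terms are sealed: unification would otherwise unfold
   the combinator terms. *)
Record constants (M : structure) := Constants {
  c_Pred : dom M T1;
  c_Monus : dom M (tN ⇒ tN ⇒ tN);
  c_Pow2 : dom M T1;
  c_Sqrt : dom M T1;
  c_Pair : dom M (tN ⇒ tN ⇒ tN);
  c_Fst : dom M T1;
  c_Snd : dom M T1;
  c_Qpos : dom M T1;
  c_Qneg : dom M T1;
  c_Qden : dom M T1;
  c_Qmk : dom M (tN ⇒ tN ⇒ tN ⇒ tN);
  c_Qadd : dom M (tN ⇒ tN ⇒ tN);
  c_Qopp : dom M T1;
  c_Qsub : dom M (tN ⇒ tN ⇒ tN);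
  c_Qabs : dom M T1;
  c_Qexp : dom M T1;
  c_Qexp1 : dom M T1;
  c_Q0 : dom M tN;
  c_Q1 : dom M tN;
  c_RofQ : dom M (tN ⇒ T1);
  c_Radd : dom M (T1 ⇒ T1 ⇒ T1);
  c_Ropp : dom M (T1 ⇒ T1);
  c_Rsub : dom M (T1 ⇒ T1 ⇒ T1);
  c_Rabs : dom M (T1 ⇒ T1);
  c_Rsum : dom M ((tN ⇒ T1) ⇒ tN ⇒ T1);
  c_R0 : dom M T1;
  c_R1 : dom M T1;
  c_PredE : forall G (r : env M G), eval r Pred = c_Pred;
  c_MonusE : forall G (r : env M G), eval r Monus = c_Monus;
  c_Pow2E : forall G (r : env M G), eval r Pow2 = c_Pow2;
  c_SqrtE : forall G (r : env M G), eval r Sqrt = c_Sqrt;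
  c_PairE : forall G (r : env M G), eval r Pair = c_Pair;
  c_FstE : forall G (r : env M G), eval r Fst = c_Fst;
  c_SndE : forall G (r : env M G), eval r Snd = c_Snd;
  c_QposE : forall G (r : env M G), eval r Qpos = c_Qpos;
  c_QnegE : forall G (r : env M G), eval r Qneg = c_Qneg;
  c_QdenE : forall G (r : env M G), eval r Qden = c_Qden;
  c_QmkE : forall G (r : env M G), eval r Qmk = c_Qmk;
  c_QaddE : forall G (r : env M G), eval r Qadd = c_Qadd;
  c_QoppE : forall G (r : env M G), eval r Qopp = c_Qopp;
  c_QsubE : forall G (r : env M G), eval r Qsub = c_Qsub;
  c_QabsE : forall G (r : env M G), eval r Qabs = c_Qabs;
  c_QexpE : forall G (r : env M G), eval r Qexp = c_Qexp;
  c_Qexp1E : forall G (r : env M G), eval r Qexp1 = c_Qexp1;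
  c_Q0E : forall G (r : env M G), eval r Q0 = c_Q0;
  c_Q1E : forall G (r : env M G), eval r Q1 = c_Q1;
  c_RofQE : forall G (r : env M G), eval r RofQ = c_RofQ;
  c_RaddE : forall G (r : env M G), eval r Radd = c_Radd;
  c_RoppE : forall G (r : env M G), eval r Ropp = c_Ropp;
  c_RsubE : forall G (r : env M G), eval r Rsub = c_Rsub;
  c_RabsE : forall G (r : env M G), eval r Rabs = c_Rabs;
  c_RsumE : forall G (r : env M G), eval r Rsum = c_Rsum;
  c_R0E : forall G (r : env M G), eval r R0 = c_R0;
  c_R1E : forall G (r : env M G), eval r R1 = c_R1 }.

Lemma constants_of (M : model) : constants M.
Proof.
pose c t (a : term nil t) := eval (enil M) a.
apply: (@Constants M (c _ Pred) (c _ Monus) (c _ Pow2) (c _ Sqrt) (c _ Pair) (c _ Fst) (c _ Snd) (c _ Qpos) (c _ Qneg) (c _ Qden) (c _ Qmk) (c _ Qadd) (c _ Qopp) (c _ Qsub) (c _ Qabs) (c _ Qexp) (c _ Qexp1) (c _ Q0) (c _ Q1) (c _ RofQ) (c _ Radd) (c _ Ropp) (c _ Rsub) (c _ Rabs) (c _ Rsum) (c _ R0) (c _ R1));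
  by move=> G r; apply: eval_closed.
Qed.

Definition mPred (M : model) := c_Pred (constants_of M).
Definition mMonus (M : model) := c_Monus (constants_of M).
Definition mPow2 (M : model) := c_Pow2 (constants_of M).
Definition mSqrt (M : model) := c_Sqrt (constants_of M).
Definition mPair (M : model) := c_Pair (constants_of M).
Definition mFst (M : model) := c_Fst (constants_of M).
Definition mSnd (M : model) := c_Snd (constants_of M).
Definition mQpos (M : model) := c_Qpos (constants_of M).
Definition mQneg (M : model) := c_Qneg (constants_of M).
Definition mQden (M : model) := c_Qden (constants_of M).
Definition mQmk (M : model) := c_Qmk (constants_of M).
Definition mQadd (M : model) := c_Qadd (constants_of M).
Definition mQopp (M : model) := c_Qopp (constants_of M).
Definition mQsub (M : model) := c_Qsub (constants_of M).
Definition mQabs (M : model) := c_Qabs (constants_of M).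
Definition mQexp (M : model) := c_Qexp (constants_of M).
Definition mQexp1 (M : model) := c_Qexp1 (constants_of M).
Definition mQ0 (M : model) := c_Q0 (constants_of M).
Definition mQ1 (M : model) := c_Q1 (constants_of M).
Definition mRofQ (M : model) := c_RofQ (constants_of M).
Definition mRadd (M : model) := c_Radd (constants_of M).
Definition mRopp (M : model) := c_Ropp (constants_of M).
Definition mRsub (M : model) := c_Rsub (constants_of M).
Definition mRabs (M : model) := c_Rabs (constants_of M).
Definition mRsum (M : model) := c_Rsum (constants_of M).
Definition mR0 (M : model) := c_R0 (constants_of M).
Definition mR1 (M : model) := c_R1 (constants_of M).

Lemma eval_Pred (M : model) G (r : env M G) : eval r Pred = mPred M.
Proof. exact: c_PredE. Qed.
Lemma eval_Monus (M : model) G (r : env M G) : eval r Monus = mMonus M.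
Proof. exact: c_MonusE. Qed.
Lemma eval_Pow2 (M : model) G (r : env M G) : eval r Pow2 = mPow2 M.
Proof. exact: c_Pow2E. Qed.
Lemma eval_Sqrt (M : model) G (r : env M G) : eval r Sqrt = mSqrt M.
Proof. exact: c_SqrtE. Qed.
Lemma eval_Pair (M : model) G (r : env M G) : eval r Pair = mPair M.
Proof. exact: c_PairE. Qed.
Lemma eval_Fst (M : model) G (r : env M G) : eval r Fst = mFst M.
Proof. exact: c_FstE. Qed.
Lemma eval_Snd (M : model) G (r : env M G) : eval r Snd = mSnd M.
Proof. exact: c_SndE. Qed.
Lemma eval_Qpos (M : model) G (r : env M G) : eval r Qpos = mQpos M.
Proof. exact: c_QposE. Qed.
Lemma eval_Qneg (M : model) G (r : env M G) : eval r Qneg = mQneg M.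
Proof. exact: c_QnegE. Qed.
Lemma eval_Qden (M : model) G (r : env M G) : eval r Qden = mQden M.
Proof. exact: c_QdenE. Qed.
Lemma eval_Qmk (M : model) G (r : env M G) : eval r Qmk = mQmk M.
Proof. exact: c_QmkE. Qed.
Lemma eval_Qadd (M : model) G (r : env M G) : eval r Qadd = mQadd M.
Proof. exact: c_QaddE. Qed.
Lemma eval_Qopp (M : model) G (r : env M G) : eval r Qopp = mQopp M.
Proof. exact: c_QoppE. Qed.
Lemma eval_Qsub (M : model) G (r : env M G) : eval r Qsub = mQsub M.
Proof. exact: c_QsubE. Qed.
Lemma eval_Qabs (M : model) G (r : env M G) : eval r Qabs = mQabs M.
Proof. exact: c_QabsE. Qed.
Lemma eval_Qexp (M : model) G (r : env M G) : eval r Qexp = mQexp M.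
Proof. exact: c_QexpE. Qed.
Lemma eval_Qexp1 (M : model) G (r : env M G) : eval r Qexp1 = mQexp1 M.
Proof. exact: c_Qexp1E. Qed.
Lemma eval_Q0 (M : model) G (r : env M G) : eval r Q0 = mQ0 M.
Proof. exact: c_Q0E. Qed.
Lemma eval_Q1 (M : model) G (r : env M G) : eval r Q1 = mQ1 M.
Proof. exact: c_Q1E. Qed.

Lemma eval_RofQ (M : model) G (r : env M G) : eval r RofQ = mRofQ M.
Proof. exact: c_RofQE. Qed.
Lemma eval_Radd (M : model) G (r : env M G) : eval r Radd = mRadd M.
Proof. exact: c_RaddE. Qed.
Lemma eval_Ropp (M : model) G (r : env M G) : eval r Ropp = mRopp M.
Proof. exact: c_RoppE. Qed.
Lemma eval_Rsub (M : model) G (r : env M G) : eval r Rsub = mRsub M.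
Proof. exact: c_RsubE. Qed.
Lemma eval_Rabs (M : model) G (r : env M G) : eval r Rabs = mRabs M.
Proof. exact: c_RabsE. Qed.
Lemma eval_Rsum (M : model) G (r : env M G) : eval r Rsum = mRsum M.
Proof. exact: c_RsumE. Qed.
Lemma eval_R0 (M : model) G (r : env M G) : eval r R0 = mR0 M.
Proof. exact: c_R0E. Qed.
Lemma eval_R1 (M : model) G (r : env M G) : eval r R1 = mR1 M.
Proof. exact: c_R1E. Qed.

Definition evQ := (eval_Pred, eval_Monus, eval_Pow2, eval_Sqrt, eval_Pair, eval_Fst, eval_Snd, eval_Qpos, eval_Qneg, eval_Qden, eval_Qmk, eval_Qadd, eval_Qopp, eval_Qsub, eval_Qabs, eval_Qexp, eval_Qexp1, eval_Q0, eval_Q1, eval_RofQ, eval_Radd, eval_Ropp, eval_Rsub, eval_Rabs, eval_Rsum, eval_R0, eval_R1).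

Declare Scope M_scope.
Delimit Scope M_scope with M.
Notation "f · a" := (app f a) (at level 20, left associativity) : M_scope.

Section Operations.
Variable M : structure.
Local Notation N := (dom M tN).
Local Open Scope M_scope.
Definition n0 : N := cst M Zero.
Definition n1 : N := cst M One.
Definition nadd (x y : N) : N := cst M Plus · x · y.
Definition nmul (x y : N) : N := cst M Times · x · y.
End Operations.
Arguments nadd {M} x y.
Arguments nmul {M} x y.

Ltac fold_ops :=
  repeat match goal with
  | |- context [app (app (cst _ Plus) ?a) ?b] =>
    change (app (app (cst _ Plus) a) b) with (nadd a b)
  | |- context [app (app (cst _ Times) ?a) ?b] =>
    change (app (app (cst _ Times) a) b) with (nmul a b)
  | |- context [cst ?M Zero] => change (cst M Zero) with (n0 M)
  | |- context [cst ?M One] => change (cst M One) with (n1 M)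
  end.

(* Syntactic matching: plain rewriting would unfold the constants of [Defs]. *)
Ltac ev :=
  cbn [eval econs];
  repeat (match goal with
  | |- context [app (eval ?r (bind_lam ?f)) ?x] => rewrite (eval_bind_lam r f x)
  | |- context [eval ?r (wk (e := ?e) ?a)] => rewrite (@eval_wk _ _ _ e r _ a)
  end; cbn [eval econs ext_cons ext_refl ext_var wk tsub ext_sub rec]);
  fold_ops.

Section Arithmetic.
Variable M : model.
Local Notation N := (dom M tN).
Local Open Scope M_scope.

Definition nlt (x y : N) : Prop := ltD x y.
Definition nrec (f : dom M (tN ⇒ tN ⇒ tN)) (m n : N) : N := cst M (Rec tN) · f · m · n.
Local Notation "0" := (n0 M) : M_scope.
Local Notation "1" := (n1 M) : M_scope.
Local Infix "+" := nadd : M_scope.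
Local Infix "*" := nmul : M_scope.

Ltac axiom ax := apply: (m_valid M) => G s H; apply: nd_ax; exact: ax.

Lemma naddA (x y z : N) : x + (y + z) = x + y + z.
Proof.
have h : sem (∀ x : tN, ∀ y : tN, ∀ z : tN, $x + ($y + $z) == ($x + $y) + $z)%L (enil M) by axiom ax_addA.
exact: h.
Qed.
Lemma naddC (x y : N) : x + y = y + x.
Proof.
have h : sem (∀ x : tN, ∀ y : tN, $x + $y == $y + $x)%L (enil M) by axiom ax_addC.
exact: h.
Qed.
Lemma nadd0 (x : N) : x + 0 = x.
Proof.
have h : sem (∀ x : tN, $x + 0 == $x)%L (enil M) by axiom ax_add0.
exact: h.
Qed.
Lemma nmulA (x y z : N) : x * (y * z) = x * y * z.
Proof.
have h : sem (∀ x : tN, ∀ y : tN, ∀ z : tN, $x * ($y * $z) == ($x * $y) * $z)%L (enil M) by axiom ax_mulA.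
exact: h.
Qed.
Lemma nmulC (x y : N) : x * y = y * x.
Proof.
have h : sem (∀ x : tN, ∀ y : tN, $x * $y == $y * $x)%L (enil M) by axiom ax_mulC.
exact: h.
Qed.
Lemma nmul1 (x : N) : x * 1 = x.
Proof.
have h : sem (∀ x : tN, $x * 1 == $x)%L (enil M) by axiom ax_mul1.
exact: h.
Qed.
Lemma nmul0 (x : N) : x * 0 = 0.
Proof.
have h : sem (∀ x : tN, $x * 0 == 0)%L (enil M) by axiom ax_mul0.
exact: h.
Qed.
Lemma nmulD (x y z : N) : x * (y + z) = x * y + x * z.
Proof.
have h : sem (∀ x : tN, ∀ y : tN, ∀ z : tN, $x * ($y + $z) == $x * $y + $x * $z)%L (enil M) by axiom ax_mulD.
exact: h.
Qed.
Lemma nltI (x : N) : ~ nlt x x.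
Proof.
have h : sem (∀ x : tN, ~ $x < $x)%L (enil M) by axiom ax_ltI.
exact: h.
Qed.
Lemma nltT (x y z : N) : nlt x y -> nlt y z -> nlt x z.
Proof.
have h : sem (∀ x : tN, ∀ y : tN, ∀ z : tN, $x < $y --> $y < $z --> $x < $z)%L (enil M) by axiom ax_ltT.
exact: h.
Qed.
Lemma nlt_total (x y : N) : nlt x y \/ x = y \/ nlt y x.
Proof.
have h : sem (∀ x : tN, ∀ y : tN, $x < $y \/ $x == $y \/ $y < $x)%L (enil M) by axiom ax_lt_total.
exact: h.
Qed.
Lemma nlt_add (x y z : N) : nlt x y -> nlt (x + z) (y + z).
Proof.
have h : sem (∀ x : tN, ∀ y : tN, ∀ z : tN, $x < $y --> $x + $z < $y + $z)%L (enil M) by axiom ax_lt_add.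
exact: h.
Qed.
Lemma nlt_mul (x y z : N) : nlt x y -> nlt 0 z -> nlt (x * z) (y * z).
Proof.
have h : sem (∀ x : tN, ∀ y : tN, ∀ z : tN, $x < $y --> 0 < $z --> $x * $z < $y * $z)%L (enil M) by axiom ax_lt_mul.
exact: h.
Qed.
Lemma nlt01 : nlt 0 1.
Proof.
have h : sem (0 < 1)%L (enil M) by axiom ax_lt01.
exact: h.
Qed.
Lemma nge0 (x : N) : ~ nlt x 0.
Proof.
have h : sem (∀ x : tN, ~ $x < 0)%L (enil M) by axiom ax_ge0.
exact: h.
Qed.
Lemma nltS (x y : N) : nlt x (y + 1) <-> nlt x y \/ x = y.
Proof.
have h : sem (∀ x : tN, ∀ y : tN, $x < $y + 1 <--> $x < $y \/ $x == $y)%L (enil M) by axiom ax_ltS.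
by have [] := h x y.
Qed.
Lemma nrec0 f (m : N) : nrec f m 0 = m.
Proof.
have h : sem (∀ f : tN ⇒ tN ⇒ tN, ∀ m : tN, rec $f $m 0 == $m)%L (enil M) by axiom ax_R0_0.
exact: h.
Qed.
Lemma nrecS f (m n : N) : nrec f m (n + 1) = f · n · nrec f m n.
Proof.
have h : sem (∀ f : tN ⇒ tN ⇒ tN, ∀ m : tN, ∀ n : tN,
      rec $f $m ($n + 1) == $f · $n · rec $f $m $n)%L (enil M) by axiom ax_R0_S.
exact: h.
Qed.

(** * Quantifier-free induction and represented functions *)

Definition ind_matrix (G : ctx) : form (tN :: T1 :: T1 :: T1 :: T1 :: G) :=
  let n := Var V0 in
  (Var (VS V0) · n < Var (VS (VS V0)) · n \/
   Var (VS (VS (VS V0))) · n == Var (VS (VS (VS (VS V0)))) · n)%L.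

(** One instance of the schema, with functions of the model as parameters, carries every later
    induction. The disjunct with [<] serves to establish predecessor and cut-off subtraction; after
    that, equations suffice. *)
Lemma nind_fun (f g h k : dom M T1) :
  let P n := nlt (h · n) (k · n) \/ f · n = g · n in
  P 0 -> (forall n, P n -> P (n + 1)) -> forall n, P n.
Proof.
have H : sem (All T1 (All T1 (All T1 (All T1 (QF_IND (@ind_matrix nil)))))) (enil M).
  apply: (m_valid M) => G s H; do 4 apply: nd_allI; apply: nd_ax.
  by have := @ax_ind _ (@ind_matrix G); apply.
move=> P h0 hS; apply: (H g f k h); split; first exact: h0.
exact: hS.
Qed.

(** The numbers of [M] may be nonstandard and admit no induction from outside, so induction is
    confined to functions that an element of [M] represents. *)
Definition dfn (f : N -> N) := exists F : dom M T1, forall n, F · n = f n.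

Lemma dfn_id : dfn (fun n => n).
Proof. by exists (eval (enil M) (λ n : tN, $n)%L) => n; ev. Qed.
Lemma dfn_const (c : N) : dfn (fun n => c).
Proof. by exists (eval (enil M) (λ c : tN, λ n : tN, $c)%L · c) => n; ev. Qed.
Lemma dfn_app (F : dom M T1) f : dfn f -> dfn (fun n => F · f n).
Proof.
move=> [f' hf]; exists (eval (enil M) (λ F : T1, λ f : T1, λ n : tN, $F · ($f · $n))%L · F · f') => n.
by ev; rewrite hf.
Qed.
Lemma dfn_app2 (F : dom M (tN ⇒ tN ⇒ tN)) f g : dfn f -> dfn g ->
  dfn (fun n => F · f n · g n).
Proof.
move=> [f' hf] [g' hg].
exists (eval (enil M) (λ F : tN ⇒ tN ⇒ tN, λ f : T1, λ g : T1, λ n : tN,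
   $F · ($f · $n) · ($g · $n))%L · F · f' · g') => n.
by ev; rewrite hf hg.
Qed.
Lemma dfn_add f g : dfn f -> dfn g -> dfn (fun n => f n + g n).
Proof. exact: dfn_app2. Qed.
Lemma dfn_mul f g : dfn f -> dfn g -> dfn (fun n => f n * g n).
Proof. exact: dfn_app2. Qed.

Lemma nind_or (f g h k : N -> N) : dfn f -> dfn g -> dfn h -> dfn k ->
  let P n := nlt (h n) (k n) \/ f n = g n in
  P 0 -> (forall n, P n -> P (n + 1)) -> forall n, P n.
Proof.
move=> [f' hf] [g' hg] [h' hh] [k' hk] P h0 hS n.
have e m : P m = (nlt (h' · m) (k' · m) \/ f' · m = g' · m) by rewrite hf hg hh hk.
by rewrite e; apply: nind_fun; rewrite -?e // => m; rewrite -!e; apply: hS.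
Qed.

Lemma nind_eq (f g : N -> N) : dfn f -> dfn g -> f 0 = g 0 ->
  (forall n, f n = g n -> f (n + 1) = g (n + 1)) -> forall n, f n = g n.
Proof.
move=> hf hg h0 hS n.
case: (@nind_or f g (fun => 0) (fun => 0) hf hg (dfn_const _) (dfn_const _) _ _ n) => //.
- by right.
- by move=> m [/nltI //|/hS]; right.
- by move=> /nltI.
Qed.

Local Notation mPred := (mPred M).
Local Notation mMonus := (mMonus M).
Local Notation mPow2 := (mPow2 M).
Local Notation mSqrt := (mSqrt M).

Lemma pred0 : mPred · 0 = 0.
Proof. by rewrite -(eval_Pred (enil M)) /Pred; ev; apply: nrec0. Qed.
Lemma predS n : mPred · (n + 1) = n.
Proof. by rewrite -(eval_Pred (enil M)) /Pred; ev; rewrite [LHS]nrecS; ev; rewrite ?evQ. Qed.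
Lemma monus0 a : mMonus · a · 0 = a.
Proof. by rewrite -(eval_Monus (enil M)) /Monus; ev; apply: nrec0. Qed.
Lemma monusS a b : mMonus · a · (b + 1) = mPred · (mMonus · a · b).
Proof. by rewrite -(eval_Monus (enil M)) /Monus; ev; rewrite [LHS]nrecS; ev; rewrite ?evQ. Qed.
Lemma pow20 : mPow2 · 0 = 1.
Proof. by rewrite -(eval_Pow2 (enil M)) /Pow2; ev; apply: nrec0. Qed.
Lemma pow2S n : mPow2 · (n + 1) = mPow2 · n + mPow2 · n.
Proof. by rewrite -(eval_Pow2 (enil M)) /Pow2; ev; rewrite [LHS]nrecS; ev; rewrite ?evQ. Qed.
Lemma sqrt0 : mSqrt · 0 = 0.
Proof. by rewrite -(eval_Sqrt (enil M)) /Sqrt; ev; apply: nrec0. Qed.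
Lemma sqrtS k : let r := mSqrt · k in
  mSqrt · (k + 1) = r + mMonus · 1 · (mMonus · ((r + 1) * (r + 1)) · (k + 1)).
Proof. by rewrite -(eval_Sqrt (enil M)) /Sqrt; ev; rewrite [LHS]nrecS; ev; rewrite ?evQ. Qed.

Lemma nlt0P n : n <> 0 -> nlt 0 n.
Proof. by move=> h; case: (nlt_total n 0) => [/nge0|[]]. Qed.

Lemma npredK n : n <> 0 -> mPred · n + 1 = n.
Proof.
(* The exception n = 0 is written n < 1 to fit the disjunctive form of induction. *)
have := @nind_or (fun n => mPred · n + 1) (fun n => n) (fun n => n) (fun n => 1).
move=> /(_ (dfn_add (dfn_app _ dfn_id) (dfn_const _)) dfn_id dfn_id (dfn_const _)).
move=> /(_ (or_introl nlt01) (fun m _ => or_intror (congr1 (fun x : N => x + 1) (predS m))) n) [] //.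
rewrite -{1}[1]nadd0 naddC => /nltS [/nge0 //|-> //].
Qed.

Lemma nmonusK a b : nlt a b \/ mMonus · a · b + b = a.
Proof.
move: b; apply: (@nind_or (fun b => mMonus · a · b + b) (fun => a) (fun => a) (fun b => b)).
- exact: dfn_add (dfn_app _ dfn_id) dfn_id.
- exact: dfn_const.
- exact: dfn_const.
- exact: dfn_id.
- by right; rewrite monus0 nadd0.
- move=> b [h|]; first by left; apply/nltS; left.
  (* If the difference is 0 then a = b, hence a < b + 1; otherwise its predecessor is exact. *)
  rewrite monusS; case: (pselect (mMonus · a · b = 0)) => [-> <-|h].
    by left; apply/nltS; right; rewrite naddC nadd0.
  by move=> e; right; rewrite -{2}e -{2}(npredK h) -!naddA (naddC b).
Qed.

Lemma nsub_ex (x y : N) : exists z, x = y + z \/ y = x + z.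
Proof.
case: (nmonusK x y) => [h|e]; last by exists (mMonus · x · y); left; rewrite naddC e.
case: (nmonusK y x) => [h'|e]; first by case: (nltI (nltT h h')).
by exists (mMonus · y · x); right; rewrite naddC e.
Qed.

Lemma naddI (x y z : N) : x + z = y + z -> x = y.
Proof.
by move=> h; case: (nlt_total x y) => [|[]] // /(nlt_add z); rewrite h => /nltI.
Qed.

Lemma nadd_eq0 (x y : N) : x + y = 0 -> x = 0.
Proof.
move=> h; apply: contrapT => /nlt0P /(nlt_add y); rewrite h => /nge0.
exact.
Qed.

Lemma nmul_eq0 (x y : N) : x * y = 0 -> x = 0 \/ y = 0.
Proof.
move=> h; apply: contrapT => /not_orP [/nlt0P hx /nlt0P hy].
by have := nlt_mul hx hy; rewrite h => /nge0.
Qed.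

Lemma n1_neq0 : 1 <> 0.
Proof. by move=> h; have := nlt01; rewrite h => /nltI. Qed.

Lemma n_semi_ring : semi_ring_theory 0 1 nadd nmul eq.
Proof.
split.
- by move=> n; rewrite naddC nadd0.
- exact: naddC.
- exact: naddA.
- by move=> n; rewrite nmulC nmul1.
- by move=> n; rewrite nmulC nmul0.
- exact: nmulC.
- exact: nmulA.
- by move=> n m p; rewrite !(nmulC _ p) nmulD.
Qed.

Definition nat_semidomain : semidomain :=
  Semidomain n_semi_ring naddI nsub_ex nadd_eq0 nmul_eq0 n1_neq0.

End Arithmetic.

Local Open Scope ring_scope.

Definition model_field (M : model) : realFieldType :=
  fraction_field_of (nat_semidomain M).

(** * Embedding the numbers in the field; decidable predicates *)

Section Rationals.
Variable M : model.
Local Notation N := (dom M tN).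
Local Notation K := (model_field M).
Local Infix "·" := app (at level 20, left associativity).
Local Open Scope ring_scope.
Local Notation "0%n" := (n0 M).
Local Notation "1%n" := (n1 M).

Definition iota_ (n : N) : K := ff_nat (fraction_field_of (nat_semidomain M)) n.
Local Notation ι := iota_.

Lemma iotaD a b : ι (nadd a b) = ι a + ι b. Proof. exact: (@ff_natD _ (fraction_field_of (nat_semidomain M))). Qed.
Lemma iotaM a b : ι (nmul a b) = ι a * ι b. Proof. exact: (@ff_natM _ (fraction_field_of (nat_semidomain M))). Qed.
Lemma iota0 : ι 0%n = 0. Proof. exact: ff_nat0. Qed.
Lemma iota1 : ι 1%n = 1. Proof. exact: ff_nat1. Qed.
Lemma iota_inj a b : ι a = ι b -> a = b. Proof. exact: (@ff_nat_inj _ (fraction_field_of (nat_semidomain M))). Qed.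
Lemma iota_ge0 a : 0 <= ι a. Proof. exact: ff_nat_ge0. Qed.
Lemma iota_gt0 a : a <> 0%n -> 0 < ι a.
Proof.
move=> ha; rewrite lt_def iota_ge0 andbT; apply/eqP => h.
by apply: ha; apply: iota_inj; rewrite h iota0.
Qed.
Lemma model_fieldE (x : K) : exists a b d, 0 < ι d /\ x = (ι a - ι b) / ι d.
Proof.
have [a [b [d [hd e]]]] := ff_surj (x : fraction_field_of (nat_semidomain M)).
by exists a, b, d; split=> //; apply: iota_gt0.
Qed.
Definition iE := (iotaD, iotaM, iota0, iota1).

Lemma iota_S a b : ι a < ι b -> ι a + 1 <= ι b.
Proof.
have [c [] e] := nsub_ex a b; rewrite e iotaD; first by have := iota_ge0 c; lra.
case: (pselect (c = 0%n)) => [->|/npredK <-]; rewrite !iE; first by lra.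
by have := iota_ge0 (mPred M · c); lra.
Qed.

Lemma iota_ge1 a : 0 < ι a -> 1 <= ι a.
Proof. by rewrite -iota0 => /iota_S; rewrite iota0 add0r. Qed.

Lemma nltE a b : nlt a b <-> ι a < ι b.
Proof.
have lt_iota x y : nlt x y -> ι x < ι y.
  move=> h; have [c [] e] := nsub_ex y x.
    rewrite e iotaD; suff : 0 < ι c by lra.
    apply: iota_gt0 => hc; apply: (@nltI M x); rewrite -{2}[x]nadd0.
    by rewrite -hc -e.
  move: h; rewrite e => h; exfalso.
  case: (pselect (c = 0%n)) => [hc|/nlt0P hc]; first by move: h; rewrite hc nadd0 => /nltI.
  have := nlt_add y hc; rewrite !(naddC _ y) nadd0 => h'.
  exact: nltI (nltT h h').
split; first exact: lt_iota.
move=> h; case: (nlt_total a b) => [//|[e|/lt_iota h']]; last by lra.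
by move: h; rewrite e ltxx.
Qed.

Lemma iota_monus a b :
  (ι a <= ι b /\ ι (mMonus M · a · b) = 0) \/
  (ι b <= ι a /\ ι (mMonus M · a · b) = ι a - ι b).
Proof.
have monus_nn n : mMonus M · n · n = 0%n.
  case: (nmonusK n n) => [/nltI //|h]; apply: (@naddI _ _ _ n).
  by rewrite h naddC nadd0.
case: (nmonusK a b) => [/nltE h|e]; [left|right].
  split; first exact: ltW.
  have [c [] e] := nsub_ex b a; last by move: h; rewrite e iotaD; have := iota_ge0 c; lra.
  (* With b = a + c the claim a ∸ (a + c) = 0 is an equation in c, open to induction. *)
  rewrite e -iota0; congr ι; move: c {e}.
  apply: (nind_eq (f := fun c => mMonus M · a · nadd a c) (g := fun _ => 0%n)).
  - by apply: dfn_app2; [exact: dfn_const|apply: dfn_add; [exact: dfn_const|exact: dfn_id]].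
  - exact: dfn_const.
  - by rewrite nadd0.
  - by move=> c h'; rewrite naddA monusS h' pred0.
by have := congr1 ι e; rewrite iotaD; have := iota_ge0 (mMonus M · a · b); lra.
Qed.

Lemma dfn_monus f g : dfn f -> dfn g -> dfn (fun n => mMonus M · f n · g n).
Proof. exact: dfn_app2. Qed.

(** A represented characteristic function stands in for quantifier-free definability. By the closure
    properties below, inductions can be stated with inequalities in the field and still reduce to an
    equation with 0. *)
Definition decp (P : N -> Prop) := exists f, dfn f /\ forall n, ι (f n) = 0 <-> P n.

Lemma decp_le f g : dfn f -> dfn g -> decp (fun n => ι (f n) <= ι (g n)).
Proof.
move=> hf hg; exists (fun n => mMonus M · f n · g n); split; first exact: dfn_monus.
by move=> n; case: (iota_monus (f n) (g n)) => -[h ->]; lra.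
Qed.

Lemma decp_and P Q : decp P -> decp Q -> decp (fun n => P n /\ Q n).
Proof.
move=> [f [hf eP]] [g [hg eQ]]; exists (fun n => nadd (f n) (g n)); split; first exact: dfn_add.
move=> n; rewrite -eP -eQ iotaD; have := iota_ge0 (f n); have := iota_ge0 (g n).
by split=> [|[]]; lra.
Qed.

Lemma decp_not P : decp P -> decp (fun n => ~ P n).
Proof.
move=> [f [hf eP]]; exists (fun n => mMonus M · 1%n · f n); split.
  by apply: dfn_monus => //; exact: dfn_const.
move=> n; rewrite -eP; case: (iota_monus 1%n (f n)) => -[h ->]; rewrite iota1 in h *; first by lra.
have := iota_ge0 (f n); case: (pselect (ι (f n) = 0)) => [->|/eqP]; first by lra.
rewrite neq_lt ltNge iota_ge0 /= -iota0 => /iota_S; rewrite iota0 => h1 h2.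
by split; lra.
Qed.

Lemma decp_eqv P Q : (forall n, P n <-> Q n) -> decp P -> decp Q.
Proof. by move=> h [f [hf e]]; exists f; split=> // n; rewrite e. Qed.

Lemma decp_or P Q : decp P -> decp Q -> decp (fun n => P n \/ Q n).
Proof.
move=> hP hQ; apply: decp_eqv (decp_not (decp_and (decp_not hP) (decp_not hQ))) => n.
by split=> [/not_andP [] /contrapT|[h []|h []]]; [left|right|..].
Qed.

Lemma decp_imp P Q : decp P -> decp Q -> decp (fun n => P n -> Q n).
Proof.
move=> hP hQ; apply: decp_eqv (decp_or (decp_not hP) hQ) => n.
by split=> [[] //|h]; case: (pselect (P n)) => [/h|]; [right|left].
Qed.

Lemma dec_ind P : decp P -> P 0%n -> (forall n, P n -> P (nadd n 1%n)) -> forall n, P n.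
Proof.
move=> [f [hf e]] h0 hS n; rewrite -e -iota0; congr ι; move: n.
apply: nind_eq hf (dfn_const _) _ _; first by apply: iota_inj; rewrite iota0 e.
by move=> n /(congr1 ι); rewrite iota0 => /e/hS h; apply: iota_inj; rewrite iota0 e.
Qed.

Lemma sqrt_spec n : let r := ι (mSqrt M · n) in r * r <= ι n /\ ι n + 1 <= (r + 1) * (r + 1).
Proof.
have h : decp (fun n => ι (nmul (mSqrt M · n) (mSqrt M · n)) <= ι n /\
    ι (nadd n 1%n) <= ι (nmul (nadd (mSqrt M · n) 1%n) (nadd (mSqrt M · n) 1%n))).
  have hs := dfn_app (mSqrt M) (dfn_id M); have h1 := dfn_const (n1 M).
  apply: decp_and; apply: decp_le; try exact: dfn_id; try exact: dfn_mul; try exact: dfn_add.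
    exact: dfn_add (dfn_id M) h1.
  by apply: dfn_mul; apply: dfn_add.
suff hP : forall n, ι (nmul (mSqrt M · n) (mSqrt M · n)) <= ι n /\
    ι (nadd n 1%n) <= ι (nmul (nadd (mSqrt M · n) 1%n) (nadd (mSqrt M · n) 1%n)).
  by have := hP n; rewrite !iE.
apply: (dec_ind h); first by rewrite sqrt0 !iE; split; lra.
move=> k; rewrite sqrtS; set r := mSqrt M · k; rewrite !iE => -[h1 h2].
set d := mMonus M · _ · nadd k 1%n.
(* The root grows by 1 ∸ d, so that d = 0 means a step of 1 and any other d, being at least 1, a
   step of 0. *)
have hd : ι d = 0 \/ 1 <= ι d.
  case: (pselect (ι d = 0)) => [->|/eqP]; first by left.
  by rewrite neq_lt ltNge iota_ge0 /= -iota0 => /iota_S; rewrite iota0 add0r; right.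
have hr := iota_ge0 r.
case: (iota_monus (nmul (nadd r 1%n) (nadd r 1%n)) (nadd k 1%n)) (iota_monus 1%n d);
  rewrite -/d !iE => -[a1 a2] [] [b1 b2]; rewrite b2; split; nra.
Qed.

End Rationals.

(** * Codes of rationals *)

Lemma addf_frac (F : fieldType) (a b c d x y : F) : x != 0 -> y != 0 ->
  (a * y + c * x - (b * y + d * x)) / (x * y) = (a - b) / x + (c - d) / y.
Proof. by move=> hx hy; field; rewrite hx hy. Qed.

Lemma mulf_frac (F : fieldType) (a b c d x y : F) : x != 0 -> y != 0 ->
  (a * c + b * d - (a * d + b * c)) / (x * y) = (a - b) / x * ((c - d) / y).
Proof. by move=> hx hy; field; rewrite hx hy. Qed.

Section Codes.
Variable M : model.
Local Notation N := (dom M tN).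
Local Notation K := (model_field M).
Local Infix "·" := app (at level 20, left associativity).
Local Open Scope ring_scope.
Local Notation "0%n" := (n0 M).
Local Notation "1%n" := (n1 M).
Local Notation ι := (@iota_ M).

Lemma nat_sep (x y w : K) : 0 <= y -> x + 1 <= y -> 0 <= x ->
  (x + 1) * (x + 1) <= y * y.
Proof. by move=> *; nra. Qed.

Local Notation mPow2 := (mPow2 M).
Local Notation mPair := (mPair M).
Local Notation mFst := (mFst M).
Local Notation mSnd := (mSnd M).
Local Notation mQpos := (mQpos M).
Local Notation mQneg := (mQneg M).
Local Notation mQden := (mQden M).
Local Notation mQmk := (mQmk M).
Local Notation mQadd := (mQadd M).
Local Notation mQopp := (mQopp M).
Local Notation mQsub := (mQsub M).
Local Notation mQabs := (mQabs M).
Local Notation mQexp := (mQexp M).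
Local Notation mQexp1 := (mQexp1 M).
Local Notation mQ0 := (mQ0 M).
Local Notation mQ1 := (mQ1 M).

Lemma mPairE a b : mPair · a · b = nadd (nmul (nadd a b) (nadd a b)) a.
Proof. by rewrite -(eval_Pair (enil M)) /Pair; ev. Qed.
Lemma mFstE c : mFst · c = mMonus M · c · nmul (mSqrt M · c) (mSqrt M · c).
Proof. by rewrite -(eval_Fst (enil M)) /Fst; ev; rewrite ?eval_Monus ?eval_Sqrt. Qed.
Lemma mSndE c : mSnd · c = mMonus M · (mSqrt M · c) · (mFst · c).
Proof. by rewrite -(eval_Snd (enil M)) /Snd; ev; rewrite ?eval_Monus ?eval_Sqrt ?eval_Fst. Qed.

(** The code (a + b)^2 + a is below (a + b + 1)^2, and the roots being compared, if different,
    differ by at least 1. *)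
Lemma sqrt_pair a b : mSqrt M · (mPair · a · b) = nadd a b.
Proof.
have := sqrt_spec (mPair · a · b); rewrite mPairE; set r := mSqrt M · _.
rewrite !iE /= => -[h1 h2]; apply: iota_inj; rewrite iotaD.
have ha := iota_ge0 a; have hb := iota_ge0 b; have hr := iota_ge0 r.
case: (ltgtP (ι r) (ι (nadd a b))) => [/iota_S h|/iota_S h|]; last by rewrite iotaD.
  by rewrite iotaD in h; have := @nat_sep (ι r) (ι a + ι b) 0; nra.
by rewrite iotaD in h; have := @nat_sep (ι a + ι b) (ι r) 0; nra.
Qed.

Lemma fst_pair a b : mFst · (mPair · a · b) = a.
Proof.
rewrite mFstE sqrt_pair; apply: iota_inj.
have ha := iota_ge0 a.
by case: (iota_monus (mPair · a · b) (nmul (nadd a b) (nadd a b))) => -[h ->];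
  rewrite mPairE !iE in h *; lra.
Qed.

Lemma snd_pair a b : mSnd · (mPair · a · b) = b.
Proof.
rewrite mSndE sqrt_pair fst_pair; apply: iota_inj.
have hb := iota_ge0 b.
by case: (iota_monus (nadd a b) a) => -[h ->]; rewrite !iE in h *; lra.
Qed.

Lemma mQdenE q : mQden · q = nadd (mSnd · q) 1%n.
Proof. by rewrite -(eval_Qden (enil M)) /Qden; ev; rewrite evQ. Qed.
Lemma mQmkE a b d : mQmk · a · b · d = mPair · (mPair · a · b) · (mMonus M · d · 1%n).
Proof. by rewrite -(eval_Qmk (enil M)) /Qmk; ev; rewrite !evQ. Qed.
Lemma pos_mk a b d : mQpos · (mQmk · a · b · d) = a.
Proof. by rewrite mQmkE -(eval_Qpos (enil M)) /Qpos; ev; rewrite ?evQ !fst_pair. Qed.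
Lemma neg_mk a b d : mQneg · (mQmk · a · b · d) = b.
Proof. by rewrite mQmkE -(eval_Qneg (enil M)) /Qneg; ev; rewrite ?evQ fst_pair snd_pair. Qed.
Lemma mQaddE p q : mQadd · p · q =
  mQmk · nadd (nmul (mQpos · p) (mQden · q)) (nmul (mQpos · q) (mQden · p))
       · nadd (nmul (mQneg · p) (mQden · q)) (nmul (mQneg · q) (mQden · p))
       · nmul (mQden · p) (mQden · q).
Proof. by rewrite -(eval_Qadd (enil M)) /Qadd; ev; rewrite !evQ. Qed.
Lemma mQoppE q : mQopp · q = mQmk · (mQneg · q) · (mQpos · q) · (mQden · q).
Proof. by rewrite -(eval_Qopp (enil M)) /Qopp; ev; rewrite !evQ. Qed.
Lemma mQsubE p q : mQsub · p · q = mQadd · p · (mQopp · q).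
Proof. by rewrite -(eval_Qsub (enil M)) /Qsub; ev; rewrite !evQ. Qed.
Lemma mQabsE q : mQabs · q =
  mQmk · nadd (mMonus M · (mQpos · q) · (mQneg · q)) (mMonus M · (mQneg · q) · (mQpos · q))
       · 0%n · (mQden · q).
Proof. by rewrite -(eval_Qabs (enil M)) /Qabs; ev; rewrite !evQ. Qed.
Lemma mQexpE n : mQexp · n = mQmk · 1%n · 0%n · (mPow2 · n).
Proof. by rewrite -(eval_Qexp (enil M)) /Qexp; ev; rewrite !evQ. Qed.
Lemma mQexp1E n : mQexp1 · n = mQmk · nadd 1%n 1%n · 0%n · (mPow2 · n).
Proof. by rewrite -(eval_Qexp1 (enil M)) /Qexp1; ev; rewrite !evQ. Qed.

Definition val (q : N) : K := (ι (mQpos · q) - ι (mQneg · q)) / ι (mQden · q).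

Lemma den_gt0 q : 0 < ι (mQden · q).
Proof. by rewrite mQdenE !iE; have := iota_ge0 (mSnd · q); lra. Qed.

Lemma den_mk a b d : 0 < ι d -> mQden · (mQmk · a · b · d) = d.
Proof.
move=> hd; rewrite mQdenE mQmkE snd_pair; apply: iota_inj; rewrite !iE.
have := iota_ge1 hd.
by case: (iota_monus d 1%n) => -[h ->]; rewrite !iE in h *; lra.
Qed.

Lemma val_mk a b d : 0 < ι d -> val (mQmk · a · b · d) = (ι a - ι b) / ι d.
Proof. by move=> hd; rewrite /val pos_mk neg_mk den_mk. Qed.

Lemma val_add p q : val (mQadd · p · q) = val p + val q.
Proof.
have hp := den_gt0 p; have hq := den_gt0 q.
rewrite mQaddE val_mk !iE ?mulr_gt0 //.
by apply: addf_frac; rewrite gt_eqF.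
Qed.

Lemma val_opp q : val (mQopp · q) = - val q.
Proof.
have hq := den_gt0 q.
by rewrite mQoppE val_mk // /val -mulNr opprB.
Qed.

Lemma val_sub p q : val (mQsub · p · q) = val p - val q.
Proof. by rewrite mQsubE val_add val_opp. Qed.

Lemma val_abs q : val (mQabs · q) = `|val q|.
Proof.
have hq := den_gt0 q.
rewrite mQabsE val_mk // !iE subr0 /val normrM normfV (gtr0_norm hq).
congr (_ / _); have := iota_monus (mQneg · q) (mQpos · q).
case: (iota_monus (mQpos · q) (mQneg · q)) => -[h ->] [] [h' ->];
  case: ler0P => h1; lra.
Qed.

(** This is 2^-n. The exponent may be nonstandard, so the power is the one computed by [Pow2] in the
    model. *)
Definition e_ (n : N) : K := (ι (mPow2 · n))^-1.

Lemma pow2_ge n : ι n + 1 <= ι (mPow2 · n).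
Proof.
have h : decp (fun n => ι (nadd n 1%n) <= ι (mPow2 · n)).
  by apply: decp_le; [apply: dfn_add; [exact: dfn_id|exact: dfn_const]|apply: dfn_app; exact: dfn_id].
rewrite -iota1 -iotaD; move: n; apply: (dec_ind h).
  by rewrite pow20 !iE; lra.
by move=> n; rewrite pow2S !iE => hn; have := iota_ge0 n; lra.
Qed.

Lemma pow2_gt0 n : 0 < ι (mPow2 · n).
Proof. by have := pow2_ge n; have := iota_ge0 n; lra. Qed.

Lemma e_gt0 n : 0 < e_ n.
Proof. by rewrite /e_ invr_gt0 pow2_gt0. Qed.

Lemma e0 : e_ 0%n = 1.
Proof. by rewrite /e_ pow20 iota1 invr1. Qed.

Lemma eS n : e_ (nadd n 1%n) = e_ n / 2.
Proof.
rewrite /e_ pow2S iotaD; have := pow2_gt0 n; set x := ι _ => hx.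
have hx2 : 0 < x + x by lra.
by field; rewrite !gt_eqF.
Qed.

Lemma pow2D n i : mPow2 · (nadd n i) = nmul (mPow2 · n) (mPow2 · i).
Proof.
move: i; apply: nind_eq.
- by apply: dfn_app; apply: dfn_add; [exact: dfn_const|exact: dfn_id].
- by apply: dfn_mul; [exact: dfn_const|apply: dfn_app; exact: dfn_id].
- by rewrite nadd0 pow20 nmul1.
- by move=> i h; rewrite naddA !pow2S h nmulD.
Qed.

Lemma eD n i : e_ (nadd n i) = e_ n * e_ i.
Proof. by rewrite /e_ pow2D iotaM invfM mulrC. Qed.

Lemma e_le1 n : e_ n <= 1.
Proof. by rewrite /e_ invf_le1 ?pow2_gt0 //; have := pow2_ge n; have := iota_ge0 n; lra. Qed.

Lemma eD_le n i : e_ (nadd n i) <= e_ n.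
Proof. by rewrite eD; have := e_gt0 n; have := e_le1 i; nra. Qed.

Lemma iota_e n : ι n * e_ n <= 1.
Proof. by rewrite /e_ ler_pdivrMr ?pow2_gt0 //; have := pow2_ge n; lra. Qed.

Lemma iota_eD m n : ι m * e_ (nadd n m) <= e_ n.
Proof.
rewrite eD mulrCA -[leRHS]mulr1 ler_pM2l ?e_gt0 //; exact: iota_e.
Qed.

(** The field is Archimedean relative to the numbers of [M]: a positive (a - b)/d is at least 1/d,
    which exceeds 2^-d. *)
Lemma archi (x : K) : 0 < x -> exists n, e_ n < x.
Proof.
move=> hx; have [a [b [d [hd e]]]] := model_fieldE x.
have hab : ι b < ι a.
  by move: hx; rewrite e pmulr_lgt0 ?invr_gt0 // subr_gt0.
exists d; rewrite /e_ -div1r ltr_pdivrMr ?pow2_gt0 // e mulrAC ltr_pdivlMr // mul1r.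
have h1 := iota_S hab; have h2 := pow2_ge d.
have h3 : 1 <= ι a - ι b by lra.
have h4 : 0 <= (ι a - ι b - 1) * ι (mPow2 · d) by rewrite mulr_ge0 ?(ltW (pow2_gt0 d)) //; lra.
lra.
Qed.

Lemma val_exp n : val (mQexp · n) = e_ n.
Proof.
rewrite mQexpE val_mk ?pow2_gt0 //.
by rewrite !iE /e_ subr0 mul1r.
Qed.

Lemma val_exp1 n : val (mQexp1 · n) = 2 * e_ n.
Proof.
rewrite mQexp1E val_mk ?pow2_gt0 //.
by rewrite !iE /e_ subr0.
Qed.

Lemma val_Q0 : val mQ0 = 0.
Proof.
by rewrite -(eval_Q0 (enil M)) /Q0; cbn [eval]; fold_ops; rewrite !evQ val_mk !iE ?ltr01 // subrr mul0r.
Qed.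
Lemma val_Q1 : val mQ1 = 1.
Proof.
by rewrite -(eval_Q1 (enil M)) /Q1; cbn [eval]; fold_ops; rewrite !evQ val_mk !iE ?ltr01 // subr0 divr1.
Qed.

Lemma sem_Qlt G (r : env M G) (p q : term G tN) :
  sem (Qlt p q) r <-> val (eval r p) < val (eval r q).
Proof.
rewrite /Qlt; cbn [sem eval]; fold_ops; rewrite !evQ; set x := eval r p; set y := eval r q.
rewrite -[ltD _ _]/(nlt _ _) nltE !iE.
have hx := den_gt0 x; have hy := den_gt0 y.
have ex : ι (mQpos · x) - ι (mQneg · x) = val x * ι (mQden · x).
  by rewrite /val mulfVK // gt_eqF.
have ey : ι (mQpos · y) - ι (mQneg · y) = val y * ι (mQden · y).
  by rewrite /val mulfVK // gt_eqF.
have e1 : val x * (ι (mQden · x) * ι (mQden · y)) = (ι (mQpos · x) - ι (mQneg · x)) * ι (mQden · y).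
  by rewrite ex mulrA.
have e2 : val y * (ι (mQden · x) * ι (mQden · y)) = (ι (mQpos · y) - ι (mQneg · y)) * ι (mQden · x).
  by rewrite ey [ι (mQden · x) * _]mulrC mulrA.
rewrite -[val x < val y](ltr_pM2r (mulr_gt0 hx hy)) e1 e2; split=> ?; lra.
Qed.

Lemma sem_Qle G (r : env M G) (p q : term G tN) :
  sem (Qle p q) r <-> val (eval r p) <= val (eval r q).
Proof. by rewrite /Qle; cbn [sem]; rewrite sem_Qlt leNgt; split=> /negP. Qed.

Definition defq (h : N -> K) := exists f, dfn f /\ forall n, val (f n) = h n.

Lemma dfn_app3 (F : dom M (tN ⇒ tN ⇒ tN ⇒ tN)) f g h : dfn f -> dfn g -> dfn h ->
  dfn (fun n => F · f n · g n · h n).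
Proof.
move=> [f' hf] [g' hg] [h' hh].
exists (eval (enil M) (λ F : tN ⇒ tN ⇒ tN ⇒ tN, λ f : T1, λ g : T1, λ h : T1, λ n : tN,
   $F · ($f · $n) · ($g · $n) · ($h · $n))%L · F · f' · g' · h') => n.
by ev; rewrite hf hg hh.
Qed.

Lemma defq_val f : dfn f -> defq (fun n => val (f n)).
Proof. by exists f. Qed.

Lemma defq_add g h : defq g -> defq h -> defq (fun n => g n + h n).
Proof.
move=> [g' [dg eg]] [h' [dh eh]]; exists (fun n => mQadd · g' n · h' n); split; first exact: dfn_app2.
by move=> n; rewrite val_add eg eh.
Qed.

Lemma defq_opp g : defq g -> defq (fun n => - g n).
Proof.
move=> [g' [dg eg]]; exists (fun n => mQopp · g' n); split; first exact: dfn_app.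
by move=> n; rewrite val_opp eg.
Qed.

Lemma defq_const c : defq (fun _ => c).
Proof.
have [a [b [d [hd ->]]]] := model_fieldE c.
exists (fun _ => mQmk · a · b · d); split; first exact: dfn_const.
by move=> n; rewrite val_mk.
Qed.

Lemma defq_iota f : dfn f -> defq (fun n => ι (f n)).
Proof.
move=> hf; exists (fun n => mQmk · f n · 0%n · 1%n); split.
  by apply: dfn_app3; [exact: hf|exact: dfn_const..].
by move=> n; rewrite val_mk iE ?ltr01 // iE subr0 divr1.
Qed.

Lemma defq_e f : dfn f -> defq (fun n => e_ (f n)).
Proof.
move=> hf; exists (fun n => mQexp · f n); split; first exact: dfn_app.
by move=> n; rewrite val_exp.
Qed.

Lemma defq_mulc c g : defq g -> defq (fun n => c * g n).
Proof.
move=> [g' [dg eg]]; have [a [b [d [hd ec]]]] := model_fieldE c.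
exists (fun n => mQmk · nadd (nmul a (mQpos · g' n)) (nmul b (mQneg · g' n))
  · nadd (nmul a (mQneg · g' n)) (nmul b (mQpos · g' n)) · nmul d (mQden · g' n)).
have hp (F : dom M T1) a' : dfn (fun n => nmul a' (F · g' n)).
  by apply: dfn_mul; [exact: dfn_const|exact: dfn_app].
split; first by apply: dfn_app3; [apply: dfn_add|apply: dfn_add|]; exact: hp.
move=> n; have h2 := den_gt0 (g' n).
rewrite val_mk !iE ?mulr_gt0 // -eg ec /val.
by apply: mulf_frac; rewrite gt_eqF.
Qed.

Lemma decp_qle g h : defq g -> defq h -> decp (fun n => g n <= h n).
Proof.
move=> [f [df ef]] [f' [df' ef']].
have hm (F F' : dom M T1) u u' : dfn u -> dfn u' -> dfn (fun n => nmul (F · u n) (F' · u' n)).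
  by move=> hu hu'; apply: dfn_mul; exact: dfn_app.
apply: decp_eqv (decp_le
  (dfn_add (hm (mQpos) (mQden) _ _ df df') (hm (mQneg) (mQden) _ _ df' df))
  (dfn_add (hm (mQpos) (mQden) _ _ df' df) (hm (mQneg) (mQden) _ _ df df'))) => n.
have := sem_Qlt (econs (f' n) (econs (f n) (enil M))) (Var V0) (Var (VS V0)).
rewrite /Qlt; cbn [sem eval econs]; fold_ops; rewrite !evQ -[ltD _ _]/(nlt _ _) nltE !iE -!ef -!ef' => e.
rewrite !leNgt; split=> /negP hn; apply/negP => h'; apply: hn; first exact/e.
by move/e: h'.
Qed.

Definition sum_step {G : ctx} : term G (T1 ⇒ tN ⇒ tN ⇒ tN) :=
  (λ F : T1, λ i : tN, λ q : tN, Qadd · $q · ($F · $i))%L.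

(** The recursor of the model gives sense to sums with a nonstandard number of terms. *)
Definition sumq (F : dom M T1) (m : N) : K :=
  val (nrec (eval (enil M) sum_step · F) mQ0 m).

Lemma sumq0 F : sumq F 0%n = 0.
Proof. by rewrite /sumq nrec0 val_Q0. Qed.
Lemma sumqS F n : sumq F (nadd n 1%n) = sumq F n + val (F · n).
Proof. by rewrite /sumq nrecS /sum_step; ev; rewrite evQ val_add. Qed.
Lemma defq_sumq F : defq (sumq F).
Proof. by apply: defq_val; apply: dfn_app; exact: dfn_id. Qed.

End Codes.

(** * Reals *)

Section Clipping.
Variable F : realFieldType.

Definition clip (lo hi v : F) := if v <= lo then lo else if v <= hi then v else hi.

Lemma clip_mono lo hi v w : lo <= hi -> v <= w -> clip lo hi v <= clip lo hi w.
Proof. by rewrite /clip => *; do ?case: ifPn; rewrite -?ltNge => *; lra. Qed.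

Lemma clip_bound lo hi v : lo <= hi -> lo <= clip lo hi v <= hi.
Proof. by rewrite /clip => *; do ?case: ifPn; rewrite -?ltNge => *; lra. Qed.

Lemma clip_shift lo hi v d : lo <= hi -> 0 <= d -> clip lo hi (v + d) <= clip lo hi v + d.
Proof. by rewrite /clip => *; do ?case: ifPn; rewrite -?ltNge => *; lra. Qed.

Lemma clip_ge lo hi v : lo <= hi -> v <= hi -> v <= clip lo hi v.
Proof. by rewrite /clip => *; do ?case: ifPn; rewrite -?ltNge => *; lra. Qed.

Lemma clip_le lo hi v : lo <= hi -> lo <= v -> clip lo hi v <= v.
Proof. by rewrite /clip => *; do ?case: ifPn; rewrite -?ltNge => *; lra. Qed.

Lemma clip_lip lo hi v w : lo <= hi -> `|clip lo hi v - clip lo hi w| <= `|v - w|.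
Proof.
move=> h; wlog hvw : v w / v <= w.
  by move=> hw; case: (leP v w) => [/hw //|/ltW/hw]; rewrite distrC (distrC w).
have := clip_mono h hvw; have : clip lo hi (v + (w - v)) <= clip lo hi v + (w - v).
  by apply: clip_shift => //; lra.
have -> : v + (w - v) = w by lra.
by move=> h1 h2; rewrite !ler0_norm; lra.
Qed.
End Clipping.

Section Reals.
Variable M : model.
Local Notation N := (dom M tN).
Local Notation R := (dom M T1).
Local Notation K := (model_field M).
Local Infix "·" := app (at level 20, left associativity).
Local Infix "+n" := nadd (at level 50, left associativity).
Local Notation "0%n" := (n0 M).
Local Notation "1%n" := (n1 M).
Local Notation ι := (@iota_ M).

Definition xv (x : R) (n : N) : K := val (x · n).
Definition isReal (x : R) := forall n i, `|xv x n - xv x (n +n i)| < e_ n.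
Definition eqR (x y : R) := forall n, `|xv x n - xv y n| <= 2 * e_ n.
Definition ltR (x y : R) := exists n, xv x n + 2 * e_ n < xv y n.
Definition leR (x y : R) := forall n, xv x n <= xv y n + 2 * e_ n.

Lemma xv_RofQ q n : xv (mRofQ M · q) n = val q.
Proof. by rewrite /xv -(eval_RofQ (enil M)) /RofQ; ev. Qed.
Lemma xv_R0 n : xv (mR0 M) n = 0.
Proof. by rewrite -(eval_R0 (enil M)) /R0; cbn [eval]; rewrite !evQ xv_RofQ val_Q0. Qed.
Lemma xv_R1 n : xv (mR1 M) n = 1.
Proof. by rewrite -(eval_R1 (enil M)) /R1; cbn [eval]; rewrite !evQ xv_RofQ val_Q1. Qed.
Lemma xv_add x y n : xv (mRadd M · x · y) n = xv x (n +n 1%n) + xv y (n +n 1%n).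
Proof. by rewrite /xv -(eval_Radd (enil M)) /Radd; ev; rewrite !evQ val_add. Qed.
Lemma xv_opp x n : xv (mRopp M · x) n = - xv x n.
Proof. by rewrite /xv -(eval_Ropp (enil M)) /Ropp; ev; rewrite !evQ val_opp. Qed.
Lemma xv_sub x y n : xv (mRsub M · x · y) n = xv x (n +n 1%n) - xv y (n +n 1%n).
Proof. by rewrite -(eval_Rsub (enil M)) /Rsub; ev; rewrite !evQ xv_add xv_opp. Qed.
Lemma xv_abs x n : xv (mRabs M · x) n = `|xv x n|.
Proof. by rewrite /xv -(eval_Rabs (enil M)) /Rabs; ev; rewrite !evQ val_abs. Qed.

Definition terms_at {G : ctx} : term G ((tN ⇒ T1) ⇒ tN ⇒ T1) :=
  (λ s : tN ⇒ T1, λ k : tN, λ i : tN, $s · $i · $k)%L.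
Definition mterms_at s k := eval (enil M) terms_at · s · k.
Lemma mterms_atE s k i : mterms_at s k · i = s · i · k.
Proof. by rewrite /mterms_at /terms_at; ev. Qed.

(** The step functions of [Rsum] and [sum_step] come from different combinator terms but have equal
    values, so extensionality identifies them under the recursor. *)
Lemma xv_sum s m n : xv (mRsum M · s · m) n = sumq (mterms_at s (n +n m)) m.
Proof.
rewrite /xv -(eval_Rsum (enil M)) /Rsum; ev; rewrite !evQ /sumq /nrec.
match goal with |- val (app (app (app _ ?g) _) _) = _ =>
  have -> : g = eval (enil M) sum_step · mterms_at s (n +n m) end.
  apply: m_ext => i; apply: m_ext => q; rewrite /sum_step; ev.
  by rewrite !evQ mterms_atE.
by [].
Qed.

Lemma sem_isR G (r : env M G) (x : term G T1) : sem (isR x) r <-> isReal (eval r x).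
Proof.
rewrite /isR /bind_all; cbn [sem]; split=> hr n i; move: (hr n i); rewrite sem_Qlt; ev;
  by rewrite !evQ val_abs val_sub val_exp.
Qed.

Lemma sem_Req G (r : env M G) (x y : term G T1) : sem (Req x y) r <-> eqR (eval r x) (eval r y).
Proof.
rewrite /Req /bind_all; cbn [sem]; split=> hr n; move: (hr n); rewrite sem_Qle; ev;
  by rewrite !evQ val_abs val_sub val_exp1.
Qed.

Lemma sem_Rlt G (r : env M G) (x y : term G T1) : sem (Rlt x y) r <-> ltR (eval r x) (eval r y).
Proof.
rewrite /Rlt /bind_ex; cbn [sem]; split=> -[n hr]; exists n; move: hr; rewrite sem_Qlt; ev;
  by rewrite !evQ val_add val_exp1.
Qed.

Lemma leRE x y : leR x y <-> ~ ltR y x.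
Proof.
split=> [h [n hn]|h n]; first by have := h n; lra.
by rewrite leNgt; apply/negP => hn; apply: h; exists n.
Qed.

Lemma sem_Rle G (r : env M G) (x y : term G T1) : sem (Rle x y) r <-> leR (eval r x) (eval r y).
Proof. by rewrite /Rle; cbn [sem]; rewrite sem_Rlt leRE. Qed.

Definition unitR x := isReal x /\ leR (mR0 M) x /\ leR x (mR1 M).

Lemma sem_in01 G (r : env M G) (x : term G T1) : sem (in01 x) r <-> unitR (eval r x).
Proof. by rewrite /in01; cbn [sem]; rewrite sem_isR !sem_Rle !evQ. Qed.

Definition nearR x y n := exists k, `|xv x (k +n 1%n) - xv y (k +n 1%n)| + 2 * e_ k < e_ n.

Lemma sem_Rnear G (r : env M G) (x y : term G T1) (n : term G tN) :
  sem (Rnear x y n) r <-> nearR (eval r x) (eval r y) (eval r n).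
Proof.
rewrite /Rnear sem_Rlt; cbn [eval]; rewrite !evQ.
by split=> -[k hk]; exists k; move: hk; rewrite xv_abs xv_sub xv_RofQ val_exp.
Qed.

Lemma le_arch (a b c : K) : 0 < c -> (forall m, a <= b + c * e_ m) -> a <= b.
Proof.
move=> hc h; rewrite leNgt; apply/negP => hab.
have hd : 0 < (a - b) / c by rewrite divr_gt0 // subr_gt0.
have [m] := archi hd; rewrite ltr_pdivlMr // mulrC; have := h m; lra.
Qed.

Lemma real_dist x n m : isReal x -> `|xv x n - xv x m| <= e_ n + e_ m.
Proof.
move=> hx; have hn := e_gt0 n; have hm := e_gt0 m.
have [i [] e] := nsub_ex n m.
  by have := hx m i; rewrite -e distrC; lra.
by have := hx n i; rewrite -e; lra.
Qed.

Lemma eqR_sym x y : eqR x y -> eqR y x.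
Proof. by move=> h n; rewrite distrC. Qed.

Lemma ler_dist_triangle (a b c : K) d d' : `|a - b| <= d -> `|b - c| <= d' -> `|a - c| <= d + d'.
Proof. by rewrite !ler_distl => /andP [h1 h2] /andP [h3 h4]; apply/andP; split; lra. Qed.

Lemma eqR_trans x y z : isReal x -> isReal z -> eqR x y -> eqR y z -> eqR x z.
Proof.
(* Adding the two bounds at n itself would give 4 e_n. A detour through an arbitrary index m gives 2
   e_n + 6 e_m instead, and e_m is arbitrarily small. *)
move=> hx hz hxy hyz n; apply: (@le_arch _ _ 6) => // m.
have h1 := ler_dist_triangle (real_dist n m hx) (hxy m).
have h2 := ler_dist_triangle h1 (hyz m).
have h3 := ler_dist_triangle h2 (real_dist m n hz).
by lra.
Qed.

Lemma isReal_RofQ q : isReal (mRofQ M · q).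
Proof. by move=> n i; rewrite !xv_RofQ subrr normr0 e_gt0. Qed.

Lemma neqR_apart x y : ~ eqR x y -> exists n, 2 * e_ n < `|xv x n - xv y n|.
Proof. by move/existsNP => [n /negP]; rewrite -ltNge; exists n. Qed.

Lemma small_e (x : K) : 0 < x -> exists n, 2 * e_ n < x.
Proof. by move=> hx; have [|n hn] := @archi M (x / 2); [lra|exists n; lra]. Qed.

End Reals.

(** * From BCT to NIN *)

Section Baire.
Variable M : model.
Local Notation N := (dom M tN).
Local Notation R := (dom M T1).
Local Notation K := (model_field M).
Local Infix "·" := app (at level 20, left associativity).
Local Infix "+n" := nadd (at level 50, left associativity).
Local Notation "0%n" := (n0 M).
Local Notation "1%n" := (n1 M).
Local Notation ι := (@iota_ M).

Definition respects_eqR (Y : dom M (T1 ⇒ tN)) :=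
  forall x y, unitR x -> unitR y -> eqR x y -> Y · x = Y · y.

Definition injectiveR (Y : dom M (T1 ⇒ tN)) :=
  forall x y, unitR x -> unitR y -> Y · x = Y · y -> eqR x y.

Lemma sem_NIN : (forall Y, respects_eqR Y -> ~ injectiveR Y) -> sem NIN (enil M).
Proof.
move=> h; rewrite /NIN /bind_all /bind_ex; cbn [sem] => Y hY.
have hY' : respects_eqR Y.
  by move=> x y hx hy hxy; have := hY x y; rewrite !sem_in01 sem_Req; ev; apply.
apply: contrapT => hn; apply: (h Y hY') => x y hx hy e.
apply: contrapT => hxy; apply: hn; exists x, y.
by rewrite !sem_in01 sem_Req; ev.
Qed.

Lemma sem_is_open G (r : env M G) (O : term G (T1 ⇒ T1)) :
  (forall x, unitR x -> isReal (eval r O · x)) ->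
  (forall x y, unitR x -> unitR y -> eqR x y -> eqR (eval r O · x) (eval r O · y)) ->
  (forall x, unitR x -> ltR (mR0 M) (eval r O · x) ->
    exists n, forall y, unitR y -> nearR x y n -> ltR (mR0 M) (eval r O · y)) ->
  sem (is_open O) r.
Proof.
move=> h1 h2 h3; rewrite /is_open /fun_01_R /in_open /bind_all /bind_ex; cbn [sem].
split; first split.
- by move=> x; rewrite sem_in01 sem_isR; ev; apply: h1.
- by move=> x y; rewrite !sem_in01 !sem_Req; ev; apply: h2.
- move=> x; rewrite sem_in01 sem_Rlt; ev; rewrite evQ => hx hlt.
  have [n hn] := h3 x hx hlt; exists n => y.
  by rewrite sem_in01 sem_Rnear sem_Rlt; ev; rewrite evQ; apply: hn.
Qed.

Lemma sem_is_dense G (r : env M G) (O : term G (T1 ⇒ T1)) :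
  (forall x n, unitR x -> exists y, [/\ unitR y, nearR x y n & ltR (mR0 M) (eval r O · y)]) ->
  sem (is_dense O) r.
Proof.
move=> h; rewrite /is_dense /in_open /bind_all /bind_ex; cbn [sem] => x n.
rewrite sem_in01; ev => hx; have [y [hy h1 h2]] := h x n hx; exists y.
by rewrite sem_in01 sem_Rnear sem_Rlt; ev; rewrite evQ.
Qed.

(** The real |Y x - n|: 0 where Y x = n and, being an integer, at least 1 elsewhere. *)
Definition avoid {G : ctx} : term G ((T1 ⇒ tN) ⇒ tN ⇒ T1 ⇒ T1) :=
  (λ Y : T1 ⇒ tN, λ n : tN, λ x : T1,
    RofQ · (Qmk · (($Y · $x ∸ $n) + ($n ∸ $Y · $x)) · 0 · 1))%L.

Lemma avoid_pos Y n x : ltR (mR0 M) (eval (enil M) avoid · Y · n · x) <-> Y · x <> n.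
Proof.
have e k : xv (eval (enil M) avoid · Y · n · x) k =
    ι (mMonus M · (Y · x) · n) + ι (mMonus M · n · (Y · x)).
  by rewrite /avoid; ev; rewrite !evQ xv_RofQ val_mk !iE ?ltr01 // subr0 divr1.
split.
  move=> [k]; rewrite xv_R0 e => + h; rewrite h; have := e_gt0 k.
  by case: (iota_monus n n) => -[_ ->]; lra.
move=> h; have [k hk] := @small_e M 1 ltr01; exists k; rewrite xv_R0 e add0r.
apply: lt_le_trans hk _.
have lt1 a b : ι a < ι b -> 1 <= ι b - ι a by move=> /iota_S; lra.
case: (ltgtP (ι (Y · x)) (ι n)) => [hl|hl|/iota_inj //].
  by have := lt1 _ _ hl; case: (iota_monus (Y · x) n) (iota_monus n (Y · x)) => -[h1 ->] [] [h2 ->]; lra.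
by have := lt1 _ _ hl; case: (iota_monus (Y · x) n) (iota_monus n (Y · x)) => -[h1 ->] [] [h2 ->]; lra.
Qed.

Lemma avoid_real Y n x : isReal (eval (enil M) avoid · Y · n · x).
Proof. by rewrite /avoid; ev; rewrite !evQ; apply: isReal_RofQ. Qed.

Lemma avoid_eq Y n x y : Y · x = Y · y ->
  eqR (eval (enil M) avoid · Y · n · x) (eval (enil M) avoid · Y · n · y).
Proof.
move=> e; rewrite /avoid; ev; rewrite e => k.
by rewrite subrr normr0 mulr_ge0 // ltW // e_gt0.
Qed.

Lemma unitR_RofQ q : 0 <= val q <= 1 -> unitR (mRofQ M · q).
Proof.
move=> /andP [h0 h1]; split; first exact: isReal_RofQ.
by split=> n; rewrite ?xv_R0 ?xv_R1 xv_RofQ; have := e_gt0 n; lra.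
Qed.

Lemma val_surj (c : K) : exists q, val q = c.
Proof. by have [f [_ h]] := defq_const c; exists (f 0%n); apply: h. Qed.

(** Density of the complement of a point without locating the point: of two distinct nearby reals at
    least one is left. *)
Lemma near_pair (x : R) n : unitR x -> exists y z : R, [/\ unitR y, unitR z, ~ eqR y z,
  nearR x y n & nearR x z n].
Proof.
move=> [hx [hx0 hx1]].
(* The two points are the rationals c0 and c0 + 2 e_m, at most 6 e_m away from the approximation of
   x at m. The remaining errors raise this to 8.25 e_m, which four extra binary places
   accommodate. *)
pose m := n +n 1%n +n 1%n +n 1%n +n 1%n.
have em : e_ n = 16 * e_ m by rewrite /m !eS; field.
have hm := e_gt0 m; have hm1 := e_le1 n.
have h0 := hx0 m; have h1 := hx1 m; rewrite ?xv_R0 ?xv_R1 in h0 h1.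
pose c0 := clip 0 (1 - 2 * e_ m) (xv x m).
have hc : 0 <= 1 - 2 * e_ m by lra.
have /andP [hb0 hb1] : 0 <= c0 <= 1 - 2 * e_ m by exact: clip_bound.
have hc0 : `|xv x m - c0| <= 4 * e_ m.
  rewrite ler_distl; rewrite /c0 /clip; do ?case: ifPn; rewrite -?ltNge => *; apply/andP; split; lra.
have [q hq] := val_surj c0; have [q' hq'] := val_surj (c0 + 2 * e_ m).
have near c (t : N) : val t = c -> `|xv x m - c| <= 6 * e_ m -> nearR x (mRofQ M · t) n.
  move=> ht hd; exists (m +n 1%n); rewrite xv_RofQ ht.
  have h2 := ler_dist_triangle (real_dist (m +n 1%n +n 1%n) m hx) hd.
  by move: h2; rewrite !eS; lra.
exists (mRofQ M · q), (mRofQ M · q'); split.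
- by apply: unitR_RofQ; rewrite hq; lra.
- by apply: unitR_RofQ; rewrite hq'; lra.
- move=> /(_ (m +n 1%n)); rewrite !xv_RofQ hq hq' eS distrC addrAC subrr add0r gtr0_norm; lra.
- by apply: near hq _; lra.
- apply: near hq' _; move: hc0; rewrite !ler_distl => /andP [? ?]; apply/andP; split; lra.
Qed.

Lemma BCT_NIN : sem BCT (enil M) -> sem NIN (enil M).
Proof.
move=> hB; apply: sem_NIN => Y hY hinj.
rewrite /BCT /bind_all /bind_ex in hB; cbn [sem] in hB.
have [|x] := hB (eval (enil M) avoid · Y); last first.
  rewrite sem_in01; ev => -[hx h].
  have := h (Y · x); rewrite /in_open sem_Rlt; ev; rewrite evQ => /avoid_pos; exact.
move=> n; split.
- apply: sem_is_open; ev.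
  + by move=> x _; apply: avoid_real.
  + by move=> x y hx hy hxy; apply: avoid_eq; apply: hY.
  + move=> x hx /avoid_pos hn.
    case: (pselect (exists2 x0, unitR x0 & Y · x0 = n)) => [[x0 hx0 e0]|hno]; last first.
      by exists 0%n => y hy _; apply/avoid_pos => e; apply: hno; exists y.
    have [k hk] := neqR_apart (fun h : eqR x x0 => hn (etrans (hY _ _ hx hx0 h) e0)).
    (* By injectivity every point with value n equals x0, so a radius below the gap between x and x0
       excludes that value. *)
    have [p hp] : exists p, 4 * e_ p < `|xv x k - xv x0 k| - 2 * e_ k.
      have [|p hp] := @archi M ((`|xv x k - xv x0 k| - 2 * e_ k) / 4); first by lra.
      by exists p; lra.
    exists (p +n 1%n) => y hy [j hj]; apply/avoid_pos => e.
    have hyx : eqR y x0 by apply: hinj => //; rewrite e e0.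
    have hd : `|xv x (j +n 1%n) - xv y (j +n 1%n)| <= e_ p / 2 - 2 * e_ j.
      by move: hj; rewrite eS; lra.
    have h1 := ler_dist_triangle (real_dist k (j +n 1%n) (proj1 hx)) hd.
    have h2 := ler_dist_triangle h1 (hyx _).
    have h3 := ler_dist_triangle h2 (real_dist (j +n 1%n) k (proj1 hx0)).
    by move: h3 hp; rewrite !eS; have := e_gt0 j; have := e_gt0 p; lra.
- apply: sem_is_dense; ev => x k hx.
  have [y [z [hy hz hyz n1 n2]]] := near_pair k hx.
  case: (pselect (Y · y = n)) => h.
    exists z; split => //; apply/avoid_pos => h'.
    by apply: hyz; apply: hinj => //; rewrite h h'.
  by exists y; split => //; apply/avoid_pos.
Qed.

End Baire.

(** * Sums *)

Section Sums.
Variable M : model.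
Local Notation N := (dom M tN).
Local Notation R := (dom M T1).
Local Notation K := (model_field M).
Local Infix "·" := app (at level 20, left associativity).
Local Infix "+n" := nadd (at level 50, left associativity).
Local Notation "0%n" := (n0 M).
Local Notation "1%n" := (n1 M).
Local Notation ι := (@iota_ M).

Lemma iota_le_S (i k : N) : ι i < ι k <-> ι (i +n 1%n) <= ι k.
Proof. by split=> [/iota_S|]; rewrite !iE //; lra. Qed.

Lemma iota_ltS (i k : N) : ι i < ι (k +n 1%n) -> ι i < ι k \/ i = k.
Proof.
move=> h; case: (ltgtP (ι i) (ι k)) => [|/iota_S|/iota_inj]; [by left| |by right].
by move=> h2; exfalso; move: h h2; rewrite !iE; lra.
Qed.

Lemma dfn_succ : dfn (fun n : N => n +n 1%n).
Proof. by apply: dfn_add; [exact: dfn_id|exact: dfn_const]. Qed.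

Lemma decp_lt (m : N) : decp (fun n => ι n < ι m).
Proof.
apply: decp_eqv (decp_le dfn_succ (dfn_const m)) => n.
by rewrite iota_le_S.
Qed.

(** The factor a rescales the sum; the constant b per term absorbs the errors of rational
    approximation. *)
Lemma sumq_le_lin (F G : R) (a b : K) m :
  (forall i, ι i < ι m -> val (F · i) <= a * val (G · i) + b) ->
  sumq F m <= a * sumq G m + b * ι m.
Proof.
move=> h.
have hd : decp (fun n => ι n <= ι m -> sumq F n <= a * sumq G n + b * ι n).
  apply: decp_imp; first by apply: decp_le; [exact: dfn_id|exact: dfn_const].
  apply: decp_qle; first exact: defq_sumq.
  by apply: defq_add; apply: defq_mulc; [exact: defq_sumq|apply: defq_iota; exact: dfn_id].
apply: (dec_ind hd) => [_|n IH hn|//]; first by rewrite !sumq0 iota0 !mulr0 addr0.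
have hn' : ι n < ι m by rewrite iota_le_S.
by have := IH (ltW hn'); have := h n hn'; rewrite !sumqS !iE; lra.
Qed.

Lemma sumq_ge0 (F : R) m : (forall i, 0 <= val (F · i)) -> 0 <= sumq F m.
Proof.
move=> h; have hd : decp (fun n => 0 <= sumq F n).
  by apply: decp_qle; [exact: defq_const|exact: defq_sumq].
move: m; apply: (dec_ind hd) => [|n IH]; first by rewrite sumq0.
by rewrite sumqS; have := h n; lra.
Qed.

Definition sum_param {G : ctx} : term G ((tN ⇒ T1) ⇒ tN ⇒ T1) :=
  (λ g : tN ⇒ T1, λ k : tN, λ n : tN, rec (sum_step · ($g · $n)) Q0 $k)%L.

(** Here the summands, not the number of terms, vary with the argument; the induction on the
    truncation level needs this form. *)
Lemma defq_sum_param (g : dom M (tN ⇒ T1)) k : defq (fun n => sumq (g · n) k).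
Proof.
exists (fun n => eval (enil M) sum_param · g · k · n); split.
  by apply: dfn_app; exact: dfn_id.
move=> n; rewrite /sum_param; ev; rewrite evQ /sumq /nrec.
match goal with |- val (app (app (app _ ?u) _) _) = _ =>
  have -> : u = eval (enil M) sum_step · (g · n) end.
  by apply: m_ext => i; apply: m_ext => q; rewrite /sum_step; ev; rewrite !evQ.
by [].
Qed.

Lemma archi_nat (x : K) : exists n, x <= ι n.
Proof.
have [a [b [d [hd ->]]]] := model_fieldE x; exists a; rewrite ler_pdivrMr //.
have := iota_ge1 hd; have := iota_ge0 a; have := iota_ge0 b => h1 h2 h3.
have := mulr_ge0 h2 (_ : 0 <= ι d - 1); rewrite subr_ge0 => /(_ h3); lra.
Qed.

(** * Sums of distinct negative powers of two *)

Definition powers {G : ctx} : term G (T1 ⇒ T1) := (λ Z : T1, λ i : tN, Qexp · ($Z · $i))%L.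
(** The numerator 1 ∸ ((Z i + 1) ∸ n) is the indicator of Z i < n. *)
Definition truncated {G : ctx} : term G (T1 ⇒ tN ⇒ T1) :=
  (λ Z : T1, λ n : tN, λ i : tN,
    Qmk · (1 ∸ (($Z · $i + 1) ∸ $n)) · 0 · (Pow2 · ($Z · $i)))%L.
Definition successors {G : ctx} : term G (T1 ⇒ T1) :=
  (λ Z : T1, λ i : tN, Qmk · ($Z · $i + 1) · 0 · 1)%L.

Lemma val_powers (Z : R) i : val (eval (enil M) powers · Z · i) = e_ (Z · i).
Proof. by rewrite /powers; ev; rewrite !evQ val_exp. Qed.

Lemma val_truncated (Z : R) n i : val (eval (enil M) truncated · Z · n · i) =
  if ι (Z · i) < ι n then e_ (Z · i) else 0.
Proof.
rewrite /truncated; ev; rewrite !evQ val_mk ?pow2_gt0 // !iE subr0 /e_.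
case: ifPn => h; last rewrite -leNgt in h.
  rewrite (_ : ι _ = 1) ?mul1r //; have := iota_S h.
  case: (iota_monus (Z · i +n 1%n) n) => -[h1 h2] h3; rewrite !iE in h1 h2;
    case: (iota_monus 1%n (mMonus M · (Z · i +n 1%n) · n)) => -[h4 ->]; rewrite !iE in h4 *; lra.
rewrite (_ : ι _ = 0) ?mul0r //.
case: (iota_monus (Z · i +n 1%n) n) => -[h1 h2]; rewrite !iE in h1 h2;
  case: (iota_monus 1%n (mMonus M · (Z · i +n 1%n) · n)) => -[h4 ->]; rewrite !iE in h4 *; lra.
Qed.

Lemma val_successors (Z : R) i : val (eval (enil M) successors · Z · i) = ι (Z · i) + 1.
Proof. by rewrite /successors; ev; rewrite !evQ val_mk !iE ?ltr01 // subr0 divr1. Qed.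

(** As k may be nonstandard, no maximum can be taken from outside; the sum of all Z i + 1, computed
    in the model, bounds every single value. *)
Lemma values_bounded (Z : R) k : exists n, forall i, ι i < ι k -> ι (Z · i) < ι n.
Proof.
have [n hn] := archi_nat (sumq (eval (enil M) successors · Z) k).
have hg m : 0 <= sumq (eval (enil M) successors · Z) m.
  by apply: sumq_ge0 => i; rewrite val_successors; have := iota_ge0 (Z · i); lra.
exists n => i hi.
have hd : decp (fun m => ι i < ι m -> ι (Z · i) + 1 <= sumq (eval (enil M) successors · Z) m).
  apply: decp_imp; last by apply: decp_qle; [exact: defq_const|exact: defq_sumq].
  apply: decp_eqv (decp_le (dfn_const (i +n 1%n)) (dfn_id M)) => m.
  by rewrite iota_le_S.
suff H : forall m, ι i < ι m -> ι (Z · i) + 1 <= sumq (eval (enil M) successors · Z) m.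
  by have := H k hi; lra.
apply: (dec_ind hd) => [|m IH /iota_ltS [/IH|->]].
- by rewrite iota0; have := iota_ge0 i; lra.
- by rewrite sumqS val_successors; have := iota_ge0 (Z · m); lra.
- by rewrite sumqS val_successors; have := hg m; lra.
Qed.

(* The sum [T n] restricted to the terms with [Z i < n] grows by at most 2^-n when
   [n] is increased, for at most one [i] has [Z i = n]. *)
Lemma sum_distinct_powers (Z : R) k :
  (forall i j, ι i < ι k -> ι j < ι k -> Z · i = Z · j -> i = j) ->
  sumq (eval (enil M) powers · Z) k <= 2.
Proof.
move=> hinj; pose T n := eval (enil M) truncated · Z · n.
have [nmax hn0] := values_bounded Z k.
have hT n : sumq (T (n +n 1%n)) k <= sumq (T n) k + e_ n.
  have hlt i : ι (Z · i) < ι (n +n 1%n) -> Z · i <> n -> ι (Z · i) < ι n.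
    by move=> /iota_ltS [].
  have hsame i : Z · i <> n -> val (T (n +n 1%n) · i) = val (T n · i).
    move=> hi; rewrite !val_truncated; case: ifPn => h; case: ifPn => h' //.
      by move: (hlt _ h hi); rewrite (negbTE h').
    by move: h; rewrite !iE (lt_trans h') //; lra.
  case: (pselect (exists i, ι i < ι k /\ Z · i = n)) => [[i0 [hi0 e0]]|hno]; last first.
    have := @sumq_le_lin (T (n +n 1%n)) (T n) 1 0 k.
    rewrite mul1r mul0r addr0 => h; apply: le_trans (h _) _; last by have := e_gt0 n; lra.
    by move=> i hi; rewrite hsame ?mul1r ?addr0 // => e; apply: hno; exists i.
  (* Both bounds are carried along: without error up to i0, the index with value n, and with the
     error e_n spent at i0 from there on. *)
  have hd : decp (fun i => ι i <= ι k ->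
     (ι i <= ι i0 -> sumq (T (n +n 1%n)) i <= sumq (T n) i) /\
     sumq (T (n +n 1%n)) i <= sumq (T n) i + e_ n).
    have hle j : decp (fun i => ι i <= ι j) by apply: decp_le; [exact: dfn_id|exact: dfn_const].
    apply: decp_imp => //; apply: decp_and; first apply: decp_imp => //.
      by apply: decp_qle; exact: defq_sumq.
    apply: decp_qle; first exact: defq_sumq.
    by apply: defq_add; [exact: defq_sumq|exact: defq_const].
  suff : forall i, ι i <= ι k ->
     (ι i <= ι i0 -> sumq (T (n +n 1%n)) i <= sumq (T n) i) /\
     sumq (T (n +n 1%n)) i <= sumq (T n) i + e_ n by case/(_ k (lexx _)).
  apply: (dec_ind hd) => [_|i IH hi].
    by rewrite !sumq0; have := e_gt0 n; split; lra.
  have hi' : ι i < ι k by rewrite iota_le_S.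
  have [h1 h2] := IH (ltW hi').
  rewrite !sumqS; case: (pselect (i = i0)) => [e|hne].
    split; first by rewrite e !iE; lra.
    have h3 : sumq (T (n +n 1%n)) i <= sumq (T n) i by apply: h1; rewrite e.
    have := e_gt0 n; rewrite e !val_truncated e0 ltxx !iE; case: ifPn => _; rewrite -e; lra.
  have hne' : Z · i <> n by move=> e; apply: hne; apply: hinj => //; rewrite e e0.
  rewrite hsame //; split; last by lra.
  move=> h3; have : sumq (T (n +n 1%n)) i <= sumq (T n) i.
    by apply: h1; move: h3; rewrite !iE; lra.
  by lra.
(* The bound 2 - 2 e_n is the geometric sum of e_j over j < n. *)
have hB : forall n, sumq (T n) k <= 2 - 2 * e_ n.
  have hd : decp (fun n => sumq (T n) k <= 2 - 2 * e_ n).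
    apply: decp_qle; first exact: defq_sum_param.
    apply: defq_add; first exact: defq_const.
    by apply: defq_opp; apply: defq_mulc; apply: defq_e; exact: dfn_id.
  apply: (dec_ind hd) => [|n IH]; last by have := hT n; rewrite eS; lra.
  rewrite e0; have := @sumq_le_lin (T (n0 M)) (T (n0 M)) 0 0 k.
  rewrite !mul0r addr0 => h; apply: le_trans (h _) _; last by lra.
  move=> i _; rewrite val_truncated iota0 ltNge iota_ge0 /=; lra.
have := @sumq_le_lin (eval (enil M) powers · Z) (T nmax) 1 0 k.
rewrite mul1r mul0r addr0 => h; apply: le_trans (h _) _.
  by move=> i hi; rewrite val_powers val_truncated hn0 // mul1r addr0.
by have := hB nmax; have := e_gt0 nmax; lra.
Qed.

Lemma decp_le_clip (lo hi : K) A S T : defq A -> defq S -> defq T ->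
  decp (fun n => S n <= clip lo hi (A n) + T n).
Proof.
move=> hA hS hT.
have h1 c : decp (fun n => S n <= c + T n).
  by apply: decp_qle => //; apply: defq_add => //; exact: defq_const.
have h2 c : decp (fun n => A n <= c) by apply: decp_qle => //; exact: defq_const.
have h3 : decp (fun n => S n <= A n + T n) by apply: decp_qle => //; apply: defq_add.
apply: decp_eqv (decp_and (decp_imp (h2 lo) (h1 lo)) (decp_imp (decp_not (h2 lo))
  (decp_and (decp_imp (h2 hi) h3) (decp_imp (decp_not (h2 hi)) (h1 hi))))) => n.
have tt := isT; have ff : ~ is_true false by [].
by rewrite /clip; case: (A n <= lo); case: (A n <= hi); intuition.
Qed.

(* Clipping to the interval from [lo] to [hi] does not change the length of a
   nondegenerate interval and bounds the telescoping sum; degenerate intervals may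
   lie anywhere.  The errors [c] come from rational approximations. *)
Lemma telescope (A B : N -> K) (F : R) m (lo hi c : K) : defq A ->
  lo <= hi -> 0 <= c -> (forall j, val (F · j) = B j - A j) ->
  (forall j, ι j < ι m -> A j <= B j + 2 * c) ->
  (forall j, ι (j +n 1%n) < ι m -> B j <= A (j +n 1%n) + 2 * c) ->
  (forall j, ι j < ι m -> B j <= A j + 2 * c \/ lo <= A j /\ B j <= hi) ->
  sumq F m <= hi - lo + 6 * c * ι m.
Proof.
move=> hA hlh hc hF hAB hBA hcase.
(* A nondegenerate interval costs nothing. A degenerate one costs 2c for its length and 2c because
   its approximate ends may be in the wrong order. The passage to the next interval costs another
   2c, whence the 6 in the bound. *)
have hincr j : ι j < ι m -> B j - A j <= clip lo hi (B j) - clip lo hi (A j) + 4 * c.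
  move=> hj; case: (hcase j hj) => [h|[h1 h2]].
    have := clip_mono hlh (hAB j hj); have := @clip_shift _ lo hi (B j) (2 * c) hlh.
    by move=> /(_ ltac:(lra)); lra.
  by have := clip_ge hlh h2; have := clip_le hlh h1; lra.
have hP : forall n, ι n < ι m -> sumq F n <= clip lo hi (A n) + (6 * c * ι n - lo).
  have hd : decp (fun n => ι n < ι m -> sumq F n <= clip lo hi (A n) + (6 * c * ι n - lo)).
    apply: decp_imp (decp_lt m) _; apply: decp_le_clip => //; first exact: defq_sumq.
    by apply: defq_add; [apply: defq_mulc; apply: defq_iota; exact: dfn_id|exact: defq_const].
  apply: (dec_ind hd) => [_|n IH hn].
    by rewrite sumq0 iota0 mulr0; have /andP [] := clip_bound (A (n0 M)) hlh; lra.
  have hn' : ι n < ι m by move: hn; rewrite !iE; lra.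
  have := IH hn'; have := hincr n hn'; rewrite sumqS hF !iE.
  have := clip_mono hlh (hBA n hn); have := @clip_shift _ lo hi (A (n +n 1%n)) (2 * c) hlh.
  by move=> /(_ ltac:(lra)); lra.
case: (pselect (m = n0 M)) => [->|hm].
  by rewrite sumq0 iota0 mulr0; lra.
(* [hP] stops at the left end of the last interval, for no hypothesis constrains A at m; the last
   interval is added separately. *)
move: (npredK hm); move: (mPred M · m) => m' em; subst m.
have hm' : ι m' < ι (m' +n 1%n) by rewrite !iE; lra.
have := hP m' hm'; have := hincr m' hm'; rewrite sumqS hF !iE.
have /andP [] := clip_bound (B m') hlh; lra.
Qed.

End Sums.

(** * From WHBU to NIN *)

Section Vitali.
Variable M : model.
Local Notation N := (dom M tN).
Local Notation R := (dom M T1).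
Local Notation K := (model_field M).
Local Infix "·" := app (at level 20, left associativity).
Local Infix "+n" := nadd (at level 50, left associativity).
Local Notation "0%n" := (n0 M).
Local Notation "1%n" := (n1 M).
Local Notation ι := (@iota_ M).

Lemma ltE (a b : N) : ltD a b <-> ι a < ι b. Proof. exact: nltE. Qed.

(** For d the denominator and p the cut-off difference of the numerator parts, d ∸ (d ∸ p) is the
    minimum of d and p. *)
Definition Qclip {G : ctx} : term G T1 :=
  (λ q : tN, Qmk · (Qden · $q ∸ (Qden · $q ∸ (Qpos · $q ∸ Qneg · $q))) · 0 · (Qden · $q))%L.
Definition Rclip {G : ctx} : term G (T1 ⇒ T1) := (λ x : T1, λ n : tN, Qclip · ($x · $n))%L.
Definition mRclip := eval (enil M) Rclip.

Lemma val_clip G (r : env M G) q : val (eval r Qclip · q) = clip 0 1 (val q).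
Proof.
have hd := den_gt0 q; rewrite /Qclip; ev; rewrite !evQ val_mk // iE subr0.
have e : val q * ι (mQden M · q) = ι (mQpos M · q) - ι (mQneg M · q).
  by rewrite /val mulfVK // gt_eqF.
apply: (mulIf (lt0r_neq0 hd)); rewrite mulfVK ?gt_eqF //.
have h0 : (val q <= 0) = (ι (mQpos M · q) <= ι (mQneg M · q)).
  by rewrite -[RHS]subr_le0 -e [RHS]pmulr_lle0.
have h1 : (val q <= 1) = (ι (mQpos M · q) - ι (mQneg M · q) <= ι (mQden M · q)).
  by rewrite -e -{2}[ι _]mul1r ler_pM2r.
rewrite /clip h0 h1 !(fun_if (fun v => v * ι (mQden M · q))) mul0r mul1r e.
case: (iota_monus (mQpos M · q) (mQneg M · q)) => -[g1 g2];
case: (iota_monus (mQden M · q) (mMonus M · (mQpos M · q) · (mQneg M · q))) => -[g3 g4];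
case: (iota_monus (mQden M · q) (mMonus M · (mQden M · q) · (mMonus M · (mQpos M · q) · (mQneg M · q)))) => -[g5 ->];
do ?case: ifPn; rewrite -?ltNge; lra.
Qed.

Lemma xv_clip x n : xv (mRclip · x) n = clip 0 1 (xv x n).
Proof. by rewrite /xv /mRclip /Rclip; ev; rewrite val_clip. Qed.

Lemma clip_unit x : isReal x -> unitR (mRclip · x).
Proof.
move=> hx; have hb n := @clip_bound _ 0 1 (xv x n) ler01.
split; first by move=> n i; rewrite !xv_clip; apply: le_lt_trans (clip_lip _ _ ler01) (hx n i).
by split=> n; rewrite ?xv_R0 ?xv_R1 xv_clip; have /andP [] := hb n; have := e_gt0 n; lra.
Qed.

Lemma clip_eqR x y : eqR x y -> eqR (mRclip · x) (mRclip · y).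
Proof. by move=> h n; rewrite !xv_clip; apply: le_trans (clip_lip _ _ ler01) (h n). Qed.

Lemma clip_id x : unitR x -> eqR (mRclip · x) x.
Proof.
move=> [_ [h0 h1]] n; have := h0 n; have := h1 n; rewrite xv_R0 xv_R1 xv_clip.
have := e_gt0 n; rewrite ler_distl /clip.
by do ?case: ifPn; rewrite -?ltNge => *; apply/andP; split; lra.
Qed.

(** WHBU wants a function on all reals, while [Y] respects equality only on [0,1]; hence the
    composition with the retraction [Rclip] onto the unit interval. *)
Definition gauge {G : ctx} : term G ((T1 ⇒ tN) ⇒ T1 ⇒ T1) :=
  (λ Y : T1 ⇒ tN, λ x : T1, RofQ · (Qexp · ($Y · (Rclip · $x) + (1 + 1 + 1))))%L.

Lemma eval_Rclip G (r : env M G) : eval r Rclip = mRclip.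
Proof. exact: eval_closed. Qed.

Lemma xv_gauge Y x n :
  xv (eval (enil M) gauge · Y · x) n = e_ (Y · (mRclip · x)) / 8.
Proof.
by rewrite /gauge; ev; rewrite !evQ eval_Rclip xv_RofQ val_exp !naddA !eS; field.
Qed.

Lemma gauge_real Y x : isReal (eval (enil M) gauge · Y · x).
Proof. by move=> n i; rewrite !xv_gauge subrr normr0 e_gt0. Qed.

Lemma sem_fun_R_Rpos G (r : env M G) (F : term G (T1 ⇒ T1)) :
  (forall x, isReal x -> isReal (eval r F · x) /\ ltR (mR0 M) (eval r F · x)) ->
  (forall x y, isReal x -> isReal y -> eqR x y -> eqR (eval r F · x) (eval r F · y)) ->
  sem (fun_R_Rpos F) r.
Proof.
move=> h1 h2; rewrite /fun_R_Rpos /bind_all; cbn [sem]; split.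
  by move=> x; rewrite !sem_isR sem_Rlt; ev; rewrite evQ; apply: h1.
by move=> x y; rewrite !sem_isR !sem_Req; ev; apply: h2.
Qed.

(** * Lengths of finite unions of intervals *)

Definition differences {G : ctx} : term G ((tN ⇒ T1) ⇒ (tN ⇒ T1) ⇒ tN ⇒ T1) :=
  (λ a : tN ⇒ T1, λ b : tN ⇒ T1, λ i : tN, Rsub · ($b · $i) · ($a · $i))%L.

(** An upper bound on the length rests on one inclusion: the interiors of the listed intervals lie
    in [P]. *)
Lemma sem_total_length G (r : env M G) (P : form (T1 :: G)) (l : term G T1) :
  sem (total_length P l) r ->
  exists (m : N) (a b d : dom M (tN ⇒ T1)),
    [/\ forall i, ι i < ι m -> [/\ isReal (a · i), isReal (b · i) & leR (a · i) (b · i)],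
        forall i, ι (i +n 1%n) < ι m -> leR (b · i) (a · (i +n 1%n)),
        forall x i, isReal x -> ι i < ι m -> ltR (a · i) x -> ltR x (b · i) ->
          sem P (econs x r),
        forall i, d · i = mRsub M · (b · i) · (a · i)
      & eqR (eval r l) (mRsum M · d · m)].
Proof.
rewrite /total_length /bind_all /bind_ex; cbn [sem].
move=> [m [a [b [u [v [h1 [h2 [h3 h4]]]]]]]].
exists m, a, b, (eval (enil M) differences · a · b); split.
- move=> i hi; have := h1 i; rewrite !sem_isR sem_Rle; ev.
  by rewrite ltE => /(_ hi) [? [? ?]].
- by move=> i hi; have := h2 i; rewrite sem_Rle; ev; rewrite ltE; apply.
- move=> x i hx hi hax hxb; have [|_ h] := h3 x; first by rewrite sem_isR; ev.
  move: h; rewrite sem_inst; ev; apply; exists i; rewrite ltE; split=> //.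
  by rewrite /in_itv; cbn [sem]; rewrite !sem_Rlt; ev; split; left.
- by move=> i; rewrite /differences; ev; rewrite evQ.
- move: h4; rewrite sem_Req; ev; rewrite evQ.
  match goal with |- eqR _ (app (app _ ?u) _) -> _ =>
    have -> // : u = eval (enil M) differences · a · b end.
  by apply: m_ext => i; rewrite /differences; ev.
Qed.

Lemma sem_J_set G (r : env M G) (F : term G (T1 ⇒ T1)) (y : term G (tN ⇒ T1))
    (i : term G tN) (x : R) :
  sem (J_set F y i) (econs x r) ->
  let z := eval r y · eval r i in
  ltR (mRsub M · z · (eval r F · z)) x /\ ltR x (mRadd M · z · (eval r F · z)).
Proof. by rewrite /J_set /in_I; cbn [sem]; rewrite !sem_Rlt; ev; rewrite !evQ => -[]. Qed.

(** Adding a rational shifts every approximation equally, so the modulus is kept without the index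
    change of [Radd]. *)
Definition offset {G : ctx} : term G (T1 ⇒ tN ⇒ T1) :=
  (λ x : T1, λ q : tN, λ n : tN, Qadd · ($x · $n) · $q)%L.

Lemma xv_offset x q n : xv (eval (enil M) offset · x · q) n = xv x n + val q.
Proof. by rewrite /xv /offset; ev; rewrite evQ val_add. Qed.

Lemma offset_real x q : isReal x -> isReal (eval (enil M) offset · x · q).
Proof.
move=> hx n i; rewrite !xv_offset (_ : _ - _ = xv x n - xv x (n +n i)) //; lra.
Qed.

(** The ends of an interval may lie outside the set, so they are bounded through the interior points
    a + q and b - q, with q at most e_p. *)
Lemma points_near_ends a b p : isReal a -> isReal b -> ltR a b ->
  exists q, [/\ 0 < val q, val q <= e_ p,
    ltR a (eval (enil M) offset · a · q), ltR (eval (enil M) offset · a · q) b &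
    exists q', [/\ val q' = - val q,
    ltR a (eval (enil M) offset · b · q') & ltR (eval (enil M) offset · b · q') b]].
Proof.
move=> ha hb [n hn].
(* The gap has room for 4 e_r: the offset takes e_r and the margin of the strict inequality at index
   n + r at most 2 e_r. *)
have [|r0 hr0] := @archi M ((xv b n - xv a n - 2 * e_ n) / 4); first by lra.
pose r := r0 +n p.
have hr1 : e_ r <= e_ r0 by exact: eD_le.
have hr2 : e_ r <= e_ p by rewrite /r naddC; exact: eD_le.
have hr := e_gt0 r.
have [q hq] := val_surj (e_ r); have [q' hq'] := val_surj (- e_ r).
have hk : 2 * e_ (r +n 1%n +n 1%n) < e_ r by rewrite !eS; lra.
have hnr : e_ (n +n r) <= e_ r by rewrite naddC; exact: eD_le.
have := ha n r; have := hb n r; rewrite !ltr_distl => /andP [b1 b2] /andP [a1 a2].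
exists q; rewrite hq; split=> //.
- by exists (r +n 1%n +n 1%n); rewrite xv_offset hq; lra.
- by exists (n +n r); rewrite xv_offset hq; lra.
exists q'; rewrite hq'; split=> //.
- by exists (n +n r); rewrite xv_offset hq'; lra.
- by exists (r +n 1%n +n 1%n); rewrite xv_offset hq'; lra.
Qed.

Section Interval.
Variables (y W : R) (w : K).
Hypothesis hy : isReal y.
Hypothesis hW : forall n, xv W n = w.

Lemma interval_left x p : isReal x -> ltR (mRsub M · y · W) x -> xv y p - w - 2 * e_ p < xv x p.
Proof.
move=> hx [n]; rewrite xv_sub hW => h.
have := real_dist (n +n 1%n) p hy; have := real_dist n p hx.
by rewrite !ler_distl eS => /andP [? ?] /andP [? ?]; have := e_gt0 n; lra.
Qed.

Lemma interval_right x p : isReal x -> ltR x (mRadd M · y · W) -> xv x p < xv y p + w + 2 * e_ p.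
Proof.
move=> hx [n]; rewrite xv_add hW => h.
have := real_dist (n +n 1%n) p hy; have := real_dist n p hx.
by rewrite !ler_distl eS => /andP [? ?] /andP [? ?]; have := e_gt0 n; lra.
Qed.

(** Of the error 3 e_p, the offset of the interior test points accounts for e_p and the comparison
    of approximations for 2 e_p. *)
Lemma subinterval a b p : isReal a -> isReal b -> ltR a b ->
  (forall x, isReal x -> ltR a x -> ltR x b ->
     ltR (mRsub M · y · W) x /\ ltR x (mRadd M · y · W)) ->
  xv y p - w - 3 * e_ p <= xv a p /\ xv b p <= xv y p + w + 3 * e_ p.
Proof.
move=> ha hb hab h; have [q [hq0 hq1 h1 h2 [q' [eq' h3 h4]]]] := points_near_ends p ha hb hab.
have [hl _] := h _ (offset_real q ha) h1 h2; have [_ hr] := h _ (offset_real q' hb) h3 h4.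
have := interval_left p (offset_real q ha) hl; have := interval_right p (offset_real q' hb) hr.
by rewrite !xv_offset eq'; lra.
Qed.

Lemma length_le (l : R) (m : N) (a b d : dom M (tN ⇒ T1)) : 0 < w -> isReal l ->
  (forall i, ι i < ι m -> [/\ isReal (a · i), isReal (b · i) & leR (a · i) (b · i)]) ->
  (forall i, ι (i +n 1%n) < ι m -> leR (b · i) (a · (i +n 1%n))) ->
  (forall x i, isReal x -> ι i < ι m -> ltR (a · i) x -> ltR x (b · i) ->
     ltR (mRsub M · y · W) x /\ ltR x (mRadd M · y · W)) ->
  (forall i, d · i = mRsub M · (b · i) · (a · i)) ->
  eqR l (mRsum M · d · m) ->
  forall n, xv l n <= 2 * w + e_ n.
Proof.
move=> hw hl h1 h2 h3 h4 h5 n.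
(* The 12 collects, at an auxiliary index q, 6 from the widened ends of the interval, 3 from the
   telescoping errors, 2 from the equality of reals and 1 from the passage between n and q. *)
apply: (@le_arch M _ _ 12) => // q.
(* [Rsum] reads its terms at index q + m and [Rsub] reads one place further. The summand m makes m
   errors e_p add up to at most e_q / 2. *)
pose p := q +n m +n 1%n.
have hp := e_gt0 p.
have hpq : e_ p <= e_ q by rewrite /p -naddA; exact: eD_le.
have hmp : ι m * e_ p <= e_ q / 2.
  by have := iota_eD m q; rewrite /p eS; lra.
have hA : defq (fun j => val (a · j · p)).
  exists (fun j => mterms_at a p · j); split; first by apply: dfn_app; exact: dfn_id.
  by move=> j; rewrite mterms_atE.
have := @telescope M (fun j => val (a · j · p)) (fun j => val (b · j · p))
  (mterms_at d (q +n m)) m (xv y p - w - 3 * e_ p) (xv y p + w + 3 * e_ p) (e_ p) hA.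
move=> T; have hS : sumq (mterms_at d (q +n m)) m <=
    xv y p + w + 3 * e_ p - (xv y p - w - 3 * e_ p) + 6 * e_ p * ι m.
  apply: T; try by lra.
  - by move=> j; rewrite mterms_atE h4 -/(xv _ _) xv_sub.
  - by move=> j /h1 [_ _ /(_ p)].
  - by move=> j /h2 /(_ p).
  - move=> j hj; have [haj hbj _] := h1 j hj.
    case: (pselect (ltR (a · j) (b · j))) => hab; last by left; move/leRE: hab => /(_ p).
    by right; apply: subinterval => // x hx; apply: h3.
have := h5 q; rewrite xv_sum ler_distl => /andP [_ h6].
have := real_dist n q hl; rewrite ler_distl => /andP [_ h7].
lra.
Qed.
End Interval.

(** * The covering argument *)

Definition centre_values {G : ctx} : term G ((T1 ⇒ tN) ⇒ (tN ⇒ T1) ⇒ T1) :=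
  (λ Y : T1 ⇒ tN, λ y : tN ⇒ T1, λ i : tN, $Y · (Rclip · ($y · $i)))%L.

Lemma centre_valuesE Y y i : eval (enil M) centre_values · Y · y · i = Y · (mRclip · (y · i)).
Proof. by rewrite /centre_values; ev; rewrite eval_Rclip. Qed.

Lemma WHBU_NIN : sem WHBU (enil M) -> sem NIN (enil M).
Proof.
move=> hW; apply: sem_NIN => Y hY hinj.
pose F := eval (enil M) gauge · Y.
pose eps := mRofQ M · (mQexp M · 1%n).
have xv_eps n : xv eps n = 1 / 2.
  by rewrite xv_RofQ val_exp -[1%n]nadd0 naddC eS e0.
rewrite /WHBU /bind_all /bind_ex in hW; cbn [sem] in hW.
have [||| k [y [l [h1 [h2 [h3 h4]]]]]] := hW F eps.
- apply: sem_fun_R_Rpos; ev.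
    move=> x hx; split; first exact: gauge_real.
    have [|n hn] := @small_e M (e_ (Y · (mRclip · x)) / 8); first by have := e_gt0 (Y · (mRclip · x)); lra.
    by exists n; rewrite xv_R0 add0r xv_gauge.
  move=> x x' hx hx' hxx n; rewrite !xv_gauge.
  rewrite (hY _ _ (clip_unit hx) (clip_unit hx') (clip_eqR hxx)) subrr normr0.
  by rewrite mulr_ge0 // ltW // e_gt0.
- by rewrite sem_isR; ev; apply: isReal_RofQ.
- rewrite sem_Rlt; ev; rewrite evQ; have [|n hn] := @small_e M (1 / 2); first by lra.
  by exists n; rewrite xv_R0 xv_eps add0r.
pose Z := eval (enil M) centre_values · Y · y.
have hu i : ι i < ι (k +n 1%n) -> unitR (y · i).
  by move=> hi; have := h1 i; rewrite sem_in01; ev; rewrite ltE; apply.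
(* Equal values make the clipped centres equal by injectivity, and clipping does not change a real
   of [0,1]; so the centres would coincide. *)
have hZ i j : ι i < ι (k +n 1%n) -> ι j < ι (k +n 1%n) -> Z · i = Z · j -> i = j.
  move=> hi hj; rewrite !centre_valuesE => e; apply: contrapT => hij.
  have := h2 i j; rewrite sem_Req; ev; rewrite !ltE => /(_ hi hj hij); apply.
  have [ri rj] := (hu i hi, hu j hj).
  have e1 : eqR (mRclip · (y · i)) (mRclip · (y · j)).
    by apply: hinj => //; apply: clip_unit; [case: ri|case: rj].
  have e2 := eqR_trans (proj1 ri) (proj1 (clip_unit (proj1 rj))) (eqR_sym (clip_id ri)) e1.
  exact: eqR_trans (proj1 ri) (proj1 rj) e2 (clip_id rj).
have hl i : ι i < ι (k +n 1%n) -> forall n, xv (l · i) n <= e_ (Z · i) / 4 + e_ n.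
  move=> hi n; have := h3 i; rewrite sem_isR; ev; rewrite ltE => /(_ hi) [rl /sem_total_length].
  move=> [m [a [b [d [t1 t2 t3 t4 t5]]]]].
  have hg n' : xv (F · (y · i)) n' = e_ (Z · i) / 8 by rewrite xv_gauge centre_valuesE.
  have := length_le (proj1 (hu i hi)) hg _ rl t1 t2 _ t4 _ n.
  have hpos := e_gt0 (Z · i).
  move=> H; have : xv (l · i) n <= 2 * (e_ (Z · i) / 8) + e_ n; last by lra.
  apply: H; first by lra.
    by move=> x j hx hj hax hxb; have := sem_J_set (t3 x j hx hj hax hxb); ev.
  by move: t5; ev.
move: h4; rewrite sem_Rlt; ev; rewrite !evQ => -[n].
rewrite xv_sub xv_R1 xv_eps xv_sum.
set p := n +n _.
have := @sumq_le_lin M (mterms_at l p) (eval (enil M) powers · Z) (1 / 4) (e_ p) (k +n 1%n).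
move=> H hlt; have {}H : sumq (mterms_at l p) (k +n 1%n) <=
    1 / 4 * sumq (eval (enil M) powers · Z) (k +n 1%n) + e_ p * ι (k +n 1%n).
  apply: H => i hi; rewrite mterms_atE val_powers; have := hl i hi p; rewrite /xv; lra.
(* The lengths add up to at most 2/4 and their errors to at most e_n, which is less than the margin
   2 e_n in the strict inequality supplied by WHBU. *)
have := sum_distinct_powers hZ; have := iota_eD (k +n 1%n) n; have := e_gt0 n.
rewrite -/p; lra.
Qed.

End Vitali.

Lemma RCA0w_ext (G : ctx) (r t : fty) (H : list (form G)) (f : term G (r ⇒ t)) (x y : term G r) :
  nd RCA0w H (eqt x y) -> nd RCA0w H (eqt (App f x) (App f y)).
Proof.
apply: nd_impE.
have := nd_allE f (nd_ax H (ax_ext G r t)); rewrite /inst /= => /(nd_allE x).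
rewrite /inst /= => /(nd_allE y); rewrite /inst /= !fsub_eqt /=.
rewrite !tsub_tsub /= !tsub_ids.
exact.
Qed.

Theorem theorem3p4 : (RCA0w ⊢ WHBU --> NIN) /\ (RCA0w ⊢ BCT --> NIN).
Proof.
split; apply: completeness RCA0w_ext _ => str hext hvalid.
  exact: (@WHBU_NIN (Model hext hvalid)).
exact: (@BCT_NIN (Model hext hvalid)).
Qed.
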